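(* Let $\theta\in\mathbb{R}$ and suppose that the family of bounded positive operators $X_t$, $t\ge0$, satisfies the free stochastic differential equation $$dX_t=\theta X_t\,dt+X_t^{1/2}(dW_t)X_t^{1/2},\qquad X_0=I,$$ where $W_t$ is the free Brownian motion. Then the expectation of the resolvent $g=g(t,z)=E[(X_t-z)^{-1}]$, $z\in\mathbb{C}\setminus\mathbb{R}$, satisfies the functional equation $$z+g^{-1}=e^{(\alpha-zg)t},\qquad \alpha=\theta-1.$$ Moreover, for $t>0$, the density of the spectral distribution of $X_t$ is supported on the interval $$\Big[\frac{r_1(t)}{1+r_1(t)}e^{(\alpha-r_1(t))t},\ \frac{r_2(t)}{1+r_2(t)}e^{(\alpha-r_2(t))t}\Big],$$ where $$r_{1}(t)=\frac{-1+\sqrt{1+4/t}}{2},\qquad r_2(t)=\frac{-1-\sqrt{1+4/t}}{2}.$$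
   Context: $(\mathcal{A},E)$ is a $W^*$-probability space: a von Neumann algebra $\mathcal{A}$ with a faithful normal tracial state $E$. Freeness is in the sense of Voiculescu. The spectral distribution of a self-adjoint $X\in\mathcal{A}$ is the probability measure $\mu$ on $\mathbb{R}$ with $E(X^n)=\int x^n\mu(dx)$ for all $n\ge0$. Free Brownian motion (Wigner process): a family of self-adjoint operators $W_t\in\mathcal{A}$, $t\ge 0$, with $W_0=0$, such that for $t>s$ the increment $W_t-W_s$ is free from the subalgebra $\mathcal{W}_s$ generated by $\{W_\tau:\tau\le s\}$ and has the semicircle distribution with mean $0$ and variance $t-s$. Free stochastic integral: if $t\mapsto u_t,v_t$ are norm-continuous, norm-bounded and adapted ($u_t,v_t\in\mathcal{W}_t$), then $\int_p^q u_t(dW_t)v_t$ is the operator-norm limit of the sums $\sum_i u_{\tau_i}(W_{t_i}-W_{t_{i-1}})v_{\tau_i}$ over partitions $p=t_0\le\dots\le t_n=q$ and points $p\le\tau_i\le t_{i-1}$, as $\max_i(t_i-\tau_i)\to0$. (The limit exists and is independent of choices.) That $X_t$ satisfies $dX_t=a(X_t)dt+b(X_t)(dW_t)c(X_t)$ means that $X_t$ is an adapted norm-continuous family of self-adjoint operators with $X_t=X_0+\int_0^t a(X_\tau)d\tau+\int_0^t b(X_\tau)(dW_\tau)c(X_\tau)$. *)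

(* Defs.v *)
From HB Require Import structures.
From mathcomp Require Import all_boot all_order all_algebra.
From mathcomp Require Import complex.
From mathcomp Require Import all_classical all_reals all_analysis.

Set Implicit Arguments.
Unset Strict Implicit.
Unset Printing Implicit Defensive.

Import Order.TTheory GRing.Theory Num.Theory.
Import numFieldNormedType.Exports.

Local Open Scope classical_set_scope.
Local Open Scope ring_scope.
Local Open Scope complex_scope.

Definition cexp (R : realType) (z : R[i]) : R[i] :=
  (expR (complex.Re z) * cos (complex.Im z)) +i*
  (expR (complex.Re z) * sin (complex.Im z)).

Definition ipnorm (R : realType) (H : lmodType R[i])
    (ip : {dot H for Num.conj}) (x : H) : R :=
  Num.sqrt (complex.Re (ip x x)).

Definition ip_complete (R : realType) (H : lmodType R[i])
    (ip : {dot H for Num.conj}) : Prop :=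
  forall x : nat -> H,
    (forall e : R, 0 < e -> exists N : nat, forall m n : nat,
       (N <= m)%N -> (N <= n)%N -> ipnorm ip (x m - x n) < e) ->
    exists l : H, ipnorm ip (x n - l) @[n --> \oo] --> (0 : R).

(* The inner product is linear in its first argument and conjugate-linear in
   its second one. *)
Record hilbertType (R : realType) := HilbertType {
  hsort :> lmodType R[i];
  ip : {dot hsort for Num.conj};
  ip_completeP : ip_complete ip }.

Arguments ip {R h}.

Definition hnorm (R : realType) (H : hilbertType R) (x : H) : R :=
  ipnorm ip x.

Definition bounded_op (R : realType) (H : hilbertType R) (T : H -> H) : Prop :=
  linear T /\ exists c : R, forall x, hnorm (T x) <= c * hnorm x.

Definition adjoint_op (R : realType) (H : hilbertType R) (T T' : H -> H) :
  Prop := forall x y, ip (T x) y = ip x (T' y).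

Definition commutant (R : realType) (H : hilbertType R) (M : set (H -> H)) :
    set (H -> H) :=
  [set T | bounded_op T /\ forall S, M S -> forall x, T (S x) = S (T x)].

(* The bicommutant equation already makes M a unital subalgebra of B(H). *)
Definition von_neumann (R : realType) (H : hilbertType R) (M : set (H -> H)) :
    Prop :=
  [/\ forall T, M T -> bounded_op T,
      forall T, M T -> exists2 T', M T' & adjoint_op T T' &
      commutant (commutant M) = M].

(* A von Neumann algebra acting on the Hilbert space [vn_space].  Its elements
   form an abstract algebra, identified by [act] with the operators of a von
   Neumann algebra.  Since a ring element has at most one inverse and
   [x \is a unit] is equivalent to the existence of an inverse, [unitAlgType]
   imposes nothing beyond being an algebra. *)
Record vnAlgebra (R : realType) := VnAlgebra {
  vn_sort :> unitAlgType R[i];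
  vn_space : hilbertType R;
  act : vn_sort -> vn_space -> vn_space;
  star : vn_sort -> vn_sort;
  act_linear : forall x, linear (act^~ x);
  act1 : act 1 = id;
  actM : forall a b, act (a * b) = act a \o act b;
  act_star : forall a, adjoint_op (act a) (act (star a));
  act_inj : injective act;
  act_von_neumann : von_neumann (range act) }.

Arguments act {R v}.
Arguments star {R v}.

Section OperatorAlgebra.
Variables (R : realType) (A : vnAlgebra R).
Implicit Types (a b : A) (D : set A).

Definition opnorm a : R :=
  sup [set hnorm (act a xi) | xi in [set xi | hnorm xi <= 1]].

Definition selfadjoint a : Prop := star a = a.

(* The order of R[i] makes [0 <= z] include the reality of z. *)
Definition positive a : Prop := forall xi, 0 <= ip (act a xi) xi.

Definition op_le a b : Prop := positive (b - a).

Definition is_op_lub D a : Prop :=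
  [/\ selfadjoint a, forall d, D d -> op_le d a &
      forall b, selfadjoint b -> (forall d, D d -> op_le d b) -> op_le a b].

Definition directed D : Prop :=
  D !=set0 /\ forall a b, D a -> D b -> exists2 c, D c & op_le a c /\ op_le b c.

(* The positive square root; it exists and is unique when a is positive. *)
Definition psqrt a : A := xget 0 [set b | positive b /\ b * b = a].

Definition vn_generated D : set A :=
  [set a | forall N, von_neumann N -> (forall d, D d -> N (act d)) ->
                     N (act a)].

Definition normal_functional (E : A -> R[i]) : Prop :=
  forall D a, (forall d, D d -> selfadjoint d) -> directed D ->
    is_op_lub D a -> supremums [set E d | d in D] (E a).

End OperatorAlgebra.

Record wstarProbSpace (R : realType) := WstarProbSpace {
  wsp_alg :> vnAlgebra R;
  Ex : {scalar wsp_alg};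
  Ex1 : Ex 1 = 1;
  Ex_ge0 : forall a, 0 <= Ex (star a * a);
  Ex_faithful : forall a, Ex (star a * a) = 0 -> a = 0;
  Ex_tracial : forall a b, Ex (a * b) = Ex (b * a);
  Ex_normal : normal_functional Ex }.

Arguments Ex {R w}.

Definition has_density (R : realType) (mu : probability (measurableTypeR R) R)
    (f : R -> R) : Prop :=
  [/\ measurable_fun setT f, forall x, 0 <= f x &
      forall B : set R, measurable B ->
        mu B = (\int[lebesgue_measure]_(x in B) (f x)%:E)%E].

(* Num.sqrt vanishes on negative numbers, hence so does this density outside
   [-2 sqrt v, 2 sqrt v]. *)
Definition semicircle_density (R : realType) (v x : R) : R :=
  Num.sqrt (4 * v - x ^+ 2) / (2 * pi * v).

Section FreeProbability.
Variables (R : realType) (A : wstarProbSpace R).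
Implicit Types (a x : A) (u v W X : R -> A).

Definition spectral_distribution x (mu : probability (measurableTypeR R) R) :
    Prop :=
  forall n : nat, mu.-integrable setT (fun y : R => (y ^+ n)%:E) /\
    Ex (x ^+ n) = (\int[mu]_y (y ^+ n))%:C.

Definition semicircular x (v : R) : Prop :=
  exists mu, spectral_distribution x mu /\ has_density mu (semicircle_density v).

(* Voiculescu freeness of two subalgebras; a word is a list of letters, the
   boolean telling which of the two algebras a letter is taken from. *)
Definition free_algebras (B1 B2 : set A) : Prop :=
  forall s : seq (bool * A), s != [::] ->
    (forall l, l \in s -> (if l.1 then B1 else B2) l.2 /\ Ex l.2 = 0) ->
    sorted (fun l l' => l.1 != l'.1) s ->
    Ex (\prod_(l <- s) l.2) = 0.

(* The unital subalgebra generated by a single element. *)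
Definition poly_algebra x : set A := range (horner_alg x).

Definition past W (s : R) : set A :=
  vn_generated [set W r | r in `[0, s]].

Definition free_brownian_motion W : Prop :=
  [/\ forall t, 0 <= t -> selfadjoint (W t), W 0 = 0 &
      forall s t, 0 <= s -> s < t ->
        free_algebras (poly_algebra (W t - W s)) (past W s) /\
        semicircular (W t - W s) (t - s)].

Definition opnorm_continuous (D : set R) u : Prop :=
  forall t, D t -> opnorm (u s - u t) @[s --> within D (nbhs t)] --> (0 : R).

Definition opnorm_bounded (D : set R) u : Prop :=
  exists c : R, forall t, D t -> opnorm (u t) <= c.

Definition adapted W (D : set R) u : Prop :=
  forall t, D t -> past W t (u t).

Definition is_partition (p q : R) (n : nat) (t : nat -> R) : Prop :=
  [/\ t 0%N = p, t n = q & forall i, (i < n)%N -> t i <= t i.+1].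

Definition is_riemann_integral u (p q : R) (J : A) : Prop :=
  forall e : R, 0 < e -> exists2 d : R, 0 < d &
    forall (n : nat) (t tau : nat -> R), is_partition p q n t ->
      (forall i, (i < n)%N ->
         [/\ t i <= tau i, tau i <= t i.+1 & t i.+1 - t i < d]) ->
      opnorm (\sum_(i < n) (t i.+1 - t i)%:C *: u (tau i) - J) < e.

Definition integrand W (p q : R) u : Prop :=
  [/\ opnorm_continuous `[p, q] u, opnorm_bounded `[p, q] u & adapted W `[p, q] u].

(* J is the integral of u_t (dW_t) v_t over [p, q].  The tag of [t_i, t_(i+1)]
   is not in that interval but lies before t_i, and the mesh is measured
   from the tag. *)
Definition is_free_integral W u v (p q : R) (J : A) : Prop :=
  [/\ integrand W p q u, integrand W p q v &
      forall e : R, 0 < e -> exists2 d : R, 0 < d &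
        forall (n : nat) (t tau : nat -> R), is_partition p q n t ->
          (forall i, (i < n)%N ->
             [/\ p <= tau i, tau i <= t i & t i.+1 - tau i < d]) ->
          opnorm (\sum_(i < n)
            u (tau i) * (W (t i.+1) - W (t i)) * v (tau i) - J) < e].

(* dX_t = a(X_t) dt + b(X_t) (dW_t) c(X_t) *)
Definition free_sde W (a b c : A -> A) X : Prop :=
  [/\ adapted W `[0, +oo[ X,
      opnorm_continuous `[0, +oo[ X,
      forall t, 0 <= t -> selfadjoint (X t) &
      forall t, 0 <= t -> exists J K : A,
        [/\ is_riemann_integral (a \o X) 0 t J,
            is_free_integral W (b \o X) (c \o X) 0 t K &
            X t = X 0 + J + K]].

End FreeProbability.

(* Main.v *)
(* Put [h(t,z) = z E[(X_t - z)^-1] = z g].  Freeness and the semicircle law of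
   the increments give an infinitesimal Ito formula, which turns the equation for
   [X] into a transport equation [d_t h = - z (alpha - h) d_z h].  Its
   characteristics are [zeta(t) = z0 exp((alpha - c) t)], and [h = c] at one time
   iff [h = c] at every time as long as [zeta] avoids the half-line [0, +oo).
   Following them back to [t = 0], where [h = z / (1 - z)], yields the functional
   equation; that they never reach the half-line on the way back comes from
   [Im h > 0] in the upper half-plane, and the same argument bounds [t Im h] by
   [pi].

   This bound on [Im h] is a bound on the Poisson integrals of [u mu(du)], so the
   spectral distribution [mu] is absolutely continuous on [(0, +oo)]; the
   functional equation as [z -> 0] excludes an atom at [0].  For real [h] with
   [0 < h (1 + h) < 1/t] the characteristics with [c = h + i d] start and stay in
   the upper half-plane, and end at distance of order [d] from
   [x = h / (1 + h) exp((alpha - h) t)], where [Im h = d].  Hence [mu] gives mass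
   [O(d^2)] to the interval of radius [d] around [x], and vanishes on every open
   set of such points.  These points fill the complement in [(0, +oo)] of the
   interval between the images of the two roots of [h (1 + h) = 1/t]. *)
Require Import Defs.
From HB Require Import structures.
From mathcomp Require Import all_boot all_order all_algebra.
From mathcomp Require Import complex ring lra.
From mathcomp Require Import all_classical all_reals all_analysis.
From mathcomp Require Import measurable_realfun.

Set Implicit Arguments.
Unset Strict Implicit.
Unset Printing Implicit Defensive.

Import Order.TTheory GRing.Theory Num.Theory.
Import numFieldNormedType.Exports.

Local Open Scope classical_set_scope.
Local Open Scope ring_scope.
Local Open Scope complex_scope.

(** All stochastic estimates are made under [Ex]; no operator-valued Ito formula appears. Continuity
    makes an increment [d] of [X] over a time step [k] small in operator norm, but without a rate,
    whereas [Ex (d * d)] is [O(k)]. Hence the resolvent is expanded to third order: of the three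
    factors [d] in the remainder, two are measured in the trace norm and one in operator norm, so
    the remainder is [o(k)]. The transport equation is never written with derivatives. Along a
    characteristic the increments of [h - c] are estimated with errors uniform near each time, and
    only the vanishing of [h - c] is propagated, by a Gronwall argument that runs in both directions
    of time. On the side of measures there is no functional calculus: [mu] and [X t] share their
    moments only, so a Poisson integral has to be compared with a trace of resolvents through
    polynomials. *)

Notation cmod := ComplexField.Normc.normc.

(** * Modulus, real part and imaginary part of complex numbers *)

Section ComplexModulus.
Variable R : realType.
Implicit Types z w : R[i].

Lemma normcE_cmod z : `|z| = (cmod z)%:C.
Proof. by []. Qed.

Lemma cmod_ge0 z : 0 <= cmod z.
Proof. by case: z => a b; rewrite sqrtr_ge0. Qed.

Lemma cmodM z w : cmod (z * w) = cmod z * cmod w.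
Proof. exact: ComplexField.Normc.normcM. Qed.

Lemma cmodD z w : cmod (z + w) <= cmod z + cmod w.
Proof. exact: le_normcD. Qed.

Lemma cmodN z : cmod (- z) = cmod z.
Proof. exact: normcN. Qed.

Lemma cmodB z w : cmod (z - w) <= cmod z + cmod w.
Proof. by rewrite -(cmodN w) cmodD. Qed.

Lemma cmodBC z w : cmod (z - w) = cmod (w - z).
Proof. by rewrite -cmodN opprB. Qed.

Lemma cmodV z : cmod z^-1 = (cmod z)^-1.
Proof. exact: ComplexField.Normc.normcV. Qed.

Lemma cmod0 : cmod (0 : R[i]) = 0.
Proof. exact: ComplexField.Normc.normc0. Qed.

Lemma cmod1 : cmod (1 : R[i]) = 1.
Proof. exact: ComplexField.Normc.normc1. Qed.

Lemma cmod_eq0 z : (cmod z == 0) = (z == 0).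
Proof.
by apply/eqP/eqP => [/ComplexField.Normc.eq0_normc //|->]; exact: cmod0.
Qed.

Lemma cmod_real (x : R) : cmod x%:C = `|x|.
Proof. by rewrite /cmod/= expr0n/= addr0 sqrtr_sqr. Qed.

Lemma sqr_cmod z : cmod z ^+ 2 = complex.Re z ^+ 2 + complex.Im z ^+ 2.
Proof. by case: z => a b; rewrite sqr_sqrtr// addr_ge0// sqr_ge0. Qed.

Lemma Re_le_cmod z : `|complex.Re z| <= cmod z.
Proof.
by case: z => a b; rewrite /= -sqrtr_sqr ler_sqrt ?lerDl ?addr_ge0 ?sqr_ge0.
Qed.

Lemma Im_le_cmod z : `|complex.Im z| <= cmod z.
Proof.
by case: z => a b; rewrite /= -sqrtr_sqr ler_sqrt ?lerDr ?addr_ge0 ?sqr_ge0.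
Qed.

Lemma cmod_le_ReIm z : cmod z <= `|complex.Re z| + `|complex.Im z|.
Proof.
rewrite -(@ler_pXn2r _ 2)// ?nnegrE ?cmod_ge0 ?addr_ge0// sqr_cmod sqrrD.
by rewrite !real_normK ?num_real// addrAC lerDl mulrn_wge0// mulr_ge0.
Qed.

Lemma cReM z w : complex.Re (z * w) =
  complex.Re z * complex.Re w - complex.Im z * complex.Im w.
Proof. by case: z w => [a b] [c d]. Qed.

Lemma cImM z w : complex.Im (z * w) =
  complex.Re z * complex.Im w + complex.Im z * complex.Re w.
Proof. by case: z w => [a b] [c d]. Qed.

Lemma cReD z w : complex.Re (z + w) = complex.Re z + complex.Re w.
Proof. by case: z w => [a b] [c d]. Qed.

Lemma cImD z w : complex.Im (z + w) = complex.Im z + complex.Im w.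
Proof. by case: z w => [a b] [c d]. Qed.

Lemma cReN z : complex.Re (- z) = - complex.Re z.
Proof. by case: z. Qed.

Lemma cImN z : complex.Im (- z) = - complex.Im z.
Proof. by case: z. Qed.

Lemma complex_eqP z w :
  complex.Re z = complex.Re w -> complex.Im z = complex.Im w -> z = w.
Proof. by case: z w => [a b] [c d] /= -> ->. Qed.

Lemma ge0_realC z : 0 <= z -> z = (complex.Re z)%:C /\ 0 <= complex.Re z.
Proof. by case: z => a b; rewrite lecE/= => /andP[/eqP-> ->]. Qed.

Lemma cmod_sum (I : Type) (s : seq I) (P : pred I) (F : I -> R[i]) :
  cmod (\sum_(i <- s | P i) F i) <= \sum_(i <- s | P i) cmod (F i).
Proof.
elim/big_ind2: _ => [|x y u v h1 h2|//]; first by rewrite cmod0.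
exact: le_trans (cmodD _ _) (lerD h1 h2).
Qed.

End ComplexModulus.

(** * Inner products and the Cauchy-Schwarz inequality *)

Section DotForm.
Variables (R : realType) (H : lmodType R[i]) (d : {dot H for Num.conj}).
Implicit Types x y : H.

Lemma dotDl x y z : d (x + y) z = d x z + d y z.
Proof. exact: linearDl. Qed.

Lemma dotDr x y z : d z (x + y) = d z x + d z y.
Proof. exact: linearDr. Qed.

Lemma dotZl a x y : d (a *: x) y = a * d x y.
Proof. exact: linearZl_LR. Qed.

Lemma dotZr a x y : d x (a *: y) = conjc a * d x y.
Proof. exact: linearZr_LR. Qed.

Lemma dotNl x y : d (- x) y = - d x y.
Proof. exact: linearNl. Qed.

Lemma dotNr x y : d x (- y) = - d x y.
Proof. exact: linearNr. Qed.

Lemma dotC x y : d x y = conjc (d y x).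
Proof. by rewrite hermC/= expr0 mul1r. Qed.

Lemma dot0l y : d 0 y = 0.
Proof. exact: linear0l. Qed.

Lemma ipnorm_ge0 x : 0 <= ipnorm d x.
Proof. exact: sqrtr_ge0. Qed.

Lemma dotE x : d x x = (ipnorm d x ^+ 2)%:C.
Proof.
have [e h] := ge0_realC (dnorm_ge0 d x).
by rewrite {1}e /ipnorm sqr_sqrtr.
Qed.

Lemma ipnorm_eq0 x : ipnorm d x = 0 -> x = 0.
Proof.
by move=> h; apply/eqP; rewrite -(dnorm_eq0 d) dotE h expr0n.
Qed.

Lemma ipnormZ a x : ipnorm d (a *: x) = cmod a * ipnorm d x.
Proof.
apply/eqP; rewrite -(@eqrXn2 _ 2)// ?mulr_ge0 ?ipnorm_ge0 ?cmod_ge0//.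
apply/eqP/complexI; rewrite -dotE dnormZ dotE normcE_cmod.
by rewrite [RHS]/= exprMn -rmorphXn -rmorphM.
Qed.

Lemma cauchy_schwarz x y : cmod (d x y) <= ipnorm d x * ipnorm d y.
Proof.
have [->|y0] := eqVneq y 0.
  by rewrite dotC dot0l conjc0 cmod0 mulr_ge0// ipnorm_ge0.
have yy : 0 < ipnorm d y ^+ 2 by rewrite -ltcR -dotE dnorm_gt0.
rewrite -(@ler_pXn2r _ 2)// ?nnegrE ?cmod_ge0 ?mulr_ge0 ?ipnorm_ge0//.
pose c := d x y / d y y.
have := dnorm_ge0 d (x - c *: y).
rewrite -scaleNr dotDl !dotDr !(dotZl, dotZr) rmorphN [d y x]dotC.
have dy0 : d y y != 0 by rewrite dnorm_eq0.
have cE : conjc c = conjc (d x y) / d y y.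
  by rewrite rmorphM/= conjc_inv [in LHS]dotE conjc_real dotE.
rewrite [X in 0 <= X](_ : _ = d x x - d x y * conjc (d x y) / d y y); last first.
  by rewrite /= cE /c; field.
rewrite -[_ * conjc _]sqr_normc normcE_cmod !dotE.
rewrite -rmorphXn -fmorphV -rmorphM -rmorphB /= ler0c subr_ge0.
by rewrite ler_pdivrMr// exprMn.
Qed.

Lemma ipnormD x y : ipnorm d (x + y) <= ipnorm d x + ipnorm d y.
Proof.
rewrite -(@ler_pXn2r _ 2)// ?nnegrE ?ipnorm_ge0 ?addr_ge0 ?ipnorm_ge0//.
have -> : ipnorm d (x + y) ^+ 2 =
    ipnorm d x ^+ 2 + ipnorm d y ^+ 2 + 2 * complex.Re (d x y).
  apply: complexI; rewrite -dotE dotDl !dotDr [d y x]dotC !dotE.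
  by apply: complex_eqP; rewrite ?(cReD, cImD)/=; case: (d x y) => a b /=; ring.
have := le_trans (ler_norm _) (le_trans (Re_le_cmod _) (cauchy_schwarz x y)).
by nra.
Qed.

Lemma ipnormN x : ipnorm d (- x) = ipnorm d x.
Proof. by rewrite -scaleN1r ipnormZ cmodN cmod1 mul1r. Qed.

Lemma ipnormB x y : ipnorm d (x - y) <= ipnorm d x + ipnorm d y.
Proof. by rewrite -(ipnormN y) ipnormD. Qed.

Lemma ipnorm0 : ipnorm d 0 = 0.
Proof. by rewrite -(scale0r 0) ipnormZ cmod0 mul0r. Qed.

Lemma dot_eqr x y : (forall z, d z x = d z y) -> x = y.
Proof.
move=> h; apply/eqP; rewrite -subr_eq0 -(dnorm_eq0 d) dotDr dotNr h.
by rewrite subrr.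
Qed.

End DotForm.

(** * Operators on a Hilbert space *)

Section Operators.
Variables (R : realType) (A : vnAlgebra R).
Implicit Types (a b : A) (x y : vn_space A).
Local Notation hn := (@hnorm R (vn_space A)).

Lemma hnorm_ge0 x : 0 <= hn x.
Proof. exact: ipnorm_ge0. Qed.

Lemma hnormD x y : hn (x + y) <= hn x + hn y.
Proof. exact: ipnormD. Qed.

Lemma hnormB x y : hn (x - y) <= hn x + hn y.
Proof. exact: ipnormB. Qed.

Lemma hnormN x : hn (- x) = hn x.
Proof. exact: ipnormN. Qed.

Lemma hnormZ k x : hn (k *: x) = cmod k * hn x.
Proof. exact: ipnormZ. Qed.

Lemma hnorm0 : hn 0 = 0.
Proof. exact: ipnorm0. Qed.

Lemma hnorm_small x (d : nat -> R) (c : R) : (forall e, 0 < e -> exists n, d n < e) ->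
  (forall n, hn x <= d n * c) -> 0 <= c -> x = 0.
Proof.
move=> d0 h c0; apply: (@ipnorm_eq0 _ _ ip); apply/eqP; rewrite eq_le.
rewrite ipnorm_ge0 andbT leNgt; apply/negP => x0.
have c1 : 0 < c + 1 by rewrite ltr_wpDl.
have [n dn] := d0 _ (divr_gt0 x0 c1).
have := h n; rewrite leNgt => /negP; apply.
rewrite /hnorm; move: (ipnorm _ x) x0 dn => X X0 dn.
by move: dn; rewrite ltr_pdivlMr// => dn; nra.
Qed.

Lemma act_bounded a : bounded_op (act a).
Proof. by have [h _ _] := @act_von_neumann R A; apply: h; exists a. Qed.

Lemma actDl a b x : act (a + b) x = act a x + act b x.
Proof. by have := act_linear x 1 a b; rewrite !scale1r. Qed.

Lemma act0l x : act (0 : A) x = 0.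
Proof. by apply: (addrI (act 0 x)); rewrite -actDl !addr0. Qed.

Lemma actZl k a x : act (k *: a) x = k *: act a x.
Proof. by have := act_linear x k a 0; rewrite act0l !addr0. Qed.

Lemma actNl a x : act (- a) x = - act a x.
Proof. by rewrite -[- a]scaleN1r actZl scaleN1r. Qed.

Lemma actBl a b x : act (a - b) x = act a x - act b x.
Proof. by rewrite actDl actNl. Qed.

Lemma act1E x : act (1 : A) x = x.
Proof. by rewrite act1. Qed.

Lemma actME a b x : act (a * b) x = act a (act b x).
Proof. by rewrite actM. Qed.

Lemma actDr a x y : act a (x + y) = act a x + act a y.
Proof. by have [h _] := act_bounded a; have := h 1 x y; rewrite !scale1r. Qed.

Lemma act0r a : act a 0 = 0.
Proof. by apply: (addrI (act a 0)); rewrite -actDr !addr0. Qed.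

Lemma actZr k a x : act a (k *: x) = k *: act a x.
Proof. by have [h _] := act_bounded a; have := h k x 0; rewrite act0r !addr0. Qed.

Lemma actNr a x : act a (- x) = - act a x.
Proof. by rewrite -[- x]scaleN1r actZr scaleN1r. Qed.

Lemma actBr a x y : act a (x - y) = act a x - act a y.
Proof. by rewrite actDr actNr. Qed.

Lemma starE a x y : ip (act a x) y = ip x (act (star a) y).
Proof. exact: act_star. Qed.

Lemma starEr a x y : ip x (act a y) = ip (act (star a) x) y.
Proof. by rewrite dotC starE -dotC. Qed.

Lemma act_ext a b : (forall x, act a x = act b x) -> a = b.
Proof. by move=> h; apply: act_inj; apply/funext. Qed.

Lemma star_unique a b : (forall x y, ip (act a x) y = ip x (act b y)) -> star a = b.
Proof.
by move=> h; apply: act_ext => x; apply: (@dot_eqr _ _ ip) => y; rewrite -h starE.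
Qed.

Lemma starK : involutive (@star R A).
Proof. by move=> a; apply: star_unique => x y; rewrite -starEr. Qed.

Lemma starD a b : star (a + b) = star a + star b.
Proof. by apply: star_unique => x y; rewrite !actDl dotDl dotDr !starE. Qed.

Lemma starZ k a : star (k *: a) = conjc k *: star a.
Proof. by apply: star_unique => x y; rewrite !actZl dotZl dotZr conjcK starE. Qed.

Lemma starN a : star (- a) = - star a.
Proof. by rewrite -[- a]scaleN1r starZ rmorphN rmorph1 scaleN1r. Qed.

Lemma starB a b : star (a - b) = star a - star b.
Proof. by rewrite starD starN. Qed.

Lemma starM a b : star (a * b) = star b * star a.
Proof. by apply: star_unique => x y; rewrite !actME !starE. Qed.

Lemma star1 : star (1 : A) = 1.
Proof. by apply: star_unique => x y; rewrite !act1E. Qed.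

Lemma star0 : star (0 : A) = 0.
Proof. by apply: star_unique => x y; rewrite !act0l dot0l dotC dot0l conjc0. Qed.

Lemma opnorm_has_sup a :
  has_sup [set hn (act a xi) | xi in [set xi | hn xi <= 1]].
Proof.
split; first by exists (hn (act a 0)), 0 => //=; rewrite hnorm0.
have [_ [c hc]] := act_bounded a; exists `|c| => _ [x /= x1 <-].
apply: le_trans (hc x) (le_trans (ler_wpM2r (hnorm_ge0 x) (ler_norm c)) _).
by rewrite ler_piMr.
Qed.

Lemma opnorm_ge0 a : 0 <= opnorm a.
Proof.
apply: (@le_trans _ _ (hn (act a 0))); first exact: hnorm_ge0.
apply: ub_le_sup; first by case: (opnorm_has_sup a).
by exists 0 => //=; rewrite hnorm0.
Qed.

Lemma act_le a x : hn (act a x) <= opnorm a * hn x.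
Proof.
have [->|x0] := eqVneq x 0; first by rewrite act0r hnorm0 mulr0.
have xn : 0 < hn x.
  by rewrite lt_def hnorm_ge0 andbT; apply: contra x0 => /eqP/ipnorm_eq0 ->.
have e : hn ((hn x)^-1%:C *: x) = 1.
  by rewrite hnormZ cmod_real ger0_norm ?invr_ge0 ?hnorm_ge0// mulVf ?gt_eqF.
have h : hn (act a ((hn x)^-1%:C *: x)) <= opnorm a.
  apply: ub_le_sup; first by case: (opnorm_has_sup a).
  by exists ((hn x)^-1%:C *: x) => //=; rewrite e.
move: h; rewrite actZr hnormZ cmod_real ger0_norm ?invr_ge0 ?hnorm_ge0//.
by rewrite ler_pdivrMl// mulrC.
Qed.

Lemma opnorm_le a c : 0 <= c -> (forall x, hn (act a x) <= c * hn x) ->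
  opnorm a <= c.
Proof.
move=> c0 h; apply: ge_sup; first by case: (opnorm_has_sup a).
by move=> _ [x /= x1 <-]; rewrite (le_trans (h x))// ler_piMr.
Qed.

Lemma opnormD a b : opnorm (a + b) <= opnorm a + opnorm b.
Proof.
apply: opnorm_le => [|x]; first by rewrite addr_ge0// opnorm_ge0.
by rewrite actDl mulrDl (le_trans (hnormD _ _))// lerD// act_le.
Qed.

Lemma opnormM a b : opnorm (a * b) <= opnorm a * opnorm b.
Proof.
apply: opnorm_le => [|x]; first by rewrite mulr_ge0// opnorm_ge0.
rewrite actME (le_trans (act_le _ _))// -mulrA ler_wpM2l ?opnorm_ge0//.
exact: act_le.
Qed.

Lemma opnormZ_le k a : opnorm (k *: a) <= cmod k * opnorm a.
Proof.
apply: opnorm_le => [|x]; first by rewrite mulr_ge0 ?cmod_ge0 ?opnorm_ge0.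
by rewrite actZl hnormZ -mulrA ler_wpM2l ?cmod_ge0 ?act_le.
Qed.

Lemma opnormN a : opnorm (- a) = opnorm a.
Proof.
have h b : opnorm (- b) <= opnorm b.
  apply: opnorm_le => [|x]; first exact: opnorm_ge0.
  by rewrite actNl hnormN act_le.
by apply/eqP; rewrite eq_le h /= -{1}(opprK a) h.
Qed.

Lemma opnormB a b : opnorm (a - b) <= opnorm a + opnorm b.
Proof. by rewrite -(opnormN b) opnormD. Qed.

Lemma opnormBC a b : opnorm (a - b) = opnorm (b - a).
Proof. by rewrite -opnormN opprB. Qed.

Lemma opnorm0 : opnorm (0 : A) = 0.
Proof.
apply/eqP; rewrite eq_le opnorm_ge0 andbT; apply: opnorm_le => // x.
by rewrite act0l hnorm0 mul0r.
Qed.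

Lemma opnorm1_le : opnorm (1 : A) <= 1.
Proof. by apply: opnorm_le => // x; rewrite act1E mul1r. Qed.

Lemma opnormX_le a n (r : R) : opnorm a <= r -> opnorm (a ^+ n) <= r ^+ n.
Proof.
move=> h; elim: n => [|n ih]; first by rewrite !expr0 opnorm1_le.
rewrite !exprS (le_trans (opnormM _ _))// ler_pM// ?opnorm_ge0//.
Qed.

Lemma opnorm_sum (I : Type) (s : seq I) (P : pred I) (F : I -> A) :
  opnorm (\sum_(i <- s | P i) F i) <= \sum_(i <- s | P i) opnorm (F i).
Proof.
elim/big_ind2: _ => [|x y u v h1 h2|//]; first by rewrite opnorm0.
exact: le_trans (opnormD _ _) (lerD h1 h2).
Qed.

Lemma opnorm_eq0 a : opnorm a = 0 -> a = 0.
Proof.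
move=> h; apply: act_ext => x; rewrite act0l; apply: (@ipnorm_eq0 _ _ ip).
apply/eqP; rewrite eq_le ipnorm_ge0 andbT.
by have := act_le a x; rewrite h mul0r.
Qed.

Lemma opnorm_star_le a : opnorm (star a) <= opnorm a.
Proof.
apply: opnorm_le => [|x]; first exact: opnorm_ge0.
have [->|h0] := eqVneq (hn (act (star a) x)) 0.
  by rewrite mulr_ge0 ?opnorm_ge0 ?hnorm_ge0.
have p : 0 < hn (act (star a) x) by rewrite lt_def h0 hnorm_ge0.
have e : hn (act (star a) x) ^+ 2 <= opnorm a * hn (act (star a) x) * hn x.
  have <- : cmod (ip (act (star a) x) (act (star a) x)) =
      hn (act (star a) x) ^+ 2.
    by rewrite dotE cmod_real ger0_norm// sqr_ge0.
  rewrite -starE; apply: le_trans (cauchy_schwarz _ _ _) _.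
  by rewrite ler_wpM2r ?hnorm_ge0 ?act_le.
by rewrite -(ler_pM2l p); move: e; rewrite expr2 mulrA [_ * opnorm a]mulrC.
Qed.

Lemma opnorm_star a : opnorm (star a) = opnorm a.
Proof.
by apply/eqP; rewrite eq_le opnorm_star_le/= -{1}(starK a) opnorm_star_le.
Qed.

(** The bicommutant equation is what recognizes an operator built by hand, such as a pointwise
    limit, as an element of the algebra. *)
Lemma bicommutant_act (T : vn_space A -> vn_space A) : bounded_op T ->
  (forall S, commutant (range (@act R A)) S -> forall x, T (S x) = S (T x)) ->
  exists a, act a = T.
Proof.
move=> bT h; have [_ _ e] := @act_von_neumann R A.
have : commutant (commutant (range (@act R A))) T by split.
by rewrite e => -[a _ <-]; exists a.
Qed.

(* Completeness, in quantitative form: a sequence whose tails have diameter at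
   most [d n], with [d] arbitrarily small, converges at rate [d]. *)
Lemma opnorm_complete (u : nat -> A) (d : nat -> R) :
  (forall e, 0 < e -> exists n, d n < e) ->
  (forall n m, (n <= m)%N -> opnorm (u m - u n) <= d n) ->
  exists l, forall n, opnorm (l - u n) <= d n.
Proof.
move=> d0 hd.
have dge0 n : 0 <= d n by apply: le_trans (hd n n (leqnn n)); exact: opnorm_ge0.
have ux x n m : (n <= m)%N -> hn (act (u m) x - act (u n) x) <= d n * hn x.
  move=> nm; rewrite -actBl (le_trans (act_le _ _))//.
  by rewrite ler_wpM2r ?hnorm_ge0 ?hd.
have lim x : exists l, forall n, hn (l - act (u n) x) <= d n * hn x.
  have cau : forall e : R, 0 < e -> exists N : nat, forall m n : nat,
      (N <= m)%N -> (N <= n)%N -> ipnorm ip (act (u m) x - act (u n) x) < e.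
    move=> e e0.
    have p : 0 < 2 * (hn x + 1).
      by rewrite mulr_gt0// ltr_wpDl ?hnorm_ge0.
    have [N hN] := d0 _ (divr_gt0 e0 p); exists N => m n Nm Nn.
    have -> : act (u m) x - act (u n) x =
      (act (u m) x - act (u N) x) - (act (u n) x - act (u N) x).
      by rewrite opprB [RHS]addrA subrK.
    apply: le_lt_trans (ipnormB _ _ _) _.
    have := ux x N m Nm; have := ux x N n Nn; rewrite /hnorm.
    move: hN; rewrite ltr_pdivlMr// /hnorm => hN.
    have := ipnorm_ge0 ip x; have := dge0 N; nra.
  have [l /cvgrPdist_lt hl] := @ip_completeP _ _ _ cau.
  exists l => n; apply/ler_addgt0Pr => e e0.
  have [N _ hN] := hl _ e0.
  have h1 := hN (maxn N n) (leq_maxl _ _).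
  have h2 := ux x n (maxn N n) (leq_maxr _ _).
  have -> : l - act (u n) x =
     (act (u (maxn N n)) x - act (u n) x) - (act (u (maxn N n)) x - l).
    by rewrite opprB [RHS]addrC addrA subrK.
  apply: le_trans (hnormB _ _) (lerD h2 _).
  move: h1; rewrite sub0r normrN ger0_norm ?ipnorm_ge0//.
  by move/ltW.
have [T hT] := choice lim.
have Tlin : linear T.
  move=> k x y; apply/eqP; rewrite -subr_eq0; apply/eqP.
  apply: (@hnorm_small _ d (hn (k *: x + y) + cmod k * hn x + hn y)) => //;
    last by rewrite !addr_ge0 ?mulr_ge0 ?hnorm_ge0 ?cmod_ge0.
  move=> n.
  have -> : T (k *: x + y) - (k *: T x + T y) =
    (T (k *: x + y) - act (u n) (k *: x + y)) - k *: (T x - act (u n) x)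
     - (T y - act (u n) y).
    rewrite actDr actZr scalerBr !opprB -[RHS]addrA [X in _ = _ + X]addrACA.
    by rewrite [RHS]addrA subrK opprD.
  rewrite !mulrDr.
  apply: le_trans (hnormB _ _) (lerD _ (hT _ _)).
  apply: le_trans (hnormB _ _) (lerD (hT _ _) _).
  by rewrite hnormZ mulrCA ler_wpM2l ?cmod_ge0.
(* The pointwise limit commutes with the commutant because every [u n] does and the members of the
   commutant are bounded. *)
have [l hl] : exists l, act l = T.
  apply: bicommutant_act.
    split=> //; exists (opnorm (u 0%N) + d 0%N) => x.
    have -> : T x = act (u 0%N) x + (T x - act (u 0%N) x) by rewrite addrC subrK.
    by rewrite mulrDl; apply: le_trans (hnormD _ _) (lerD (act_le _ _) (hT _ _)).
  move=> S [[Slin [c hc]] hS] x; apply/eqP; rewrite -subr_eq0; apply/eqP.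
  have SB y z : S (y - z) = S y - S z.
    by have := Slin (-1) z y; rewrite !scaleN1r [- z + y]addrC => ->; rewrite addrC.
  apply: (@hnorm_small _ d (hn (S x) + `|c| * hn x)) => //;
    last by rewrite addr_ge0 ?mulr_ge0 ?hnorm_ge0.
  move=> n.
  have -> : T (S x) - S (T x) =
      (T (S x) - act (u n) (S x)) - S (T x - act (u n) x).
    rewrite SB (hS (act (u n))); last by exists (u n).
    by rewrite opprB [RHS]addrA subrK.
  rewrite mulrDr; apply: le_trans (hnormB _ _) (lerD (hT _ _) _).
  apply: le_trans (hc _) _.
  have h1 := hT x n; have h2 := ler_norm c; have h3 := hnorm_ge0 (T x - act (u n) x).
  have h4 : 0 <= `|c| by []. 
  apply: le_trans (_ : `|c| * hn (T x - act (u n) x) <= _).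
    by rewrite ler_wpM2r.
  by rewrite mulrCA ler_wpM2l.
exists l => n; apply: opnorm_le => // x.
by rewrite actBl hl hT.
Qed.

End Operators.

(** * Quadratic forms, inverses, resolvents and square roots *)

Section OperatorOrder.
Variables (R : realType) (A : vnAlgebra R).
Implicit Types (a b x y p : A) (xi eta : vn_space A).
Local Notation hn := (@hnorm R (vn_space A)).

Definition qform a xi : R := complex.Re (ip (act a xi) xi).

Lemma qformD a b xi : qform (a + b) xi = qform a xi + qform b xi.
Proof. by rewrite /qform actDl dotDl cReD. Qed.

Lemma qformN a xi : qform (- a) xi = - qform a xi.
Proof. by rewrite /qform actNl dotNl cReN. Qed.

Lemma qformB a b xi : qform (a - b) xi = qform a xi - qform b xi.
Proof. by rewrite qformD qformN. Qed.

Lemma qformZ (r : R) a xi : qform (r%:C *: a) xi = r * qform a xi.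
Proof. by rewrite /qform actZl dotZl cReM/= mul0r subr0. Qed.

Lemma qform1 xi : qform 1 xi = hn xi ^+ 2.
Proof. by rewrite /qform act1E dotE. Qed.

Lemma qform_alg (z : R[i]) xi : qform z%:A xi = complex.Re z * hn xi ^+ 2.
Proof. by rewrite /qform actZl act1E dotZl dotE cReM/= mulr0 subr0. Qed.

Lemma qform_star a xi : qform (star a * a) xi = hn (act a xi) ^+ 2.
Proof. by rewrite /qform actME -starEr dotE. Qed.

Lemma qform_le a xi : `|qform a xi| <= opnorm a * hn xi ^+ 2.
Proof.
apply: le_trans (Re_le_cmod _) (le_trans (cauchy_schwarz _ _ _) _).
by rewrite expr2 mulrA ler_wpM2r ?hnorm_ge0// act_le.
Qed.

Lemma positive_qform a xi : positive a -> 0 <= qform a xi.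
Proof. by move=> /(_ xi)/ge0_realC[]. Qed.

Lemma selfadjoint_real a xi : selfadjoint a ->
  ip (act a xi) xi = (qform a xi)%:C.
Proof.
move=> sa; apply: complex_eqP => //=.
have : ip (act a xi) xi = conjc (ip (act a xi) xi).
  by rewrite -[RHS]dotC [RHS]starEr sa.
by rewrite /qform; case: (ip _ _) => u v [] /eqP; rewrite -addr_eq0 -mulr2n mulrn_eq0/= => /eqP.
Qed.

Lemma selfadjoint_positive a : selfadjoint a ->
  (forall xi, 0 <= qform a xi) -> positive a.
Proof. by move=> sa h xi; rewrite selfadjoint_real// ler0c. Qed.

Lemma selfadjointB a b : selfadjoint a -> selfadjoint b -> selfadjoint (a - b).
Proof. by rewrite /selfadjoint starB => -> ->. Qed.

Lemma selfadjointZ (r : R) a : selfadjoint a -> selfadjoint (r%:C *: a).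
Proof. by rewrite /selfadjoint starZ conjc_real => ->. Qed.

Lemma selfadjoint_star a : selfadjoint (star a * a).
Proof. by rewrite /selfadjoint starM starK. Qed.

Lemma selfadjoint1 : selfadjoint (1 : A).
Proof. exact: star1. Qed.

(* Polarization: [4 Re <x xi, eta>] is the difference of the quadratic form at
   [xi + eta] and [xi - eta]; the parallelogram law then bounds it. *)
Lemma selfadjoint_opnorm_le x (r : R) : selfadjoint x -> 0 <= r ->
  (forall xi, `|qform x xi| <= r * hn xi ^+ 2) -> opnorm x <= r.
Proof.
move=> sa r0 h; apply: opnorm_le => // xi.
have [->|n0] := eqVneq (hn (act x xi)) 0; first by rewrite mulr_ge0 ?hnorm_ge0.
have p : 0 < hn (act x xi) by rewrite lt_def n0 hnorm_ge0.
have [x0|x0] := eqVneq (hn xi) 0.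
  by apply: le_trans (act_le _ _) _; rewrite x0 !mulr0.
have xp : 0 < hn xi by rewrite lt_def x0 hnorm_ge0.
(* [eta] has the direction of [act x xi] and the length of [xi], so [ip (act x xi) eta] is the
   product of the two norms. *)
pose eta := (hn xi / hn (act x xi))%:C *: act x xi.
have en : hn eta = hn xi.
  rewrite hnormZ cmod_real ger0_norm ?divr_ge0 ?hnorm_ge0//.
  by rewrite divfK.
have c : complex.Re (ip (act x xi) eta) = hn xi * hn (act x xi).
  rewrite dotZr conjc_real dotE cReM/= mul0r subr0 -/(hn _).
  by rewrite expr2 mulrA divfK.
have ce : complex.Re (ip (act x eta) xi) = complex.Re (ip (act x xi) eta).
  by rewrite starE sa dotC; case: (ip _ _).
have nD : hn (xi + eta) ^+ 2 + hn (xi - eta) ^+ 2 = 2 * (hn xi ^+ 2 + hn eta ^+ 2).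
  rewrite -!qform1 /qform !act1E !dotDl !dotDr !dotNl !dotNr !(cReD, cReN).
  by ring.
have pol : qform x (xi + eta) - qform x (xi - eta) =
    4 * complex.Re (ip (act x xi) eta).
  rewrite /qform actDr actBr !dotDl !dotDr !dotNl !dotNr !(cReD, cReN) ce.
  by ring.
have h1 := h (xi + eta); have h2 := h (xi - eta).
rewrite ler_norml in h1; rewrite ler_norml in h2.
have {h1 h2} h3 : 4 * (hn xi * hn (act x xi)) <= r * (4 * hn xi ^+ 2).
  rewrite -c -pol (_ : 4 * hn xi ^+ 2 = hn (xi + eta) ^+ 2 + hn (xi - eta) ^+ 2).
    by case/andP: h1 => _ h1; case/andP: h2 => h2 _; lra.
  by rewrite nD en; ring.
by rewrite -(ler_pM2l xp); nra.
Qed.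

Lemma expr_small (r e : R) : 0 <= r -> r < 1 -> 0 < e -> exists n, r ^+ n < e.
Proof.
move=> r0 r1 e0; have r1' : `|r| < 1 by rewrite ger0_norm.
have /cvgrPdist_lt h := cvg_expr r1'; have [N _ hN] := h _ e0.
exists N; have := hN N (leqnn N).
by rewrite /= sub0r normrN ger0_norm ?exprn_ge0.
Qed.

(** The inverse is the sum [s] of the geometric series, reached at rate [r ^+ n / (1 - r)]. Both
    products of [s] with [1 - x] differ from [1] by [O(r ^+ n)], hence not at all. *)
Lemma neumann_unit x (r : R) : opnorm x <= r -> r < 1 -> 1 - x \is a GRing.unit.
Proof.
move=> xr r1.
have r0 : 0 <= r by apply: le_trans xr; exact: opnorm_ge0.
have r1' : 0 < 1 - r by rewrite subr_gt0.
pose S n : A := \sum_(i < n) x ^+ i.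
have [s hs] : exists s, forall n, opnorm (s - S n) <= r ^+ n / (1 - r).
  apply: opnorm_complete.
    move=> e e0; have [n hn] := expr_small r0 r1 (mulr_gt0 e0 r1').
    by exists n; rewrite ltr_pdivrMr.
  move=> n m nm.
  have -> : S m - S n = \sum_(n <= i < m) x ^+ i.
    rewrite /S -!(big_mkord xpredT (fun i => x ^+ i)).
    by rewrite (big_cat_nat (leq0n n) nm)/= addrAC subrr add0r.
  apply: le_trans (opnorm_sum _ _ _) _.
  apply: (@le_trans _ _ (\sum_(n <= i < m) r ^+ i)).
    by apply: ler_sum => i _; exact: opnormX_le.
  have -> : \sum_(n <= i < m) r ^+ i = (r ^+ n - r ^+ m) / (1 - r).
    apply: (canRL (mulfK _)); first by rewrite gt_eqF.
    elim: m nm => [|m ih]; first by rewrite leqn0 => /eqP->; rewrite big_geq// mul0r subrr.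
    rewrite leq_eqVlt => /predU1P[->|]; first by rewrite big_geq// mul0r subrr.
    rewrite ltnS => nm; rewrite big_nat_recr//= mulrDl ih// exprS.
    by ring.
  by rewrite ler_pM2r ?invr_gt0// lerBlDr lerDl exprn_ge0.
have small y z (c : R) : 0 <= c ->
    (forall n, opnorm (y - z) <= c * r ^+ n) -> y = z.
  move=> c0 h; apply/eqP; rewrite -subr_eq0; apply/eqP/opnorm_eq0/eqP.
  rewrite eq_le opnorm_ge0 andbT; apply/ler_addgt0Pr => e e0; rewrite add0r.
  have c1 : 0 < c + 1 by rewrite ltr_wpDl.
  have [n hn] := expr_small r0 r1 (divr_gt0 e0 c1).
  apply: le_trans (h n) _; move: hn; rewrite ltr_pdivlMr// => hn.
  have := exprn_ge0 n r0; nra.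
have com n : S n * (1 - x) = (1 - x) * S n.
  have cx : GRing.comm x (S n).
    by apply: commr_sum => i _; exact: commrX.
  by rewrite mulrBr mulrBl mulr1 mul1r cx.
have xS n : (1 - x) * S n = 1 - x ^+ n.
  by rewrite -[1 - x]opprB mulNr -subrX1 opprB.
have N0 := opnorm_ge0 (1 - x).
have K0 : 0 <= opnorm (1 - x) / (1 - r) + 1.
  by rewrite addr_ge0// divr_ge0// ltW.
apply/unitrP; exists s; split.
  apply: small K0 _ => n.
  have -> : s * (1 - x) - 1 = (s - S n) * (1 - x) - x ^+ n.
    by rewrite mulrBl com xS opprB addrA [RHS]addrAC addrK.
  apply: le_trans (opnormB _ _) _; rewrite [leRHS]mulrDl mul1r lerD ?opnormX_le//.
  apply: le_trans (opnormM _ _) (le_trans (ler_wpM2r N0 (hs n)) _).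
  by rewrite [leLHS]mulrC mulrA mulrAC.
apply: small K0 _ => n.
have -> : (1 - x) * s - 1 = (1 - x) * (s - S n) - x ^+ n.
  by rewrite [in RHS]mulrBr xS opprB addrA [RHS]addrAC addrK.
apply: le_trans (opnormB _ _) _; rewrite [leRHS]mulrDl mul1r lerD ?opnormX_le//.
apply: le_trans (opnormM _ _) (le_trans (ler_wpM2l N0 (hs n)) _).
by rewrite mulrA mulrAC.
Qed.

(** The quadratic form of [1 - p / C] lies between [0] and [1 - c / C]. The case [c = 0] serves the
    square root; [c > 0] gives inverses and the polynomial approximation of [1 / P]. *)
Lemma selfadjoint_contraction p (c C : R) : selfadjoint p -> c <= C -> 0 < C ->
  (forall xi, c * hn xi ^+ 2 <= qform p xi) -> opnorm p <= C ->
  opnorm (1 - C^-1%:C *: p) <= 1 - c / C.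
Proof.
move=> sa cC C0 h pC; apply: selfadjoint_opnorm_le.
- by apply: selfadjointB; [exact: selfadjoint1|exact: selfadjointZ].
- by rewrite subr_ge0 ler_pdivrMr// mul1r.
move=> xi; rewrite qformB qformZ qform1.
have h1 := h xi; have := qform_le p xi; rewrite ler_norml => /andP[_ h2].
have h3 : qform p xi <= C * hn xi ^+ 2.
  by apply: le_trans h2 _; rewrite ler_wpM2r// sqr_ge0.
have e : qform p xi = C * (C^-1 * qform p xi) by rewrite mulVKf// gt_eqF.
have e' : c = C * (c / C) by rewrite mulrC divfK// gt_eqF.
rewrite ger0_norm.
  rewrite mulrBl mul1r lerB//.
  by rewrite -(ler_pM2l C0) -e mulrA -e'.
by rewrite subr_ge0 -(ler_pM2l C0) -e.
Qed.

Lemma coercive_unit p (c : R) : selfadjoint p -> 0 < c ->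
  (forall xi, c * hn xi ^+ 2 <= qform p xi) -> p \is a GRing.unit.
Proof.
move=> sa c0 h; pose C := opnorm p + c.
have C0 : 0 < C by rewrite ltr_wpDl ?opnorm_ge0.
have pC : opnorm p <= C by rewrite lerDl ltW.
have cC : c <= C by rewrite lerDr opnorm_ge0.
have := selfadjoint_contraction sa cC C0 h pC.
move=> /neumann_unit; rewrite opprB addrCA subrr addr0.
rewrite ltrBlDr ltrDl divr_gt0// => /(_ isT) u.
have -> : p = C%:C%:A * (C^-1%:C *: p).
  by rewrite mulr_algl scalerA -rmorphM/= divff ?gt_eqF// scale1r.
rewrite unitrMr//; apply/unitrP; exists (C^-1%:C)%:A.
by rewrite !mulr_algl !scalerA -!rmorphM/= mulVf ?divff ?gt_eqF// scale1r.
Qed.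

Lemma opnorm_inv_le y (d : R) : y \is a GRing.unit -> 0 < d ->
  (forall xi, d * hn xi <= hn (act y xi)) -> opnorm y^-1 <= d^-1.
Proof.
move=> u d0 h; apply: opnorm_le => [|xi]; first by rewrite invr_ge0 ltW.
rewrite ler_pdivlMl//; apply: le_trans (h _) _.
by rewrite -actME divrr// act1E.
Qed.

(* A lower bound for the distance from [z] to the half-line [0, +oo). *)
Definition dist_halfline (z : R[i]) : R := Num.max `|complex.Im z| (- complex.Re z).

(** By Cauchy-Schwarz it suffices to bound [ip (act (x - z%:A) xi) xi]. Its imaginary part is
    [- Im z] times [hn xi ^+ 2], and its real part is at least [- Re z] times [hn xi ^+ 2] since [x]
    is positive. *)
Lemma resolvent_lower_bound x (z : R[i]) xi : selfadjoint x -> positive x ->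
  dist_halfline z * hn xi <= hn (act (x - z%:A) xi).
Proof.
move=> sa px; have [->|n0] := eqVneq (hn xi) 0; first by rewrite mulr0 hnorm_ge0.
have n1 : 0 < hn xi by rewrite lt_def n0 hnorm_ge0.
rewrite -(ler_pM2r n1).
apply: le_trans (cauchy_schwarz ip _ _).
have e : ip (act (x - z%:A) xi) xi = (qform x xi)%:C - z * (hn xi ^+ 2)%:C.
  by rewrite actBl dotDl dotNl actZl act1E dotZl dotE selfadjoint_real.
have q0 := positive_qform xi px.
rewrite e -mulrA -expr2 /dist_halfline maxEle; case: ifP => _.
  apply: le_trans (le_trans (ler_norm _) (Re_le_cmod _)).
  by rewrite cReD cReN cReM/= mulr0 subr0 mulNr lerDr.
apply: le_trans (Im_le_cmod _).
rewrite cImD cImN cImM/= mulr0 !add0r normrN normrM.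
by rewrite [X in _ <= _ * X]ger0_norm ?sqr_ge0.
Qed.

Lemma star_resolvent x (z : R[i]) : selfadjoint x -> star (x - z%:A) = x - (conjc z)%:A.
Proof. by move=> sa; rewrite starB starZ star1 sa. Qed.

Lemma comm_resolvent x (z w : R[i]) : GRing.comm (x - z%:A) (x - w%:A).
Proof.
apply: commrB; apply: commr_sym; apply: commrB => //.
- by apply: commr_sym; exact: comm_alg.
- exact: comm_alg.
- exact: comm_alg.
Qed.

(** A lower bound on [x - z%:A] alone does not give surjectivity. But [star (x - z%:A) * (x - z%:A)]
    is selfadjoint and coercive, hence invertible, and its two factors commute. *)
Lemma resolvent_unit x (z : R[i]) : selfadjoint x -> positive x ->
  0 < dist_halfline z -> x - z%:A \is a GRing.unit.
Proof.
move=> sa px d0; have u : star (x - z%:A) * (x - z%:A) \is a GRing.unit.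
  apply: (@coercive_unit _ (dist_halfline z ^+ 2)); first exact: selfadjoint_star.
  - by rewrite exprn_gt0.
  - move=> xi; rewrite qform_star -exprMn ler_pXn2r ?nnegrE ?hnorm_ge0 ?mulr_ge0 ?hnorm_ge0 ?(ltW d0)//.
    exact: resolvent_lower_bound.
move: u; rewrite unitrM_comm; first by case/andP.
by rewrite star_resolvent//; exact: comm_resolvent.
Qed.

Lemma opnorm_resolvent x (z : R[i]) : selfadjoint x -> positive x ->
  0 < dist_halfline z -> opnorm (x - z%:A)^-1 <= (dist_halfline z)^-1.
Proof.
move=> sa px d0; apply: opnorm_inv_le => // [|xi]; first exact: resolvent_unit.
exact: resolvent_lower_bound.
Qed.

Lemma opnorm_small a (c : R) (d : nat -> R) : (forall e, 0 < e -> exists n, d n < e) ->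
  0 <= c -> (forall n, opnorm a <= c * d n) -> a = 0.
Proof.
move=> d0 c0 h; apply/opnorm_eq0/eqP; rewrite eq_le opnorm_ge0 andbT.
apply/ler_addgt0Pr => e e0; rewrite add0r.
have c1 : 0 < c + 1 by rewrite ltr_wpDl.
have [n hn] := d0 _ (divr_gt0 e0 c1).
apply: le_trans (h n) _; move: hn; rewrite ltr_pdivlMr// => hn.
have [dn|dn] := leP 0 (d n); nra.
Qed.

(* The square root of [1 - x] is [1 - y], where [y] is the least fixed point of
   [y = (x + y^2) / 2]; the scalar iteration with [x = 1] dominates the
   operator one. *)
Fixpoint sqrt_iter x n : A :=
  if n is n'.+1 then (2^-1)%:C *: (x + sqrt_iter x n' * sqrt_iter x n') else 0.

Fixpoint sqrt_iter1 n : R :=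
  if n is n'.+1 then 2^-1 * (1 + sqrt_iter1 n' * sqrt_iter1 n') else 0.

Lemma sqrt_iter1_bounds n : 0 <= sqrt_iter1 n <= sqrt_iter1 n.+1 /\ sqrt_iter1 n <= 1.
Proof.
elim: n => [|n [/andP[h1 h2] h3]] /=; first by split; [apply/andP; split; lra|lra].
move: h2; rewrite /=; set p := sqrt_iter1 n in h1 h3 *; set q := 2^-1 * _ => h2.
have q0 : 0 <= q by lra.
have q1 : q <= 1 by rewrite /q; nra.
split=> //; rewrite q0/= {1}/q; nra.
Qed.

(** The splitting [a * a - b * b = a * (a - b) + (a - b) * b] needs no commutativity, and it bounds
    each operator increment by the scalar one. *)
Lemma opnorm_sqrt_iter x n : opnorm x <= 1 ->
  opnorm (sqrt_iter x n) <= sqrt_iter1 n /\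
  opnorm (sqrt_iter x n.+1 - sqrt_iter x n) <= sqrt_iter1 n.+1 - sqrt_iter1 n.
Proof.
move=> x1; have half : cmod (2^-1)%:C = 2^-1 :> R by rewrite cmod_real ger0_norm ?invr_ge0.
elim: n => [|n [h1 h2]].
  split; first by rewrite /= opnorm0.
  rewrite /= !mulr0 !subr0 !addr0; apply: le_trans (opnormZ_le _ _) _.
  by rewrite half ler_wpM2l ?invr_ge0.
have [/andP[p0 _] _] := sqrt_iter1_bounds n.
have h3 : opnorm (sqrt_iter x n.+1) <= sqrt_iter1 n.+1.
  apply: le_trans (opnormZ_le _ _) _; rewrite half/= ler_wpM2l ?invr_ge0//.
  apply: le_trans (opnormD _ _) (lerD x1 (le_trans (opnormM _ _) _)).
  by rewrite ler_pM ?opnorm_ge0.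
split=> //.
have e : sqrt_iter x n.+2 - sqrt_iter x n.+1 = (2^-1)%:C *:
  (sqrt_iter x n.+1 * (sqrt_iter x n.+1 - sqrt_iter x n) +
   (sqrt_iter x n.+1 - sqrt_iter x n) * sqrt_iter x n).
  rewrite mulrBr mulrBl addrA subrK.
  rewrite [sqrt_iter x n.+2]/= [X in _ - X]/= -scalerBr; congr (_ *: _).
  by rewrite opprD addrACA subrr add0r.
have e1 : sqrt_iter1 n.+2 - sqrt_iter1 n.+1 = 2^-1 *
  (sqrt_iter1 n.+1 * (sqrt_iter1 n.+1 - sqrt_iter1 n) +
   (sqrt_iter1 n.+1 - sqrt_iter1 n) * sqrt_iter1 n).
  have rE k : sqrt_iter1 k.+1 = 2^-1 * (1 + sqrt_iter1 k * sqrt_iter1 k) by [].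
  by rewrite (rE n.+1) [X in _ - X = _](rE n); ring.
rewrite e e1; apply: le_trans (opnormZ_le _ _) _; rewrite half ler_wpM2l ?invr_ge0//.
apply: le_trans (opnormD _ _) (lerD _ _).
  by apply: le_trans (opnormM _ _) _; rewrite ler_pM ?opnorm_ge0.
by apply: le_trans (opnormM _ _) _; rewrite ler_pM ?opnorm_ge0.
Qed.

Lemma sqrt_one_sub x : selfadjoint x -> opnorm x <= 1 ->
  exists b, [/\ selfadjoint b, positive b & b * b = 1 - x].
Proof.
move=> sa x1.
pose P := range sqrt_iter1.
have hP : has_sup P.
  split; first by exists 0, 0%N.
  by exists 1 => _ [n _ <-]; have [] := sqrt_iter1_bounds n.
(* The scalar iteration is monotone and bounded, so its tail [d] becomes arbitrarily small; it
   serves as rate of convergence for the operators. *)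
pose d n := sup P - sqrt_iter1 n.
have dsmall e : 0 < e -> exists n, d n < e.
  move=> e0; have [_ [n _ <-] h] := sup_adherent e0 hP.
  by exists n; rewrite /d ltrBlDl -ltrBlDr.
have dn m : 0 <= d m.
  by rewrite subr_ge0; apply: ub_le_sup; [case: hP|exists m].
have hd n m : (n <= m)%N ->
    opnorm (sqrt_iter x m - sqrt_iter x n) <= sqrt_iter1 m - sqrt_iter1 n.
  elim: m => [|m ih]; first by rewrite leqn0 => /eqP->; rewrite !subrr opnorm0.
  rewrite leq_eqVlt => /predU1P[->|]; first by rewrite !subrr opnorm0.
  rewrite ltnS => nm; have [_ h] := opnorm_sqrt_iter m x1.
  rewrite -(subrK (sqrt_iter x m) (sqrt_iter x m.+1)) -addrA.
  rewrite -(subrK (sqrt_iter1 m) (sqrt_iter1 m.+1)) -[leRHS]addrA.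
  by apply: le_trans (opnormD _ _) (lerD h (ih nm)).
have [y hy] : exists y, forall n, opnorm (y - sqrt_iter x n) <= d n.
  apply: opnorm_complete => // n m nm; apply: le_trans (hd n m nm) _.
  by rewrite lerB//; apply: ub_le_sup; [case: hP|exists m].
have y1 : opnorm y <= 1.
  apply/ler_addgt0Pr => e /dsmall[n hn].
  rewrite -(subrK (sqrt_iter x n) y) addrC.
  apply: le_trans (opnormD _ _) (lerD _ (le_trans (hy n) (ltW hn))).
  have [h _] := opnorm_sqrt_iter n x1; apply: le_trans h _.
  by have [] := sqrt_iter1_bounds n.
have say : star y = y.
  apply/eqP; rewrite -subr_eq0; apply/eqP.
  apply: (@opnorm_small _ 2 d) => // n.
  have sn : star (sqrt_iter x n) = sqrt_iter x n.
    by elim: n => [|n ih]; rewrite /= ?star0// starZ conjc_real starD starM sa ih.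
  rewrite -(subrK (sqrt_iter x n) (star y)) -addrA -{1}sn -starB.
  apply: le_trans (opnormD _ _) _; rewrite opnorm_star opnormBC.
  rewrite [X in _ + X]opnormBC.
  have := hy n; rewrite opnormBC; lra.
have fix_y : y = (2^-1)%:C *: (x + y * y).
  apply/eqP; rewrite -subr_eq0; apply/eqP.
  apply: (@opnorm_small _ 2 d) => // n.
  have -> : y - (2^-1)%:C *: (x + y * y) = (y - sqrt_iter x n.+1) -
     (2^-1)%:C *: (y * (y - sqrt_iter x n) + (y - sqrt_iter x n) * sqrt_iter x n).
    rewrite mulrBr mulrBl addrA subrK [sqrt_iter x n.+1]/=.
    by rewrite -[RHS]addrA -opprD -scalerDr addrACA subrr addr0.
  apply: le_trans (opnormB _ _) _; rewrite [leRHS]mulrDl mul1r.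
  apply: lerD.
    apply: le_trans (hy _) _; rewrite lerB//.
    by have [/andP[]] := sqrt_iter1_bounds n.
  apply: le_trans (opnormZ_le _ _) _; rewrite cmod_real ger0_norm ?invr_ge0//.
  rewrite ler_pdivrMl//.
  apply: le_trans (opnormD _ _) _; rewrite [leRHS]mulrDl mul1r; apply: lerD.
    by apply: le_trans (opnormM _ _) _; rewrite -[leRHS]mul1r ler_pM ?opnorm_ge0.
  apply: le_trans (opnormM _ _) _; rewrite -[leRHS]mulr1 ler_pM ?opnorm_ge0//.
  have [h _] := opnorm_sqrt_iter n x1; apply: le_trans h _.
  by have [] := sqrt_iter1_bounds n.
exists (1 - y); split.
- by apply: selfadjointB => //; exact: selfadjoint1.
- apply: selfadjoint_positive; first by apply: selfadjointB => //; exact: selfadjoint1.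
  move=> xi; rewrite qformB qform1 subr_ge0.
  apply: le_trans (ler_norm _) (le_trans (qform_le _ _) _).
  by rewrite ler_piMl// sqr_ge0.
(* The fixed point equation doubled; it amounts to [(1 - y) * (1 - y) = 1 - x]. *)
have e2 : x + y * y = y + y.
  rewrite -mulr2n -scaler_nat [in RHS]fix_y scalerA.
  by rewrite (_ : 2%:R * _ = 1) ?scale1r// -(rmorph_nat (real_complex R)) -rmorphM/= divff.
have e3 : y * y - y = y - x by rewrite -[y * y](addKr x) e2 addrA addrK addrC.
by rewrite mulrBr mulr1 mulrBl mul1r opprB e3 addrA subrK.
Qed.

Lemma positive_sqrt a : selfadjoint a -> positive a ->
  exists b, [/\ selfadjoint b, positive b & b * b = a].
Proof.
move=> sa pa; pose C := opnorm a + 1.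
have C0 : 0 < C by rewrite ltr_wpDl ?opnorm_ge0.
have c : opnorm (1 - C^-1%:C *: a) <= 1.
  rewrite -[leRHS]subr0 -[X in _ <= _ - X](mul0r C^-1).
  apply: selfadjoint_contraction => //; first exact: ltW.
    by move=> xi; rewrite mul0r positive_qform.
  by rewrite lerDl.
have [|b [sb pb e]] := sqrt_one_sub _ c.
  by apply: selfadjointB; [exact: selfadjoint1|exact: selfadjointZ].
exists ((Num.sqrt C)%:C *: b); split; first exact: selfadjointZ.
- apply: selfadjoint_positive; first exact: selfadjointZ.
  by move=> xi; rewrite qformZ mulr_ge0 ?sqrtr_ge0 ?positive_qform.
- rewrite -scalerAl -scalerAr e scalerA opprB addrCA subrr addr0 scalerA.
  rewrite -!rmorphM/= -expr2 sqr_sqrtr ?(ltW C0)//.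
  by rewrite divff ?gt_eqF// scale1r.
Qed.

Lemma psqrtP a : selfadjoint a -> positive a ->
  positive (psqrt a) /\ psqrt a * psqrt a = a.
Proof.
move=> sa pa; have [b [_ pb bb]] := positive_sqrt sa pa.
by rewrite /psqrt; case: xgetP => [c -> //|/(_ b)]; case.
Qed.

End OperatorOrder.

(** * The trace and its Hilbert norm *)

Section TracialState.
Variables (R : realType) (A : wstarProbSpace R).
Implicit Types (a b c d x y : A).

Lemma ExD a b : Ex (a + b) = Ex a + Ex b.
Proof. exact: raddfD. Qed.

Lemma ExB a b : Ex (a - b) = Ex a - Ex b.
Proof. exact: raddfB. Qed.

Lemma ExN a : Ex (- a) = - Ex a.
Proof. exact: raddfN. Qed.

Lemma Ex0 : Ex (0 : A) = 0.
Proof. exact: raddf0. Qed.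

Lemma ExZ k a : Ex (k *: a) = k * Ex a.
Proof. exact: linearZ. Qed.

Lemma Ex_alg k : Ex (k%:A : A) = k.
Proof. by rewrite ExZ Ex1 mulr1. Qed.

(** Since [Ex (star (1 + b) * (1 + b))] is real, the imaginary parts of [Ex b] and [Ex (star b)]
    cancel. For [b = a] this compares imaginary parts, for [b] equal to [i] times [a] it compares
    real parts. *)
Lemma Ex_star a : Ex (star a) = conjc (Ex a).
Proof.
have im0 z : 0 <= z -> complex.Im z = 0 :> R by case/ge0_realC => ->.
have h b : complex.Im (Ex b) + complex.Im (Ex (star b)) = 0.
  have := im0 _ (Ex_ge0 (1 + b)); rewrite starD star1 mulrDl mul1r mulrDr mulr1.
  rewrite !ExD !cImD Ex1/= (im0 _ (Ex_ge0 b)) addr0 add0r => <-.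
  by rewrite addrC.
apply: complex_eqP.
  have := h ((0 +i* 1) *: a); rewrite starZ !ExZ !cImM.
  rewrite /= !mul0r !mul1r !add0r mulN1r => /eqP.
  by rewrite subr_eq0 => /eqP <-; case: (Ex a).
by have /eqP := h a; rewrite addrC addr_eq0 => /eqP ->; case: (Ex a).
Qed.

(** The squared norm of the GNS space of the trace. *)
Definition tnorm2 a : R := complex.Re (Ex (star a * a)).

Lemma tnorm2E a : Ex (star a * a) = (tnorm2 a)%:C.
Proof. by have [] := ge0_realC (Ex_ge0 a). Qed.

Lemma tnorm2_ge0 a : 0 <= tnorm2 a.
Proof. by have [] := ge0_realC (Ex_ge0 a). Qed.

Lemma tnorm2_eq0 a : tnorm2 a = 0 -> a = 0.
Proof. by move=> h; apply: Ex_faithful; rewrite tnorm2E h. Qed.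

Lemma tnorm2_star a : tnorm2 (star a) = tnorm2 a.
Proof. by rewrite /tnorm2 starK Ex_tracial. Qed.

Lemma Ex_cauchy_schwarz a b :
  cmod (Ex (star b * a)) ^+ 2 <= tnorm2 a * tnorm2 b.
Proof.
have [b0|b0] := eqVneq (tnorm2 b) 0.
  by rewrite (tnorm2_eq0 b0) star0 mul0r raddf0 cmod0 expr0n mulr_ge0 ?tnorm2_ge0.
have bp : 0 < tnorm2 b by rewrite lt_def b0 tnorm2_ge0.
pose k := Ex (star b * a) / (tnorm2 b)%:C.
have := Ex_ge0 (a - k *: b).
have ab : Ex (star a * b) = conjc (Ex (star b * a)).
  by rewrite -Ex_star starM starK.
rewrite starB starZ mulrBl !mulrBr -!scalerAl -!scalerAr !ExB !ExZ !tnorm2E ab.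
have kE : conjc k = conjc (Ex (star b * a)) / (tnorm2 b)%:C.
  by rewrite rmorphM; congr (_ * _); rewrite -[LHS]/(conjc _) conjc_inv conjc_real.
have nz : (tnorm2 b)%:C != 0 :> R[i] by rewrite -(rmorph0 (real_complex R)) (inj_eq (@complexI R)).
rewrite [X in 0 <= X](_ : _ = (tnorm2 a)%:C -
    Ex (star b * a) * conjc (Ex (star b * a)) / (tnorm2 b)%:C); last first.
  by rewrite kE /k; field.
rewrite -[_ * conjc _]sqr_normc normcE_cmod.
rewrite -rmorphXn -fmorphV -rmorphM -rmorphB /= ler0c subr_ge0.
by rewrite ler_pdivrMr.
Qed.

(** [opnorm a ^+ 2 - star a * a] is positive, hence a square [d * d], and the claim is that [d * b]
    has nonnegative squared norm. *)
Lemma tnorm2M_le a b : tnorm2 (a * b) <= opnorm a ^+ 2 * tnorm2 b.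
Proof.
pose p := (opnorm a ^+ 2)%:C *: 1 - star a * a.
have sp : selfadjoint p.
  by apply: selfadjointB; [apply: selfadjointZ; exact: selfadjoint1|exact: selfadjoint_star].
have [|d [sd _ dd]] := positive_sqrt sp.
  apply: selfadjoint_positive => // xi.
  rewrite qformB qform_star qformZ qform1 subr_ge0 -exprMn.
  rewrite ler_pXn2r ?nnegrE ?mulr_ge0 ?opnorm_ge0 ?hnorm_ge0//.
  exact: act_le.
have := Ex_ge0 (d * b); rewrite starM sd mulrA -[star b * d * d]mulrA dd.
rewrite /p mulrBr mulrBl ExB -scalerAr -scalerAl mulr1 ExZ tnorm2E.
have -> : star b * (star a * a) * b = star (a * b) * (a * b).
  by rewrite starM !mulrA.
by rewrite tnorm2E -rmorphM -rmorphB/= ler0c subr_ge0.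
Qed.

Lemma tnorm2_le a : tnorm2 a <= opnorm a ^+ 2.
Proof.
have := tnorm2M_le a 1; rewrite mulr1.
by rewrite {2}/tnorm2 star1 mulr1 Ex1/= mulr1.
Qed.

Lemma Ex_le a : cmod (Ex a) <= opnorm a.
Proof.
have := Ex_cauchy_schwarz a 1; rewrite star1 mul1r.
rewrite {2}/tnorm2 star1 mulr1 Ex1/= mulr1 => h.
rewrite -(@ler_pXn2r _ 2)// ?nnegrE ?cmod_ge0 ?opnorm_ge0//.
exact: le_trans h (tnorm2_le a).
Qed.

(** Cauchy-Schwarz for the trace; traciality gives [x * d] and [d * star x] the same norm. Both
    factors [d] end up in trace norm, where an increment of [X] has the right order in time. *)
Lemma Ex_quadratic_le x y d : selfadjoint d ->
  cmod (Ex (x * d * (y * d))) <= opnorm x * opnorm y * tnorm2 d.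
Proof.
move=> sd.
rewrite -(@ler_pXn2r _ 2)// ?nnegrE ?cmod_ge0 ?mulr_ge0 ?opnorm_ge0 ?tnorm2_ge0//.
have -> : x * d = star (d * star x) by rewrite starM starK sd.
apply: le_trans (Ex_cauchy_schwarz _ _) _.
have h1 := tnorm2M_le y d.
have h2 := tnorm2M_le x d.
have e : tnorm2 (d * star x) = tnorm2 (x * d).
  by rewrite -[in RHS]tnorm2_star starM sd.
rewrite e.
apply: le_trans (ler_pM (tnorm2_ge0 _) (tnorm2_ge0 _) h1 h2) _.
by rewrite !exprMn; lra.
Qed.

End TracialState.

(** * The algebra generated by the Brownian motion up to a given time *)

Section Past.
Variables (R : realType) (A : wstarProbSpace R) (W : R -> A) (s : R).
Implicit Types (a b : A).
Local Notation P := (past W s).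

Lemma commutant_linear (H : hilbertType R) (M : set (H -> H)) (T : H -> H) :
  commutant M T -> forall x y, T (x + y) = T x + T y.
Proof. by move=> [[h _] _] x y; have := h 1 x y; rewrite !scale1r. Qed.

(** Membership becomes commutation with commutants, a condition that sums, products and inverses
    inherit by pure algebra. *)
Lemma pastP a : P a <-> forall N : set (vn_space A -> vn_space A), von_neumann N ->
  (forall d, [set W r | r in `[0, s]] d -> N (act d)) ->
  forall S, commutant N S -> forall x, act a (S x) = S (act a x).
Proof.
split=> h N vN hN.
  have [_ _ e] := vN; move=> S hS x.
  by have := h N vN hN; rewrite -e => -[_]; exact.
have [_ _ e] := vN; rewrite -e; split; first exact: act_bounded.
exact: h.
Qed.

Lemma pastD a b : P a -> P b -> P (a + b).
Proof.
move=> /pastP ha /pastP hb; apply/pastP => N vN hN S hS x.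
by rewrite !actDl (commutant_linear hS) (ha N) // (hb N).
Qed.

Lemma pastM a b : P a -> P b -> P (a * b).
Proof.
move=> /pastP ha /pastP hb; apply/pastP => N vN hN S hS x.
by rewrite !actME (hb N) // (ha N).
Qed.

Lemma past1 : P 1.
Proof. by apply/pastP => N vN hN S hS x; rewrite !act1E. Qed.

Lemma pastZ k a : P a -> P (k *: a).
Proof.
move=> /pastP ha; apply/pastP => N vN hN S hS x.
rewrite !actZl (ha N) //; have [[h _] _] := hS.
have S0 : S 0 = 0 by apply: (addrI (S 0)); rewrite -(commutant_linear hS) !addr0.
by have := h k (act a x) 0; rewrite S0 !addr0.
Qed.

Lemma pastN a : P a -> P (- a).
Proof. by move=> h; rewrite -scaleN1r; exact: pastZ. Qed.

Lemma pastB a b : P a -> P b -> P (a - b).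
Proof. by move=> ha hb; apply: pastD => //; exact: pastN. Qed.

Lemma past0 : P 0.
Proof. by rewrite -(scale0r 1); apply: pastZ; exact: past1. Qed.

Lemma past_alg k : P k%:A.
Proof. by apply: pastZ; exact: past1. Qed.

Lemma pastV a : a \is a GRing.unit -> P a -> P a^-1.
Proof.
move=> u /pastP ha; apply/pastP => N vN hN S hS x.
rewrite -[in LHS](act1E x) -(divrr u) actME -(ha N vN hN S hS).
by rewrite -actME mulVr// act1E.
Qed.

Lemma past_generator r : 0 <= r <= s -> P (W r).
Proof. by move=> rs N vN hN; apply: hN; exists r => //=; rewrite in_itv. Qed.

End Past.

Lemma past_mono (R : realType) (A : wstarProbSpace R) (W : R -> A) (r s : R) (a : A) :
  r <= s -> past W r a -> past W s a.
Proof.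
move=> rs h N vN hN; apply: h => // d [q /=]; rewrite in_itv/= => /andP[q0 qr] <-.
by apply: hN; exists q => //=; rewrite in_itv/= q0 (le_trans qr).
Qed.

(** * Free increments *)

Section Semicircle.
Variable R : realType.
Implicit Types (mu : probability (measurableTypeR R) R) (f rho : R -> R).
Local Notation leb := (@lebesgue_measure R).

Lemma density_dominates mu rho : has_density mu rho -> mu `<< leb.
Proof.
move=> [mrho rho0 h]; apply/null_content_dominatesP => S mS S0.
rewrite h//; apply: null_set_integral => //.
- by apply/measurable_EFinP; exact: measurable_funTS.
Qed.

Lemma density_integral mu rho f : has_density mu rho ->
  mu.-integrable setT (EFin \o f) ->
  (\int[mu]_x (f x)%:E = \int[leb]_x (f x * rho x)%:E)%E.
Proof.
move=> hd fi; have numu := density_dominates hd.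
have [mrho rho0 h] := hd.
rewrite -(@Radon_Nikodym_change_of_variables _ _ _ mu leb numu (EFin \o f))//.
have mf := measurable_int _ fi.
have mr : measurable_fun setT (EFin \o rho) by exact/measurable_EFinP.
have RNi : leb.-integrable setT (Radon_Nikodym (charge_of_finite_measure mu) leb).
  exact: Radon_Nikodym_integrable.
apply: ae_eq_integral => //.
- by apply: emeasurable_funM => //; exact: measurable_int RNi.
- have -> : (fun x => (f x * rho x)%:E) = ((EFin \o f) \* (EFin \o rho))%E.
    by apply/funext => x; rewrite /= EFinM.
  exact: emeasurable_funM.
have -> : (fun x => (f x * rho x)%:E) = ((EFin \o f) \* (EFin \o rho))%E.
  by apply/funext => x; rewrite /= EFinM.
apply: ae_eqe_mul2l; apply: integral_ae_eq => // E _ mE.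
by rewrite -Radon_Nikodym_integral//; exact: h.
Qed.

Lemma continuous_sqrt_quad (a : R) : continuous (fun x : R => Num.sqrt (a - x ^+ 2)).
Proof.
have h : continuous (fun x : R => a - x ^+ 2).
  by move=> x; apply: cvgB; [exact: cvg_cst|exact: exprn_continuous].
by move=> x; exact: (continuous_comp (h x) (@sqrt_continuous R _)).
Qed.

(* [G] is a primitive of [f] times the semicircle density that vanishes at both
   ends of the support. *)
Lemma semicircle_integral0 mu (v : R) f (G : R -> R) : 0 < v ->
  has_density mu (semicircle_density v) ->
  mu.-integrable setT (EFin \o f) -> continuous f -> continuous G ->
  G (- (2 * Num.sqrt v)) = 0 -> G (2 * Num.sqrt v) = 0 ->
  (forall x, 0 < 4 * v - x ^+ 2 ->
     is_derive x 1 G (f x * semicircle_density v x)) ->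
  (\int[mu]_x f x = 0)%R.
Proof.
move=> v0 hd fi cf cG Ga Gb dG; rewrite /Rintegral (density_integral hd fi).
set c := 2 * Num.sqrt v; have c0 : 0 < c by rewrite mulr_gt0// sqrtr_gt0.
have cc : c ^+ 2 = 4 * v by rewrite exprMn sqr_sqrtr ?ltW//; ring.
have csc : continuous (semicircle_density v).
  move=> x; apply: cvgM; last exact: cvg_cst.
  exact: continuous_sqrt_quad.
have out x : ~ `[- c, c]%classic x -> semicircle_density v x = 0.
  rewrite /= in_itv/= => /negP h; rewrite /semicircle_density ler0_sqrtr ?mul0r//.
  rewrite -cc subr_le0 -(real_normK (num_real x)) ler_pXn2r ?nnegrE ?(ltW c0)//.
  by move: h; rewrite -ler_norml -ltNge => /ltW.
have inside x : - c < x < c -> 0 < 4 * v - x ^+ 2.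
  rewrite -ltr_norml => h; rewrite subr_gt0 -cc -(real_normK (num_real x)).
  by rewrite ltr_pXn2r ?nnegrE ?(ltW c0).
have -> : (\int[leb]_x (f x * semicircle_density v x)%:E =
    \int[leb]_(x in `[(- c)%R, c]) (f x * semicircle_density v x)%:E)%E.
  rewrite [RHS]integral_mkcond; apply: eq_integral => x _.
  rewrite patchE; case: ifPn => //; rewrite notin_setE => /out ->.
  by rewrite mulr0.
rewrite (@continuous_FTC2 _ _ G).
- by rewrite Ga Gb subee.
- by rewrite -subr_gt0 opprK addr_gt0.
- by apply: continuous_subspaceT => x; apply: cvgM; [exact: cf|exact: csc].
- split.
  + by move=> x; rewrite in_itv/= => /inside/dG h; exact: ex_derive.
  + by apply: cvg_at_right_filter; exact: cG.
  + by apply: cvg_at_left_filter; exact: cG.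
- by move=> x; rewrite in_itv/= => /inside/dG h; rewrite derive1E derive_val.
Qed.

Lemma semicircle_moments mu (v : R) : 0 < v ->
  has_density mu (semicircle_density v) ->
  (forall n, mu.-integrable setT (fun y : R => (y ^+ n)%:E)) ->
  (\int[mu]_y (y ^+ 1) = 0)%R /\ (\int[mu]_y (y ^+ 2) = v)%R.
Proof.
move=> v0 hd hi; set s := fun x : R => Num.sqrt (4 * v - x ^+ 2).
have cs : continuous s by exact: continuous_sqrt_quad.
have s0 x : x ^+ 2 = 4 * v -> s x = 0 by rewrite /s => ->; rewrite subrr sqrtr0.
have sr : s (2 * Num.sqrt v) = 0 by apply: s0; rewrite exprMn sqr_sqrtr ?ltW//; ring.
have sl : s (- (2 * Num.sqrt v)) = 0 by apply: s0; rewrite sqrrN exprMn sqr_sqrtr ?ltW//; ring.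
have ds x : 0 < 4 * v - x ^+ 2 -> is_derive x 1 s (- x / s x).
  move=> h; have h1 := is_derive1_sqrt h.
  have h2 : is_derive x 1 (fun x => 4 * v - x ^+ 2) (- (2 * x)).
    by apply: is_derive_eq; rewrite /GRing.scale/=; ring.
  have h3 := @is_derive1_comp _ Num.sqrt (fun x => 4 * v - x ^+ 2) _ _ _ h1 h2.
  apply: (@is_derive_eq _ _ _ _ _ _ _ _ h3).
  have : Num.sqrt (4 * v - x ^+ 2) != 0 by rewrite sqrtr_eq0 -ltNge.
  by rewrite /s => ?; field.
set K := (2 * pi * v)^-1.
have si n : mu.-integrable setT (EFin \o (fun y : R => y ^+ n)) by exact: hi.
split.
  (* The primitive comes from [s' = - x / s], so that [(s^3)' = - 3 x s]. *)
  apply: (@semicircle_integral0 mu v (fun y => y ^+ 1) (fun x => (- K / 3) * s x ^+ 3) v0 hd (si 1)).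
  - exact: exprn_continuous.
  - move=> x; apply: cvgM; first exact: cvg_cst.
    exact: (@continuous_comp _ _ _ s (fun y => y ^+ 3) x (cs x) (@exprn_continuous _ 3 _)).
  - by rewrite sl expr0n mulr0.
  - by rewrite sr expr0n mulr0.
  - move=> x h; have h1 := ds x h.
    apply: is_derive_eq; rewrite /GRing.scale/= /semicircle_density -/(s x) -/K.
    have : s x != 0 by rewrite sqrtr_eq0 -ltNge.
    by move=> ?; field.
(* Subtracting [v] makes the primitive elementary, since [(x s^3)' = 4 s (v - x^2)]; for [x^2] alone
   an arcsine would appear. *)
have e : (\int[mu]_y (y ^+ 2 - v) = 0)%R.
  apply: (@semicircle_integral0 mu v (fun y => y ^+ 2 - v) (fun x => (- K / 4) * (x * s x ^+ 3)) v0 hd).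
  - by apply: (@integrableB _ _ _ mu setT measurableT (EFin \o (fun y : R => y ^+ 2)) (EFin \o cst v)) => //; exact: finite_measure_integrable_cst.
  - by move=> x; apply: cvgB; [exact: exprn_continuous|exact: cvg_cst].
  - move=> x; apply: cvgM; first exact: cvg_cst.
    apply: cvgM; first exact: cvg_id.
    exact: (@continuous_comp _ _ _ s (fun y => y ^+ 3) x (cs x) (@exprn_continuous _ 3 _)).
  - by rewrite sl expr0n !mulr0.
  - by rewrite sr expr0n !mulr0.
  - move=> x h; have h1 := ds x h.
    apply: is_derive_eq; rewrite /GRing.scale/= /semicircle_density -/(s x) -/K.
    have : s x != 0 by rewrite sqrtr_eq0 -ltNge.
    have e : v = (s x ^+ 2 + x ^+ 2) / 4.
      by rewrite /s sqr_sqrtr ?(ltW h)//; field.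
    by rewrite e => ?; field.
move: e; rewrite RintegralB//; last exact: finite_measure_integrable_cst.
rewrite Rintegral_cst//; have -> : fine (mu setT) = 1 by rewrite probability_setT.
by rewrite mulr1 => /eqP; rewrite subr_eq0 => /eqP.
Qed.

End Semicircle.

Lemma semicircular_moments (R : realType) (A : wstarProbSpace R) (x : A) (v : R) :
  0 < v -> semicircular x v -> Ex x = 0 /\ Ex (x ^+ 2) = v%:C.
Proof.
move=> v0 [mu [sp hd]]; have [] := semicircle_moments v0 hd (fun n => (sp n).1).
by move=> h1 h2; rewrite -{1}(expr1 x) !(sp _).2 h1 h2.
Qed.

(** * Free increments and the covariance of Ito sums *)

Section FreeItoSums.
Variables (R : realType) (A : wstarProbSpace R) (W : R -> A).
Hypothesis bm : free_brownian_motion W.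
Implicit Types (x y b : A) (s r : R).

Lemma increment_moments s r : 0 <= s -> s < r ->
  Ex (W r - W s) = 0 /\ Ex ((W r - W s) ^+ 2) = (r - s)%:C.
Proof.
move=> s0 sr; have [_ _ h] := bm; have [_ sc] := h s r s0 sr.
by apply: semicircular_moments sc; rewrite subr_gt0.
Qed.

(** Freeness kills the word made of the increment, which is centred, and of [x] minus its
    expectation. *)
Lemma increment_orthogonal s r x : 0 <= s <= r -> past W s x ->
  Ex ((W r - W s) * x) = 0.
Proof.
move=> /andP[s0]; rewrite le_eqVlt => /predU1P[<- _|sr px].
  by rewrite subrr mul0r Ex0.
have [m1 _] := increment_moments s0 sr.
have [_ _ h] := bm; have [fr _] := h s r s0 sr.
have {}fr := fr [:: (true, W r - W s); (false, x - (Ex x)%:A)].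
have : Ex ((W r - W s) * (x - (Ex x)%:A)) = 0.
  have -> : (W r - W s) * (x - (Ex x)%:A) =
    \prod_(l <- [:: (true, W r - W s); (false, x - (Ex x)%:A)]) l.2.
    by rewrite !big_cons big_nil /= mulr1.
  apply: fr => // l; rewrite !inE => /orP[]/eqP-> /=.
    by split => //; exists 'X => //; rewrite horner_algX.
  split; last by rewrite ExB Ex_alg subrr.
  by apply: pastB => //; exact: past_alg.
by rewrite mulrBr mulr_algr ExB ExZ m1 mulr0 subr0.
Qed.

(** With [x] and [y] centred, the alternating word of length four vanishes by freeness. The
    remaining terms reduce to [Ex (D * D * z) = (r - s) Ex z], which is freeness of [z] from the
    centred square of [D]. *)
Lemma increment_covariance s r x y : 0 <= s <= r -> past W s x -> past W s y ->
  Ex ((W r - W s) * x * ((W r - W s) * y)) = (r - s)%:C * Ex x * Ex y.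
Proof.
move=> /andP[s0]; rewrite le_eqVlt => /predU1P[<- _ _|sr px py].
  by rewrite !subrr !mul0r Ex0.
have [m1 m2] := increment_moments s0 sr.
have [_ _ h] := bm; have [fr _] := h s r s0 sr.
set D := W r - W s in m1 m2 fr *.
have poly_D : poly_algebra D D by exists 'X => //; rewrite horner_algX.
have centred z : past W s z -> past W s (z - (Ex z)%:A) /\ Ex (z - (Ex z)%:A) = 0.
  move=> pz; split; last by rewrite ExB Ex_alg subrr.
  by apply: pastB => //; exact: past_alg.
have D2 z : past W s z -> Ex (D * D * z) = (r - s)%:C * Ex z.
  move=> pz; pose D' := D * D - (r - s)%:C%:A; pose z' := z - (Ex z)%:A.
  have [pz' ez'] := centred z pz.
  have : Ex (D' * z') = 0.
    have -> : D' * z' = \prod_(l <- [:: (true, D'); (false, z')]) l.2.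
      by rewrite !big_cons big_nil /= mulr1.
    apply: fr => // l; rewrite !inE => /orP[]/eqP-> //=; split.
      exists ('X ^+ 2 - ((r - s)%:C)%:P) => //.
      by rewrite rmorphB rmorphXn /= horner_algX horner_algC.
    by rewrite ExB Ex_alg -expr2 m2 subrr.
  rewrite /D' mulrBl ExB mulr_algl ExZ ez' mulr0 subr0 /z' mulrBr ExB mulr_algr.
  by rewrite ExZ -expr2 m2 => /eqP; rewrite subr_eq0 mulrC => /eqP.
pose x' := x - (Ex x)%:A; pose y' := y - (Ex y)%:A.
have [px' ex'] : past W s x' /\ Ex x' = 0 by exact: centred.
have [py' ey'] : past W s y' /\ Ex y' = 0 by exact: centred.
have h4 : Ex (D * x' * (D * y')) = 0.
  have -> : D * x' * (D * y') =
      \prod_(l <- [:: (true, D); (false, x'); (true, D); (false, y')]) l.2.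
    by rewrite !big_cons big_nil /= mulr1 !mulrA.
  by apply: fr => // l; rewrite !inE => /or4P[]/eqP-> /=.
have xE : x = x' + (Ex x)%:A by rewrite subrK.
have yE : y = y' + (Ex y)%:A by rewrite subrK.
clearbody x' y' D; rewrite {1}xE {1}yE.
rewrite !mulrDr !mulrDl !mulr_algr !ExD h4 add0r.
rewrite -!scalerAl -!scalerAr !ExZ [D * (D * y')]mulrA D2// ey' !mulr0 add0r.
have -> : Ex (D * x' * D) = Ex (D * D * x') by rewrite Ex_tracial mulrA.
rewrite D2// ex' !mulr0 add0r -expr2 m2.
by rewrite -[RHS]/((r - s)%:C * (Ex x * Ex y)); ring.
Qed.

Section Sums.
Variables (t : nat -> R) (b : nat -> A).
Hypotheses (t0 : 0 <= t 0%N).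

Definition ito_sum n : A := \sum_(i < n) b i * (W (t i.+1) - W (t i)) * b i.

Variable n : nat.
Hypotheses (tm : forall i, (i < n)%N -> t i <= t i.+1).
Hypotheses (pb : forall i, (i < n)%N -> past W (t i) (b i)).

Lemma partition_mono i j : (i <= j <= n)%N -> t i <= t j.
Proof.
elim: j => [|j ih]; first by rewrite leqn0 => /andP[/eqP->].
case/andP; rewrite leq_eqVlt => /predU1P[-> //|]; rewrite ltnS => ij jn.
by apply: le_trans (tm jn); apply: ih; rewrite ij ltnW.
Qed.

Lemma partition_ge0 i : (i <= n)%N -> 0 <= t i.
Proof. by move=> i_n; apply: le_trans t0 (partition_mono _); rewrite leq0n. Qed.

Lemma ito_sum_past k : (k <= n)%N -> past W (t k) (ito_sum k).
Proof.
elim: k => [|k ih] kn; rewrite /ito_sum ?big_ord0; first exact: past0.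
have tk : t k <= t k.+1 by exact: tm.
have tk0 : 0 <= t k by apply: partition_ge0; exact: ltnW.
rewrite big_ord_recr/=; apply: pastD.
  by apply: past_mono tk _; apply: ih; exact: ltnW.
have pk : past W (t k.+1) (b k) by apply: past_mono tk (pb kn).
apply: pastM => //; apply: pastM => //; apply: pastB; apply: past_generator.
  by rewrite lexx (le_trans tk0 tk).
by rewrite tk0 tk.
Qed.

(** The trace moves the left [b k] to the end, leaving the increment times an element of its
    past. *)
Lemma ito_term_orthogonal k u : (k < n)%N -> past W (t k) u ->
  Ex (b k * (W (t k.+1) - W (t k)) * b k * u) = 0.
Proof.
move=> kn pu; rewrite -2!mulrA Ex_tracial -mulrA increment_orthogonal//.
  by rewrite tm// partition_ge0// ltnW.
by apply: pastM; [apply: pastM => //|]; exact: pb.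
Qed.

Lemma ito_sum_orthogonal k u : (k <= n)%N -> past W (t 0%N) u ->
  Ex (ito_sum k * u) = 0.
Proof.
move=> kn pu; rewrite /ito_sum mulr_suml raddf_sum big1// => i _.
have i_n : (i < n)%N by apply: leq_trans kn.
apply: ito_term_orthogonal => //; apply: past_mono pu.
by apply: partition_mono; rewrite leq0n ltnW.
Qed.

(** A discrete Ito isometry with weights. The sum of the earlier terms lies in the past of the last
    increment, so the cross terms vanish; cyclicity brings the diagonal term into the form of
    [increment_covariance]. *)
Lemma ito_sum_covariance k x y : (k <= n)%N -> past W (t 0%N) x -> past W (t 0%N) y ->
  Ex (ito_sum k * x * (ito_sum k * y)) =
  \sum_(i < k) (t i.+1 - t i)%:C * Ex (b i * b i * x) * Ex (b i * b i * y).
Proof.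
move=> + px py; elim: k => [|k ih] kn.
  by rewrite /ito_sum !big_ord0 !mul0r Ex0.
have kn' : (k <= n)%N by exact: ltnW.
rewrite big_ord_recr/= -ih//.
have e : ito_sum k.+1 = ito_sum k + b k * (W (t k.+1) - W (t k)) * b k.
  by rewrite /ito_sum big_ord_recr.
rewrite e; set m := b k * _ * b k; set M := ito_sum k.
have pM : past W (t k) M by exact: ito_sum_past.
have tk : t 0%N <= t k by apply: partition_mono; rewrite leq0n kn'.
have px' := past_mono tk px; have py' := past_mono tk py.
rewrite !mulrDl !mulrDr !ExD -!addrA; congr (_ + _).
have -> : Ex (M * x * (m * y)) = 0.
  rewrite Ex_tracial -[m * y * _]mulrA; apply: ito_term_orthogonal => //.
  by apply: pastM => //; apply: pastM.
have -> : Ex (m * x * (M * y)) = 0.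
  rewrite -mulrA; apply: ito_term_orthogonal => //.
  by apply: pastM => //; apply: pastM.
rewrite !add0r /m; set D := W _ - W _.
have -> : b k * D * b k * x * (b k * D * b k * y) =
  b k * (D * (b k * x * b k) * (D * (b k * y))) by rewrite !mulrA.
rewrite Ex_tracial -!mulrA.
have -> : D * (b k * (x * (b k * (D * (b k * (y * b k)))))) =
  D * (b k * x * b k) * (D * (b k * y * b k)) by rewrite !mulrA.
have pk := pb kn.
rewrite increment_covariance ?tm ?partition_ge0//; last 2 first.
- by apply: pastM => //; apply: pastM.
- by apply: pastM => //; apply: pastM.
rewrite [Ex (b k * x * b k)]Ex_tracial [Ex (b k * y * b k)]Ex_tracial.
by rewrite !mulrA.
Qed.

End Sums.

End FreeItoSums.

Lemma Ex_le4 (R : realType) (A : wstarProbSpace R) (a b c d : A) (ra rb rc rd : R) :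
  opnorm a <= ra -> opnorm b <= rb -> opnorm c <= rc -> opnorm d <= rd ->
  cmod (Ex (a * b * (c * d))) <= ra * rb * (rc * rd).
Proof.
move=> ha hb hc hd; apply: le_trans (Ex_le _) (le_trans (opnormM _ _) _).
have hab : opnorm (a * b) <= ra * rb.
  by apply: le_trans (opnormM _ _) (ler_pM _ _ _ _); rewrite ?opnorm_ge0.
have hcd : opnorm (c * d) <= rc * rd.
  by apply: le_trans (opnormM _ _) (ler_pM _ _ _ _); rewrite ?opnorm_ge0.
by rewrite ler_pM ?opnorm_ge0.
Qed.

Lemma Ex_le2 (R : realType) (A : wstarProbSpace R) (a b : A) (ra rb : R) :
  opnorm a <= ra -> opnorm b <= rb -> cmod (Ex (a * b)) <= ra * rb.
Proof.
move=> ha hb; apply: le_trans (Ex_le _) (le_trans (opnormM _ _) _).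
by rewrite ler_pM ?opnorm_ge0.
Qed.

(** * First and second moments of the increments of the solution *)

Section InfinitesimalIto.
Variables (R : realType) (A : wstarProbSpace R) (W X : R -> A) (theta : R).
Hypothesis bm : free_brownian_motion W.
Hypothesis posX : forall t, 0 <= t -> positive (X t).
Hypothesis sde :
  free_sde W (fun x => theta%:C *: x) (@psqrt R A) (@psqrt R A) X.

Lemma solution_selfadjoint t : 0 <= t -> selfadjoint (X t).
Proof. by case: sde => _ _ h _; exact: h. Qed.

Lemma solution_past t : 0 <= t -> past W t (X t).
Proof. by case: sde => h _ _ _ t0; apply: h; rewrite /= in_itv/= t0. Qed.

(** Read off from the stochastic integral, whose integrands are adapted by definition. *)
Lemma solution_sqrt_past t : 0 <= t -> past W t (psqrt (X t)).
Proof.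
move=> t0; case: sde => _ _ _ /(_ t t0)[J [K [_ [[_ _ h] _ _] _]]].
by apply: h; rewrite /= in_itv/= t0 lexx.
Qed.

Lemma solution_sqrt t : 0 <= t -> psqrt (X t) * psqrt (X t) = X t.
Proof.
by move=> t0; have [] := psqrtP (solution_selfadjoint t0) (posX t0).
Qed.

Lemma solution_continuous s e : 0 <= s -> 0 < e -> exists2 d : R, 0 < d &
  forall r, 0 <= r -> `|r - s| < d -> opnorm (X r - X s) < e.
Proof.
move=> s0 e0; case: sde => _ hc _ _.
have h : `[0, +oo[%classic s by rewrite /= in_itv/= s0.
have /cvgrPdist_lt/(_ _ e0) := hc s h.
rewrite near_withinE => /nbhs_ballP[d /= d0 hd]; exists d => // r r0 rs.
have := hd r; rewrite /ball/= distrC => /(_ rs); rewrite in_itv/= r0 => /(_ isT).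
by rewrite sub0r normrN ger0_norm// opnorm_ge0.
Qed.

(** The equation speaks of integrals from [0] only. A partition of [[0, q]] through [p] serves both
    end points, and the part of the sums over [[0, p]] cancels in the difference. *)
Lemma increment_approx p q e : 0 <= p -> p <= q -> 0 < e ->
  exists (n : nat) (t : nat -> R), [/\ t 0%N = p, t n = q,
    forall i, (i < n)%N -> t i <= t i.+1 &
    opnorm (X q - X p -
      (\sum_(i < n) (t i.+1 - t i)%:C *: (theta%:C *: X (t i)) +
       ito_sum W t (fun i => psqrt (X (t i))) n)) < e].
Proof.
move=> p0 pq e0; have q0 : 0 <= q by exact: le_trans pq.
have e4 : 0 < e / 4 by rewrite divr_gt0.
case: sde => _ _ _ hX.
have [Jp [Kp [/(_ _ e4)[d1 d10 hJp] [_ _ /(_ _ e4)[d2 d20 hKp]] Xp]]] := hX p p0.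
have [Jq [Kq [/(_ _ e4)[d3 d30 hJq] [_ _ /(_ _ e4)[d4 d40 hKq]] Xq]]] := hX q q0.
pose d := Num.min (Num.min d1 d2) (Num.min d3 d4).
have d0 : 0 < d by rewrite !lt_min d10 d20 d30 d40.
pose N := (Num.truncn (q / d)).+1.
have N0 : 0 < N%:R :> R by rewrite ltr0n.
have qN : q / N%:R < d.
  by rewrite ltr_pdivrMr// mulrC -ltr_pdivrMr// truncnS_gt.
(* [N] equal steps from [0] to [p], then [N] equal steps from [p] to [q]; the truncated subtraction
   switches the second phase on. All steps are at most [q / N]. *)
pose T i := p * (minn i N)%:R / N%:R + (q - p) * (i - N)%:R / N%:R.
have step i : T i.+1 - T i = if (i < N)%N then p / N%:R else (q - p) / N%:R.
  rewrite /T; case: ltnP => h.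
    have -> : minn i.+1 N = i.+1 by apply/minn_idPl.
    have -> : (i.+1 - N = 0)%N by apply/eqP; rewrite subn_eq0.
    have -> : (i - N = 0)%N by apply/eqP; rewrite subn_eq0 ltnW.
    by rewrite !mulr0 !mul0r !addr0 -natr1; field; rewrite gt_eqF.
  have -> : minn i.+1 N = N by apply/minn_idPr; exact: leqW.
  rewrite subSn// -natr1.
  by field; rewrite gt_eqF.
have Tmono i : T i <= T i.+1.
  rewrite -subr_ge0 step; by case: ifP => _; rewrite divr_ge0 ?subr_ge0// ltW.
have Tstep i : T i.+1 - T i < d.
  apply: le_lt_trans qN; rewrite step.
  by case: ifP => _; rewrite ler_pM2r ?invr_gt0// lerBlDr lerDl.
have T0 : T 0%N = 0 by rewrite /T min0n sub0n !mulr0 !mul0r addr0.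
have TN : T N = p.
  by rewrite /T minnn subnn mulr0 mul0r addr0 mulfK// gt_eqF.
have TNN : T (N + N)%N = q.
  rewrite /T; have -> : minn (N + N) N = N by apply/minn_idPr; exact: leq_addr.
  rewrite addnK !mulfK ?gt_eqF//.
  by rewrite addrC subrK.
have Tge0 i : 0 <= T i.
  by elim: i => [|i ih]; [rewrite T0|exact: le_trans ih (Tmono i)].
have partp : is_partition 0 p N T by split.
have partq : is_partition 0 q (N + N) T by split.
have {}hJp := hJp N T T partp.
have {}hJq := hJq (N + N)%N T T partq.
have {}hKp := hKp N T T partp.
have {}hKq := hKq (N + N)%N T T partq.
have st1 i : T i.+1 - T i < d1 by apply: lt_le_trans (Tstep i) _; rewrite !ge_min lexx.
have st2 i : T i.+1 - T i < d2 by apply: lt_le_trans (Tstep i) _; rewrite !ge_min lexx orbT.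
have st3 i : T i.+1 - T i < d3 by apply: lt_le_trans (Tstep i) _; rewrite !ge_min lexx !orbT.
have st4 i : T i.+1 - T i < d4 by apply: lt_le_trans (Tstep i) _; rewrite !ge_min lexx !orbT.
have {}hJp := hJp (fun i _ => And3 (lexx _) (Tmono i) (st1 i)).
have {}hJq := hJq (fun i _ => And3 (lexx _) (Tmono i) (st3 i)).
have {}hKp := hKp (fun i _ => And3 (Tge0 i) (lexx _) (st2 i)).
have {}hKq := hKq (fun i _ => And3 (Tge0 i) (lexx _) (st4 i)).
exists N, (fun i => T (N + i)%N); split => //; first by rewrite addn0.
  by move=> i _; rewrite addnS.
rewrite big_split_ord/= in hJq; rewrite big_split_ord/= in hKq.
rewrite /= in hJp hKp; rewrite Xp Xq.
move: hJp hJq hKp hKq.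
set SJp := \sum_(i < N) _; set SJ := \sum_(i < N) _.
set SKp := \sum_(i < N) _; set SK := \sum_(i < N) _.
move=> hJp hJq hKp hKq.
have -> : \sum_(i < N) (T (N + i.+1)%N - T (N + i)%N)%:C *:
    (theta%:C *: X (T (N + i)%N)) = SJ.
  by apply: eq_bigr => i _; rewrite addnS.
have -> : ito_sum W (fun i => T (N + i)%N) (fun i => psqrt (X (T (N + i)%N))) N = SK.
  by apply: eq_bigr => i _; rewrite addnS.
have -> : X 0 + Jq + Kq - (X 0 + Jp + Kp) - (SJ + SK) =
   (SJp - Jp) - (SJp + SJ - Jq) + ((SKp - Kp) - (SKp + SK - Kq)).
  have h (a b c f : A) : (a - b) - (a + c - f) = f - b - c.
    by rewrite opprB addrC [a + c]addrC opprD !addrA subrK addrAC.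
  rewrite !h [X 0 + Jp + Kp]addrAC opprD [X 0 + Jq + Kq]addrAC addrACA.
  rewrite [- (X 0 + Kp)]opprD [X 0 + Kq + _]addrACA subrr add0r.
  by rewrite [Kq - Kp + (Jq - Jp)]addrC [- (SJ + SK)]opprD [LHS]addrACA.
apply: le_lt_trans (opnormD _ _) _.
have -> : e = (e / 4 + e / 4) + (e / 4 + e / 4) by field.
by apply: ltrD; apply: le_lt_trans (opnormB _ _) _; apply: ltrD.
Qed.

(** [M] is an Ito sum, so it is orthogonal to the past and its covariance is explicit up to
    replacing each [X (t i)] by [X p]. [N] collects the approximation error and the variation of the
    drift. *)
Lemma increment_decomposition p q w : 0 <= p -> p <= q -> 0 < w ->
  (forall r, p <= r <= q -> opnorm (X r - X p) <= w) ->
  exists M N : A, [/\ X q - X p - ((q - p) * theta)%:C *: X p = M + N,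
    opnorm N <= (q - p) * ((`|theta| + 1) * w),
    forall b, past W p b -> Ex (M * b) = 0 &
    forall b c (K : R), past W p b -> past W p c -> opnorm b <= K -> opnorm c <= K ->
      cmod (Ex (M * b * (M * c)) - (q - p)%:C * Ex (X p * b) * Ex (X p * c)) <=
      (q - p) * (2 * (opnorm (X p) + w) * K ^+ 2 * w)].
Proof.
move=> p0; rewrite le_eqVlt => /predU1P[<- w0 _|pq w0 hw].
  exists 0, 0; rewrite !subrr !mul0r scale0r opnorm0 subrr addr0.
  split=> // [b _|b c K _ _ _ _]; first by rewrite mul0r Ex0.
  by rewrite !mul0r Ex0 subrr cmod0.
have qp : 0 < q - p by rewrite subr_gt0.
(* The precision is proportional to [q - p], so that the error stays negligible when increments are
   chained. *)
have [n [t [t0 tn tm happ]]] :=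
  increment_approx p0 (ltW pq) (mulr_gt0 qp w0).
pose b i := psqrt (X (t i)).
have t00 : 0 <= t 0%N by rewrite t0.
have tge0 i : (i <= n)%N -> 0 <= t i by exact: (partition_ge0 t00 tm).
have tmono i j : (i <= j <= n)%N -> t i <= t j by exact: partition_mono.
have tpq i : (i <= n)%N -> p <= t i <= q.
  by move=> i_n; rewrite -t0 -tn !tmono// ?leq0n ?i_n ?leqnn.
have pb i : (i < n)%N -> past W (t i) (b i).
  by move=> i_n; apply: solution_sqrt_past; apply: tge0; exact: ltnW.
pose L := \sum_(i < n) (t i.+1 - t i)%:C *: (theta%:C *: X (t i)).
pose M := ito_sum W t b n.
have sumt : \sum_(i < n) (t i.+1 - t i) = q - p.
  rewrite -t0 -tn -(big_mkord xpredT (fun i => t i.+1 - t i)).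
  by rewrite telescope_sumr.
have hL : opnorm (L - ((q - p) * theta)%:C *: X p) <= (q - p) * (`|theta| * w).
  rewrite -sumt mulr_suml rmorph_sum/= scaler_suml /L -sumrB mulr_suml.
  apply: le_trans (opnorm_sum _ _ _) _; apply: ler_sum => i _.
  rewrite scalerA -rmorphM/= -scalerBr; apply: le_trans (opnormZ_le _ _) _.
  have ti : 0 <= t i.+1 - t i by rewrite subr_ge0 tm.
  rewrite cmod_real normrM (ger0_norm ti) -mulrA ler_wpM2l// ler_wpM2l//.
  by apply: hw; apply: tpq; exact: ltnW.
pose N := (X q - X p - (L + M)) + (L - ((q - p) * theta)%:C *: X p).
exists M, N; split.
- have h (D U V c : A) : D - c = V + (D - (U + V) + (U - c)).
    by rewrite [U + V]addrC opprD !addrA subrK [V + D]addrC addrK.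
  exact: h.
- apply: le_trans (opnormD _ _) _; rewrite [leRHS]mulrCA [leRHS]mulrDl mul1r -mulrCA [leRHS]addrC lerD//.
  exact: ltW.
- move=> c pc; apply: (ito_sum_orthogonal bm t00 tm pb (leqnn n)).
  by rewrite t0.
move=> x y K px py hx hy.
rewrite /M (ito_sum_covariance bm t00 tm pb (leqnn n)) ?t0//.
rewrite -[in X in _ - X]sumt rmorph_sum/= !mulr_suml -sumrB -[in leRHS]sumt mulr_suml.
have K0 : 0 <= K by apply: le_trans hx; exact: opnorm_ge0.
apply: le_trans (cmod_sum _ _ _) _; apply: ler_sum => i _.
have ti : 0 <= t i.+1 - t i by rewrite subr_ge0 tm.
have ti0 : 0 <= t i by apply: tge0; exact: ltnW.
rewrite /b solution_sqrt//.
have -> : (t i.+1 - t i)%:C * Ex (X (t i) * x) * Ex (X (t i) * y) -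
   (t i.+1 - t i)%:C * Ex (X p * x) * Ex (X p * y) =
   (t i.+1 - t i)%:C * (Ex ((X (t i) - X p) * x) * Ex (X (t i) * y) +
      Ex (X p * x) * Ex ((X (t i) - X p) * y)).
  by rewrite !mulrBl !ExB; ring.
rewrite cmodM cmod_real (ger0_norm ti) ler_wpM2l//.
have hi : opnorm (X (t i) - X p) <= w by apply: hw; apply: tpq; exact: ltnW.
have hXi : opnorm (X (t i)) <= opnorm (X p) + w.
  by rewrite -(subrK (X p) (X (t i))) addrC; apply: le_trans (opnormD _ _) (lerD _ hi).
have hXp : opnorm (X p) <= opnorm (X p) + w by rewrite lerDl ltW.
apply: le_trans (cmodD _ _) _; rewrite !cmodM.
have -> : 2 * (opnorm (X p) + w) * K ^+ 2 * w =
  (w * K) * ((opnorm (X p) + w) * K) + ((opnorm (X p) + w) * K) * (w * K) by ring.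
by apply: lerD; apply: ler_pM; rewrite ?cmod_ge0//; apply: Ex_le2.
Qed.

Lemma infinitesimal_ito s e K : 0 <= s -> 0 < e -> 0 <= K ->
  exists2 d : R, 0 < d & forall p q, 0 <= p -> p <= q ->
    `|p - s| < d -> `|q - s| < d ->
    [/\ opnorm (X p) <= opnorm (X s) + 1, opnorm (X q - X p) <= e &
    forall b c, past W p b -> past W p c -> opnorm b <= K -> opnorm c <= K ->
      cmod (Ex ((X q - X p) * b) - ((q - p) * theta)%:C * Ex (X p * b)) <=
        (q - p) * e /\
      cmod (Ex ((X q - X p) * b * ((X q - X p) * c)) -
        (q - p)%:C * Ex (X p * b) * Ex (X p * c)) <= (q - p) * e].
Proof.
move=> s0 e0 K0; pose T := `|theta|; pose B := opnorm (X s) + 1.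
have T0 : 0 <= T by exact: normr_ge0.
have B0 : 0 <= B by rewrite addr_ge0// opnorm_ge0.
(* [(q - p) * z] will bound the drift together with [N], that is, all of the increment except
   [M]. *)
pose z := T * B + (T + 1).
have z0 : 0 < z by rewrite ltr_wpDl ?mulr_ge0// ltr_wpDl.
(* The sum of the coefficients of [(q - p) * w] in the error terms below; [w] is then taken with
   [w * C <= e]. *)
pose C := K ^+ 2 * (3 * z + 2 * (B + 1)) + (T + 1) * K + 1.
have C2 : 0 <= K ^+ 2 * (3 * z + 2 * (B + 1)).
  by rewrite mulr_ge0 ?exprn_ge0//; lra.
have C3 : 0 <= (T + 1) * K by rewrite mulr_ge0// addr_ge0.
have C1 : 1 <= C by rewrite /C lerDr addr_ge0.
have C0 : 0 < C by apply: lt_le_trans C1.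
pose w := Num.min 1 (e / C).
have w0 : 0 < w by rewrite lt_min ltr01 divr_gt0.
have w1 : w <= 1 by rewrite ge_min lexx.
have wC : w * C <= e by rewrite -ler_pdivlMr// ge_min lexx orbT.
have we : w <= e by apply: le_trans wC; rewrite ler_peMr// ltW.
have [d1 d10 hd1] := solution_continuous s0 (divr_gt0 w0 (ltr0n _ 2)).
pose d := Num.min d1 (w / z / 2).
exists d; first by rewrite lt_min d10 !divr_gt0.
move=> p q p0 pq ps qs.
have sub r : p <= r <= q -> opnorm (X r - X s) <= w / 2.
  move=> /andP[pr rq]; apply: ltW; apply: hd1; first exact: le_trans pr.
  have : `|r - s| < d.
    move: ps qs; rewrite !ltr_norml => /andP[h1 _] /andP[_ h2].
    by rewrite (lt_le_trans h1) ?lerB//= (le_lt_trans _ h2)// lerB.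
  by rewrite lt_min => /andP[].
have hp := sub p; rewrite lexx pq in hp; have {}hp := hp isT.
have hw r : p <= r <= q -> opnorm (X r - X p) <= w.
  move=> hr; have -> : X r - X p = (X r - X s) - (X p - X s).
    by rewrite opprB addrA subrK.
  by apply: le_trans (opnormB _ _) _; have h1 := sub r hr; lra.
have XpB : opnorm (X p) <= B.
  rewrite -(subrK (X s) (X p)) /B addrC; apply: le_trans (opnormD _ _) (lerD (lexx _) _).
  by lra.
have qp0 : 0 <= q - p by rewrite subr_ge0.
have hqp : (q - p) * z <= w.
  rewrite -ler_pdivlMr//.
  have hw2 : d <= w / z / 2 by rewrite ge_min lexx orbT.
  move: ps qs; rewrite !ltr_norml => /andP[h1 _] /andP[_ h2].
  by move: hw2 h1 h2; set u := w / z; set f := d; lra.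
split=> //; first by apply: le_trans (hw q _) we; rewrite pq lexx.
have [M [N [DE hN M1 M2]]] := increment_decomposition p0 pq w0 hw.
set D := X q - X p in DE *; set k := q - p in qp0 hqp DE hN M2 *.
have Dw : opnorm D <= w by apply: hw; rewrite pq lexx.
pose Y := (k * theta)%:C *: X p.
have Yw : opnorm Y <= k * (T * B).
  apply: le_trans (opnormZ_le _ _) _; rewrite cmod_real normrM (ger0_norm qp0).
  by rewrite -mulrA ler_wpM2l// ler_wpM2l.
have DE' : D = M + (N + Y) by rewrite addrA -DE subrK.
have Zk : opnorm (N + Y) <= k * z.
  apply: le_trans (opnormD _ _) _; rewrite /z mulrDr addrC lerD//.
  apply: le_trans hN _; rewrite ler_wpM2l// -[leRHS]mulr1.
  by rewrite ler_wpM2l// addr_ge0.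
have Mw : opnorm M <= 2 * w.
  have -> : M = D - (N + Y) by rewrite DE' addrK.
  by apply: le_trans (opnormB _ _) _; lra.
have EY b : Ex (Y * b) = (k * theta)%:C * Ex (X p * b).
  by rewrite /Y -scalerAl ExZ.
clearbody D k Y.
move=> b c pb pc hb hc; split.
  rewrite DE' !mulrDl !ExD M1// add0r EY addrK.
  apply: le_trans (Ex_le2 hN hb) _; rewrite -mulrA ler_wpM2l//.
  rewrite mulrAC mulrC; apply: le_trans wC; rewrite ler_wpM2l ?(ltW w0)//.
  by rewrite /C -addrA -[leLHS]add0r lerD// lerDl.
(* Replacing one [D] by [M] at a time costs [N + Y], of norm at most [k * z], against a factor of
   norm at most [2 * w]. *)
have -> : Ex (D * b * (D * c)) - k%:C * Ex (X p * b) * Ex (X p * c) =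
   Ex ((N + Y) * b * (D * c)) + Ex (M * b * ((N + Y) * c)) +
   (Ex (M * b * (M * c)) - k%:C * Ex (X p * b) * Ex (X p * c)).
  rewrite addrA; congr (_ - _); rewrite -addrA -ExD -mulrDr -mulrDl [N + Y + M]addrC.
  by rewrite -DE' -ExD -!mulrDl [N + Y + M]addrC -DE'.
have h1 := Ex_le4 Zk hb Dw hc.
have h2 := Ex_le4 Mw hb Zk hc.
have h3 := M2 b c K pb pc hb hc.
apply: le_trans (cmodD _ _) (le_trans (lerD (cmodD _ _) h3) _).
apply: le_trans (lerD (lerD h1 h2) (lexx _)) _.
have h4 : 2 * (opnorm (X p) + w) <= 2 * (B + 1) by lra.
apply: (@le_trans _ _ (k * (w * C))); last by rewrite ler_wpM2l.
have -> : k * z * K * (w * K) + 2 * w * K * (k * z * K) + k * (2 * (opnorm (X p) + w) * K ^+ 2 * w) =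
  k * (w * (K ^+ 2 * (3 * z + 2 * (opnorm (X p) + w)))) by ring.
rewrite ler_wpM2l// ler_wpM2l ?(ltW w0)// /C -addrA.
apply: (@le_trans _ _ (K ^+ 2 * (3 * z + 2 * (B + 1)))).
  by rewrite ler_wpM2l ?exprn_ge0// lerD2l.
by rewrite lerDl addr_ge0.
Qed.

End InfinitesimalIto.
(** * Characteristics of the Stieltjes transform *)

Section SegmentInduction.
Variable R : realType.
Implicit Types (a b s p q e C : R).

(** Compactness of [[a, b]] in the form of Cousin's lemma: the supremum of the points related to [a]
    is itself related to [a], and the local hypothesis there would reach further if it were below
    [b]. *)
Lemma cousin_chain (P : R -> R -> Prop) a b : a <= b ->
  (forall x y z, x <= y -> y <= z -> P x y -> P y z -> P x z) ->
  (forall s, a <= s <= b -> exists2 d : R, 0 < d & forall p q,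
     a <= p -> p <= s -> s <= q -> q <= b -> s - d < p -> q < s + d -> P p q) ->
  P a b.
Proof.
move=> ab trans loc.
pose E := [set x | a <= x <= b /\ P a x].
have Ea : E a.
  split; first by rewrite lexx.
  have [|d d0 h] := loc a; first by rewrite lexx.
  by apply: h; rewrite ?lexx// ?ltrBlDr ltrDl.
have hE : has_sup E by split; [exists a|exists b => x [/andP[]]].
have ac : a <= sup E by apply: ub_le_sup => //; case: hE.
have cb : sup E <= b by apply: ge_sup; [exists a|move=> x [/andP[]]].
have [|d d0 h] := loc (sup E); first by rewrite ac.
have [x [/andP[ax xb] Pax] cx] := sup_adherent d0 hE.
have xc : x <= sup E by apply: ub_le_sup; [case: hE|split=> //; rewrite ax].
have Pq q : sup E <= q -> q <= b -> q < sup E + d -> P a q.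
  by move=> cq qb qd; apply: trans Pax _ => //; [exact: le_trans cq|exact: h].
have [->|ncb] := eqVneq b (sup E); first by apply: Pq; rewrite ?ltrDl.
have {ncb cb} cb : sup E < b by rewrite lt_def ncb.
pose q := Num.min b (sup E + d / 2).
have cq : sup E < q by rewrite lt_min cb ltrDl divr_gt0.
have qb : q <= b by rewrite ge_min lexx.
have : q <= sup E.
  apply: ub_le_sup; first by case: hE.
  split; first by rewrite (le_trans ac (ltW cq)).
  apply: Pq => //; first exact: ltW.
  rewrite gt_min; apply/orP; right; rewrite ltrD2l.
  by rewrite ltr_pdivrMr// ltr_pMr// ltr1n.
by rewrite leNgt cq.
Qed.

Lemma expR_ge1 (x : R) : (1 <= expR x) = (0 <= x).
Proof. by rewrite -expR0 ler_expR. Qed.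

(** Short steps are chained for fixed [e], which then tends to [0]. Forward, a step [k] costs the
    factor [1 + C * k <= expR (C * k)]. Backward one divides by [1 - C * k]; for [C * k <= 1 / 2]
    one has [1 <= (1 + 2 * C * k) * (1 - C * k)], hence the rate [2 * C]. *)
Lemma gronwall_zero (D : R -> R) a b C : a <= b -> 0 <= C ->
  (forall s, a <= s <= b -> 0 <= D s) ->
  (forall s e, a <= s <= b -> 0 < e -> exists2 d : R, 0 < d & forall p q,
     a <= p -> p <= q -> q <= b -> `|p - s| < d -> `|q - s| < d ->
     `|D q - D p| <= (q - p) * (C * D p + e)) ->
  (D a = 0 <-> D b = 0).
Proof.
move=> ab C0 D0 loc.
have near s d p q : p <= s -> s <= q -> s - d < p -> q < s + d ->
    `|p - s| < d /\ `|q - s| < d.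
  by move=> ps sq h1 h2; rewrite !ltr_norml; split; apply/andP; split; lra.
have zero x c : 0 <= c -> (forall e, 0 < e -> x <= c * e) -> x <= 0.
  move=> c0 h; rewrite leNgt; apply/negP => x0.
  have c1 : 0 < c + 1 by rewrite ltr_wpDl.
  have := h _ (divr_gt0 x0 c1); rewrite leNgt => /negP; apply.
  by rewrite mulrA ltr_pdivrMr//; nra.
split=> h0; apply/eqP; rewrite eq_le D0 ?lexx ?ab// andbT.
- apply: (@zero _ (expR (C * (b - a)) * (b - a))).
    by rewrite mulr_ge0 ?expR_ge0 ?subr_ge0.
  move=> e e0.
  suff : D b <= expR (C * (b - a)) * (D a + e * (b - a)).
    by rewrite h0 add0r [e * _]mulrC mulrA.
  apply: (@cousin_chain (fun x y => D y <= expR (C * (y - x)) * (D x + e * (y - x)))) => //.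
    move=> x y z xy yz h1 h2; apply: le_trans h2 _.
    have -> : C * (z - x) = C * (z - y) + C * (y - x) by ring.
    rewrite expRD -[leRHS]mulrA ler_wpM2l ?expR_ge0//.
    apply: le_trans (lerD h1 (lexx _)) _.
    have : e * (z - y) <= expR (C * (y - x)) * (e * (z - y)).
      rewrite ler_peMl ?mulr_ge0 ?subr_ge0 ?(ltW e0)//.
      by rewrite expR_ge1 mulr_ge0// subr_ge0.
    by move: (expR _) => E; lra.
  move=> s hs; have [d d0 hd] := loc s e hs e0; exists d => // p q ap ps sq qb h1 h2.
  have [n1 n2] := near _ _ _ _ ps sq h1 h2.
  have pq := le_trans ps sq.
  have := hd p q ap pq qb n1 n2; rewrite ler_norml => /andP[_ h].
  have Dp : 0 <= D p by apply: D0; rewrite ap (le_trans pq).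
  have ex := expR_ge1Dx (C * (q - p)).
  have ex1 : 1 <= expR (C * (q - p)) by rewrite expR_ge1 mulr_ge0// subr_ge0.
  have qp : 0 <= e * (q - p) by rewrite mulr_ge0 ?subr_ge0// ltW.
  move: (expR _) ex ex1 => E ex ex1; move: h qp; set k := q - p => h qp.
  have g1 : (1 + C * k) * D p <= E * D p by rewrite ler_wpM2r.
  have g2 : e * k <= E * (e * k) by rewrite ler_peMl.
  by rewrite mulrDr; move: g1 g2 h; lra.
- apply: (@zero _ (expR (2 * C * (b - a)) * (b - a))).
    by rewrite mulr_ge0 ?expR_ge0 ?subr_ge0.
  move=> e e0.
  suff : D a <= expR (2 * C * (b - a)) * (D b + e * (b - a)).
    by rewrite h0 add0r [e * _]mulrC mulrA.
  apply: (@cousin_chain (fun x y => D x <= expR (2 * C * (y - x)) * (D y + e * (y - x)))) => //.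
    move=> x y z xy yz h1 h2; apply: le_trans h1 _.
    have -> : 2 * C * (z - x) = 2 * C * (y - x) + 2 * C * (z - y) by ring.
    rewrite expRD -[leRHS]mulrA ler_wpM2l ?expR_ge0//.
    apply: le_trans (lerD h2 (lexx _)) _.
    have : e * (y - x) <= expR (2 * C * (z - y)) * (e * (y - x)).
      rewrite ler_peMl ?mulr_ge0 ?subr_ge0 ?(ltW e0)//.
      by rewrite expR_ge1 !mulr_ge0// subr_ge0.
    by move: (expR _) => E; lra.
  move=> s hs; have [d d0 hd] := loc s e hs e0.
  have C4 : 0 < 4 * (C + 1) by rewrite mulr_gt0// ltr_wpDl.
  exists (Num.min d (4 * (C + 1))^-1); first by rewrite lt_min d0 invr_gt0.
  move=> p q ap ps sq qb h1 h2.
  have [] := near _ _ _ _ ps sq h1 h2; rewrite !lt_min => /andP[n1 n1'] /andP[n2 n2'].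
  have pq := le_trans ps sq.
  have := hd p q ap pq qb n1 n2; rewrite ler_norml => /andP[h _].
  have Dp : 0 <= D p by apply: D0; rewrite ap (le_trans pq).
  have Dq : 0 <= D q by apply: D0; rewrite qb (le_trans ap).
  have ex := expR_ge1Dx (2 * C * (q - p)).
  have ex1 : 1 <= expR (2 * C * (q - p)) by rewrite expR_ge1 !mulr_ge0// subr_ge0.
  have kC : C * (q - p) <= 1 / 2.
    have : q - p <= 2 / (4 * (C + 1)).
      move: n1' n2'; rewrite !ltr_norml => /andP[n1' _] /andP[_ n2'].
      by move: n1' n2'; set u := _^-1; lra.
    rewrite ler_pdivlMr// => h3; nra.
  have qp : 0 <= e * (q - p) by rewrite mulr_ge0 ?subr_ge0// ltW.
  have kC0 : 0 <= C * (q - p) by rewrite mulr_ge0// subr_ge0.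
  move: (expR _) ex ex1 => E ex ex1.
  have g0 : D p * (1 - C * (q - p)) <= D q + e * (q - p) by move: h; lra.
  have g1 : 1 <= E * (1 - C * (q - p)).
    apply: (@le_trans _ _ ((1 + 2 * C * (q - p)) * (1 - C * (q - p)))); first by nra.
    by rewrite ler_wpM2r//; lra.
  apply: (@le_trans _ _ (D p * (E * (1 - C * (q - p))))).
    by rewrite ler_peMr.
  by rewrite mulrCA ler_wpM2l// (le_trans _ ex1).
Qed.

End SegmentInduction.

(** * The complex exponential *)

Section ComplexExponential.
Variable R : realType.
Implicit Types (z w : R[i]) (x : R).

Lemma cexpD z w : cexp (z + w) = cexp z * cexp w.
Proof.
apply: complex_eqP; rewrite ?(cReM, cImM)/= cReD cImD expRD ?cosD ?sinD; ring.
Qed.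

Lemma cexp0 : cexp 0 = 1 :> R[i].
Proof. by apply: complex_eqP; rewrite /= ?expR0 ?cos0 ?sin0 ?mulr1 ?mulr0. Qed.

Lemma cexp_conj z : cexp (conjc z) = conjc (cexp z).
Proof. by case: z => a b; apply: complex_eqP; rewrite /= ?cosN ?sinN ?mulrN. Qed.

Lemma cmod_cexp z : cmod (cexp z) = expR (complex.Re z).
Proof.
apply/eqP; rewrite -(@eqrXn2 _ 2)// ?cmod_ge0 ?expR_ge0// sqr_cmod /= !exprMn.
by rewrite -mulrDr cos2Dsin2 mulr1.
Qed.

Lemma cexp_neq0 z : cexp z != 0.
Proof. by rewrite -cmod_eq0 cmod_cexp gt_eqF ?expR_gt0. Qed.

Lemma is_derive_approx (f : R -> R) x (l : R) : is_derive x 1 f l ->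
  forall e : R, 0 < e -> exists2 d : R, 0 < d & forall h, `|h| < d ->
    `|f (x + h) - f x - h * l| <= e * `|h|.
Proof.
move=> [df dl] e e0; move: df; rewrite /derivable => /cvg_ex[l' hl'].
have l'E : l' = l by rewrite -dl; apply/esym/cvg_lim.
have /cvgrPdist_lt/(_ _ e0) := hl'.
rewrite near_withinE => /nbhs_ballP[d /= d0 hd]; exists d => // h hd'.
have [->|h0] := eqVneq h 0; first by rewrite addr0 subrr mul0r subr0 normr0 mulr0.
have := hd h; rewrite /ball/= sub0r normrN => /(_ hd' h0).
rewrite l'E /= => /ltW h1.
have -> : f (x + h) - f x - h * l = - (h * (l - h^-1 * (f (h * 1 + x) - f x))).
  by rewrite mulr1 [h + x]addrC; field.
by rewrite normrN normrM mulrC ler_wpM2r.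
Qed.

Lemma cexp_approx z (e : R) : 0 < e -> exists2 d : R, 0 < d &
  forall h : R, `|h| < d -> cmod (cexp (z * h%:C) - 1 - z * h%:C) <= e * `|h|.
Proof.
case: z => a b e0; have e2 : 0 < e / 2 by rewrite divr_gt0.
have d1 : is_derive (0 : R) 1 (fun h => expR (a * h) * cos (b * h)) a.
  apply: is_derive_eq; rewrite /GRing.scale/= !mulr0 expR0 cos0 sin0; ring.
have d2 : is_derive (0 : R) 1 (fun h => expR (a * h) * sin (b * h)) b.
  apply: is_derive_eq; rewrite /GRing.scale/= !mulr0 expR0 cos0 sin0; ring.
have [r1 r10 h1] := is_derive_approx d1 e2; have [r2 r20 h2] := is_derive_approx d2 e2.
exists (Num.min r1 r2); first by rewrite lt_min r10.
move=> h; rewrite lt_min => /andP[/h1 g1 /h2 g2].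
apply: le_trans (cmod_le_ReIm _) _.
have -> : e * `|h| = e / 2 * `|h| + e / 2 * `|h| by field.
move: g1 g2; rewrite !add0r !mulr0 expR0 cos0 sin0 !mulr1 mulr0 subr0 => g1 g2.
have -> : (a +i* b) * h%:C = (a * h) +i* (b * h).
  by apply: complex_eqP; rewrite ?(cReM, cImM)/= !mulr0 ?subr0 ?add0r.
rewrite !cReD !cImD !cReN !cImN /= oppr0 addr0.
by rewrite [a * h in X in `|_ - X|]mulrC [b * h in X in _ + `|_ - X|]mulrC lerD.
Qed.

End ComplexExponential.

Lemma invr_sub (B : unitRingType) (a b : B) :
  a \is a GRing.unit -> b \is a GRing.unit -> a^-1 - b^-1 = a^-1 * (b - a) * b^-1.
Proof.
by move=> ua ub; rewrite mulrBr mulrBl mulrK// mulVr// mul1r.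
Qed.

(** Iterates [b^-1 = r - b^-1 * d * r]. The remainder is exact, and of its three factors [d] two go
    to [Ex_quadratic_le] and one to the operator norm. *)
Lemma invr_expand3 (B : unitRingType) (a b : B) (d := b - a) (r := a^-1) :
  a \is a GRing.unit -> b \is a GRing.unit ->
  b^-1 = r - r * d * r + r * d * r * d * r - b^-1 * d * r * d * r * d * r.
Proof.
move=> ua ub; have h : b^-1 = r - b^-1 * d * r.
  have := invr_sub ua ub; rewrite -/r -/d => e.
  have := invr_sub ub ua; rewrite -/r -[a - b]opprB -/d mulrN mulNr => <-.
  by rewrite addrC subrK.
rewrite {1}h -addrA -addrA; congr (_ + _).
rewrite {1}h !mulrBl opprB addrC; congr (_ + _).
by rewrite {1}h !mulrBl.
Qed.

(** * The resolvent in time, and [h] along characteristics *)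

Section Characteristics.
Variables (R : realType) (A : wstarProbSpace R) (W X : R -> A) (theta : R).
Hypothesis bm : free_brownian_motion W.
Hypothesis posX : forall t, 0 <= t -> positive (X t).
Hypothesis sde :
  free_sde W (fun x => theta%:C *: x) (@psqrt R A) (@psqrt R A) X.

Let saX t (t0 : 0 <= t) : selfadjoint (X t) := solution_selfadjoint sde t0.

Local Notation Rs t z := ((X t - z%:A)^-1).
Local Notation alpha := (theta - 1).

Lemma solution_unit t z : 0 <= t -> 0 < dist_halfline z -> X t - z%:A \is a GRing.unit.
Proof. by move=> t0; apply: resolvent_unit; [exact: saX|exact: posX]. Qed.

Lemma solution_resolvent_le t z (r : R) : 0 <= t -> 0 < r -> r^-1 <= dist_halfline z ->
  opnorm (Rs t z) <= r.
Proof.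
move=> t0 r0 h; have d0 : 0 < dist_halfline z by apply: lt_le_trans h; rewrite invr_gt0.
apply: le_trans (opnorm_resolvent (saX t0) (posX t0) d0) _.
by rewrite -[leRHS]invrK lef_pV2 ?posrE ?invr_gt0.
Qed.

Lemma solution_resolvent_past t z : 0 <= t -> 0 < dist_halfline z -> past W t (Rs t z).
Proof.
move=> t0 d0; apply: pastV; first exact: solution_unit.
by apply: pastB; [exact: (solution_past sde)|exact: past_alg].
Qed.

Lemma mul_resolvent t z : 0 <= t -> 0 < dist_halfline z ->
  X t * Rs t z = 1 + z *: Rs t z.
Proof.
move=> t0 d0; have u := solution_unit t0 d0.
by rewrite -[X in X * _](subrK z%:A) mulrDl divrr// mulr_algl.
Qed.

(** Per unit of time the first two orders of the expansion contribute [- theta * E[X R^2]] and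
    [E[X R] * E[X R^2]]. With [X R = 1 + z R] they add up to [(z g - alpha) * E[X R^2]], the origin
    of [alpha = theta - 1]. *)
Lemma resolvent_time_increment s (r e : R) : 0 <= s -> 0 < r -> 0 < e ->
  exists2 d : R, 0 < d & forall p q, 0 <= p -> p <= q ->
    `|p - s| < d -> `|q - s| < d -> forall z, r^-1 <= dist_halfline z ->
    opnorm (Rs q z - Rs p z) <= e /\
    cmod (Ex (Rs q z) - Ex (Rs p z) - (q - p)%:C *
      ((z * Ex (Rs p z) - alpha%:C) * (Ex (Rs p z) + z * Ex (Rs p z * Rs p z))))
      <= (q - p) * e.
Proof.
move=> s0 r0 e0; pose B := opnorm (X s) + 1.
have B0 : 0 <= B by rewrite addr_ge0 ?opnorm_ge0.
pose C := 2 + r ^+ 4 * (B ^+ 2 + 1) + r ^+ 2.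
have r4 : 0 <= r ^+ 4 * (B ^+ 2 + 1).
  by rewrite mulr_ge0 ?exprn_ge0 ?addr_ge0 ?exprn_ge0// ltW.
have r2 : 0 <= r ^+ 2 by rewrite exprn_ge0// ltW.
have C0 : 0 < C by rewrite /C; lra.
pose e1 := Num.min 1 (e / C).
have e10 : 0 < e1 by rewrite lt_min ltr01 divr_gt0.
have e11 : e1 <= 1 by rewrite ge_min lexx.
have e1C : e1 * C <= e by rewrite -ler_pdivlMr// ge_min lexx orbT.
pose K := 1 + r + r ^+ 2.
have K0 : 0 <= K by rewrite /K; lra.
have [d d0 hd] := infinitesimal_ito bm posX sde s0 e10 K0.
exists d => // p q p0 pq ps qs z hz.
have [XpB De hD] := hd p q p0 pq ps qs.
have q0 := le_trans p0 pq.
have dz : 0 < dist_halfline z by apply: lt_le_trans hz; rewrite invr_gt0.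
have up := solution_unit p0 dz; have uq := solution_unit q0 dz.
have rp := solution_resolvent_le p0 r0 hz; have rq := solution_resolvent_le q0 r0 hz.
have pR := solution_resolvent_past p0 dz.
have XR := mul_resolvent p0 dz.
have sD : selfadjoint (X q - X p) by apply: selfadjointB; exact: saX.
have DE : (X q - z%:A) - (X p - z%:A) = X q - X p.
  by rewrite opprB addrA subrK.
set D := X q - X p in De hD sD DE.
set h := q - p in hD *; have h0 : 0 <= h by rewrite subr_ge0.
have exp3 := invr_expand3 up uq; rewrite DE in exp3.
have inv1 := invr_sub uq up; rewrite -[X p - _ - _]opprB DE mulrN mulNr in inv1.
have := saX p0; move: rp rq pR XR exp3 inv1.
set Rp := Rs p z; set Q := Rs q z => rp rq pR XR exp3 inv1 _.
have r1 : 0 <= r by exact: ltW.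
split.
  rewrite inv1 opnormN; apply: le_trans (opnormM _ _) _.
  apply: (@le_trans _ _ ((r * e1) * r)).
    apply: ler_pM; rewrite ?opnorm_ge0//.
    by apply: le_trans (opnormM _ _) _; apply: ler_pM; rewrite ?opnorm_ge0.
  rewrite mulrAC -expr2 mulrC; apply: le_trans e1C.
  by rewrite ler_wpM2l ?(ltW e10)// /C; lra.
have nR : opnorm Rp <= K by apply: le_trans rp _; rewrite /K; lra.
have nRR : opnorm (Rp * Rp) <= r ^+ 2.
  by apply: le_trans (opnormM _ _) _; rewrite expr2 ler_pM ?opnorm_ge0.
have nRR' : opnorm (Rp * Rp) <= K by apply: le_trans nRR _; rewrite /K; lra.
have n1 : opnorm (1 : A) <= K by apply: le_trans (opnorm1_le _) _; rewrite /K; lra.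
have pRR : past W p (Rp * Rp) by exact: pastM.
have [] := hD 1 1 (@past1 _ _ W p) (@past1 _ _ W p) n1 n1; rewrite !mulr1 => _ hDD.
have [h1 _] := hD _ _ pRR pRR nRR' nRR'.
have [_ h2] := hD _ _ pR pRR nR nRR'.
have XRR : X p * (Rp * Rp) = Rp + z *: (Rp * Rp).
  by rewrite mulrA XR mulrDl mul1r scalerAl.
rewrite XRR XR !ExD !ExZ Ex1 in h1 h2.
(* The covariance estimate with [b = c = 1]: in trace norm the squared increment is of order [h]. *)
have tD : tnorm2 D <= h * (B ^+ 2 + 1).
  rewrite /tnorm2 sD; apply: le_trans (le_trans (ler_norm _) (Re_le_cmod _)) _.
  rewrite -[Ex _](subrK (h%:C * Ex (X p) * Ex (X p))).
  apply: le_trans (cmodD _ _) _; rewrite [leLHS]addrC [leRHS]mulrDr lerD//.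
    rewrite !cmodM cmod_real ger0_norm// -mulrA ler_wpM2l// expr2.
    by apply: ler_pM; rewrite ?cmod_ge0//; apply: le_trans (Ex_le _) XpB.
  by apply: le_trans hDD _; rewrite ler_wpM2l.
have h3 : cmod (Ex (Rp * Q * D * (Rp * D * Rp * D))) <= r ^+ 4 * e1 * (h * (B ^+ 2 + 1)).
  apply: le_trans (Ex_quadratic_le _ _ sD) _.
  apply: ler_pM; rewrite ?mulr_ge0 ?opnorm_ge0 ?tnorm2_ge0//.
  have g1 : opnorm (Rp * Q) <= r * r.
    by apply: le_trans (opnormM _ _) _; rewrite ler_pM ?opnorm_ge0.
  have g2 : opnorm (Rp * D * Rp) <= r * e1 * r.
    apply: le_trans (opnormM _ _) _; rewrite ler_pM ?opnorm_ge0//.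
    by apply: le_trans (opnormM _ _) _; rewrite ler_pM ?opnorm_ge0.
  apply: le_trans (ler_pM _ _ g1 g2) _; rewrite ?opnorm_ge0//.
  by rewrite le_eqVlt; apply/orP; left; apply/eqP; ring.
have EQ : Ex Q = Ex Rp - Ex (D * (Rp * Rp)) + Ex (D * Rp * (D * (Rp * Rp))) -
    Ex (Rp * Q * D * (Rp * D * Rp * D)).
  rewrite [in LHS]exp3 !ExB !ExD ExN.
  congr (_ - _ + _ - _).
  - by rewrite -mulrA Ex_tracial -mulrA.
  - by rewrite -!mulrA Ex_tracial -!mulrA.
  - by rewrite [LHS]Ex_tracial !mulrA.
have -> : Ex Q - Ex Rp - h%:C * ((z * Ex Rp - alpha%:C) * (Ex Rp + z * Ex (Rp * Rp))) =
  - (Ex (D * (Rp * Rp)) - (h * theta)%:C * (Ex Rp + z * Ex (Rp * Rp))) +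
  (Ex (D * Rp * (D * (Rp * Rp))) - h%:C * (1 + z * Ex Rp) * (Ex Rp + z * Ex (Rp * Rp))) -
  Ex (Rp * Q * D * (Rp * D * Rp * D)).
  by rewrite EQ !rmorphM !rmorphB rmorph1; ring.
apply: le_trans (cmodB _ _) (le_trans (lerD (cmodD _ _) h3) _).
rewrite cmodN; apply: le_trans (lerD (lerD h1 h2) (lexx _)) _.
have -> : h * e1 + h * e1 + r ^+ 4 * e1 * (h * (B ^+ 2 + 1)) =
  h * (e1 * (2 + r ^+ 4 * (B ^+ 2 + 1))) by ring.
rewrite ler_wpM2l//; apply: le_trans e1C.
by rewrite ler_wpM2l ?(ltW e10)// /C lerDl.
Qed.

Lemma cmod_lipschitz_dist (x y : R[i]) :
  dist_halfline x <= dist_halfline y + cmod (x - y).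
Proof.
have i1 : `|complex.Im x| <= `|complex.Im y| + cmod (x - y).
  have {1}-> : complex.Im x = complex.Im y + complex.Im (x - y).
    by rewrite cImD cImN addrC subrK.
  by apply: le_trans (ler_normD _ _) _; rewrite lerD2l Im_le_cmod.
have i2 : - complex.Re x <= - complex.Re y + cmod (x - y).
  have := le_trans (ler_norm _) (Re_le_cmod (y - x)).
  by rewrite cmodBC cReD cReN; lra.
have le1 : `|complex.Im y| <= dist_halfline y by rewrite le_max lexx.
have le2 : - complex.Re y <= dist_halfline y by rewrite le_max lexx orbT.
rewrite {1}/dist_halfline maxEle.
by case: ifP => _; [apply: le_trans i2 _|apply: le_trans i1 _]; rewrite lerD2r.
Qed.

Definition characteristic (z c : R[i]) (t : R) : R[i] :=
  z * cexp ((alpha%:C - c) * t%:C).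

Lemma characteristicD z c p q :
  characteristic z c q = characteristic z c p * cexp ((alpha%:C - c) * (q - p)%:C).
Proof. by rewrite /characteristic -mulrA -cexpD -mulrDr -rmorphD/= [p + _]addrC subrK. Qed.

Lemma characteristic_bound z c b : exists2 Z : R, 0 <= Z &
  forall t, 0 <= t <= b -> cmod (characteristic z c t) <= Z.
Proof.
set m := alpha%:C - c; exists (cmod z * expR (`|complex.Re m| * b)).
  by rewrite mulr_ge0 ?cmod_ge0 ?expR_ge0.
move=> t /andP[t0 tb]; rewrite cmodM cmod_cexp ler_wpM2l ?cmod_ge0// ler_expR.
rewrite cReM/= mulr0 subr0; apply: le_trans (ler_wpM2r t0 (ler_norm _)) _.
by rewrite ler_wpM2l.
Qed.

Lemma characteristic_increment z c b (e : R) : 0 <= b -> 0 < e ->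
  exists2 d : R, 0 < d & forall p q, 0 <= p -> p <= q -> q <= b -> q - p < d ->
    cmod (characteristic z c q - characteristic z c p -
      (q - p)%:C * ((alpha%:C - c) * characteristic z c p)) <= (q - p) * e /\
    cmod (characteristic z c q - characteristic z c p) <= e.
Proof.
move=> b0 e0; have [Z Z0 hZ] := characteristic_bound z c b.
set m := alpha%:C - c.
have Z1 : 0 < Z + 1 by rewrite ltr_wpDl.
have [d d0 hd] := cexp_approx m (divr_gt0 e0 Z1).
pose C := cmod m * Z + e + 1.
have C1 : 1 <= C by rewrite /C lerDr addr_ge0 ?(ltW e0)// mulr_ge0 ?cmod_ge0.
have C0 : 0 < C by apply: lt_le_trans C1.
exists (Num.min d (e / C)); first by rewrite lt_min d0 divr_gt0.
move=> p q p0 pq qb; rewrite lt_min => /andP[qp1 qp2].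
have h0 : 0 <= q - p by rewrite subr_ge0.
have hp : cmod (characteristic z c p) <= Z by apply: hZ; rewrite p0 (le_trans pq).
have h1 : cmod (characteristic z c q - characteristic z c p -
      (q - p)%:C * (m * characteristic z c p)) <= (q - p) * e.
  rewrite (characteristicD z c p q) -/m.
  set zp := characteristic z c p in hp *.
  have -> : zp * cexp (m * (q - p)%:C) - zp - (q - p)%:C * (m * zp) =
     zp * (cexp (m * (q - p)%:C) - 1 - m * (q - p)%:C) by ring.
  rewrite cmodM.
  have := hd (q - p); rewrite ger0_norm// => /(_ qp1) g.
  apply: le_trans (ler_pM (cmod_ge0 _) (cmod_ge0 _) hp g) _.
  rewrite [leLHS]mulrA [leLHS]mulrC ler_wpM2l// [leLHS]mulrA ler_pdivrMr//.
  by rewrite mulrC ler_wpM2l ?(ltW e0)// lerDl.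
split=> //; rewrite -[X in cmod X](subrK ((q - p)%:C * (m * characteristic z c p))).
apply: le_trans (cmodD _ _) (le_trans (lerD h1 (lexx _)) _).
rewrite cmodM (cmodM m) cmod_real ger0_norm// -mulrDr.
apply: (@le_trans _ _ ((q - p) * C)).
  by rewrite ler_wpM2l// /C; have := ler_wpM2l (cmod_ge0 m) hp; lra.
by rewrite -ler_pdivlMr// ltW.
Qed.

Definition stieltjes_h t z : R[i] := z * Ex (Rs t z).

(* Along a characteristic, [k t = h(t, zeta t)] satisfies the linear equation
   [k' = zeta w (k - c)] with [w = E[X (X - zeta)^-2]]. *)
Lemma stieltjes_h_increment z c b (r Z : R)
    (k := fun t => stieltjes_h t (characteristic z c t)) : 0 <= b -> 0 < r ->
  (forall t, 0 <= t <= b -> cmod (characteristic z c t) <= Z) ->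
  forall s (e : R), 0 <= s <= b -> 0 < e ->
  exists2 d : R, 0 < d & forall p q, 0 <= p -> p <= q -> q <= b ->
    `|p - s| < d -> `|q - s| < d ->
    (forall t, p <= t <= q -> r^-1 <= dist_halfline (characteristic z c t)) ->
    cmod (k q - k p) <= (q - p) * (Z * (r + Z * r ^+ 2) * cmod (k p - c) + e).
Proof.
move=> b0 r0 hZ s e /andP[s0 sb] e0.
have Z0 : 0 <= Z.
  by apply: le_trans (hZ 0 _); rewrite ?cmod_ge0 ?lexx.
set m := alpha%:C - c; pose a := cmod (alpha%:C : R[i]); pose M := cmod m.
have a0 : 0 <= a by exact: cmod_ge0.
have M0 : 0 <= M by exact: cmod_ge0.
have rr : 0 <= r by exact: ltW.
pose wb := r + Z * r ^+ 2.
have wb0 : 0 <= wb by rewrite /wb addr_ge0 ?mulr_ge0 ?exprn_ge0.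
pose G := (Z * r + a) * wb + M * Z * r ^+ 2.
have G0 : 0 <= G.
  by rewrite /G !addr_ge0 ?mulr_ge0 ?addr_ge0 ?exprn_ge0 ?mulr_ge0.
pose C := Z + Z * (r ^+ 2 + M * Z) + r + G + 1.
have C1 : 1 <= C.
  by rewrite /C lerDr !addr_ge0 ?mulr_ge0 ?addr_ge0 ?exprn_ge0 ?mulr_ge0.
have C0 : 0 < C by apply: lt_le_trans C1.
pose e1 := e / C; have e10 : 0 < e1 by rewrite divr_gt0.
pose D := r * (r ^+ 2 + 2) + 1.
have D1 : 1 <= D by rewrite /D lerDr mulr_ge0// addr_ge0// exprn_ge0.
have D0 : 0 < D by apply: lt_le_trans D1.
pose e2 := e1 / D; have e20 : 0 < e2 by rewrite divr_gt0.
have e21 : e2 <= e1 by rewrite ler_pdivrMr// ler_peMr// ltW.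
have [d1 d10 h1] := resolvent_time_increment s0 r0 e20.
have [d2 d20 h2] := characteristic_increment z c b0 e20.
exists (Num.min d1 (d2 / 2)); first by rewrite lt_min d10 divr_gt0.
move=> p q p0 pq qb; rewrite !lt_min => /andP[ps1 ps2] /andP[qs1 qs2] dist.
have qpd : q - p < d2.
  by move: ps2 qs2; rewrite !ltr_norml => /andP[g1 _] /andP[_ g2]; lra.
have dp : r^-1 <= dist_halfline (characteristic z c p) by apply: dist; rewrite lexx.
have dq : r^-1 <= dist_halfline (characteristic z c q) by apply: dist; rewrite pq lexx.
have pos z' : r^-1 <= dist_halfline z' -> 0 < dist_halfline z'.
  by apply: lt_le_trans; rewrite invr_gt0.
have [g1 g2] := h1 p q p0 pq ps1 qs1 _ dp.
have [g3 g4] := h2 p q p0 pq qb qpd.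
have hZp : cmod (characteristic z c p) <= Z by apply: hZ; rewrite p0 (le_trans pq).
have hZq : cmod (characteristic z c q) <= Z by apply: hZ; rewrite qb (le_trans p0).
have q0 := le_trans p0 pq.
rewrite /k /stieltjes_h; set zp := characteristic z c p in dp g1 g2 g3 g4 hZp *.
set zq := characteristic z c q in dq g3 g4 hZq *.
have rp := solution_resolvent_le p0 r0 dp.
have rq := solution_resolvent_le q0 r0 dp.
have rqq := solution_resolvent_le q0 r0 dq.
have uqq := solution_unit q0 (pos _ dq); have uq := solution_unit q0 (pos _ dp).
have idz : Rs q zq - Rs q zp = (zq - zp) *: (Rs q zq * Rs q zp).
  have dE : X q - zp%:A - (X q - zq%:A) = (zq - zp)%:A.
    by rewrite opprB addrC addrA subrK scalerBl.
  by rewrite invr_sub// dE mulr_algr -scalerAl.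
set Rq := Rs q zq in rqq idz *; set Q := Rs q zp in rq g1 g2 idz *.
set Rp := Rs p zp in rp g1 g2 *.
set h := q - p in g2 g3 *; have hge : 0 <= h by rewrite subr_ge0.
set u := zq - zp in idz g3 g4.
have zqE : zq = u + zp by rewrite subrK.
clearbody zp zq u.
have n1 : opnorm (Rq - Rp) <= e2 * (r ^+ 2 + 1).
  rewrite -(subrK Q Rq) -addrA; apply: le_trans (opnormD _ _) _.
  rewrite mulrDr mulr1 lerD// idz; apply: le_trans (opnormZ_le _ _) _.
  apply: ler_pM; rewrite ?cmod_ge0 ?opnorm_ge0//.
  by apply: le_trans (opnormM _ _) _; rewrite expr2 ler_pM ?opnorm_ge0.
have n2 : cmod (Ex (Rq * Q) - Ex (Rp * Rp)) <= e1.
  have -> : Ex (Rq * Q) - Ex (Rp * Rp) = Ex ((Rq - Rp) * Q) + Ex (Rp * (Q - Rp)).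
    by rewrite mulrBl mulrBr !ExB addrA subrK.
  apply: le_trans (cmodD _ _) _.
  apply: le_trans (lerD (Ex_le2 n1 rq) (Ex_le2 rp g1)) _.
  apply: (@le_trans _ _ (e2 * D)); last by rewrite divfK// gt_eqF.
  have -> : e2 * (r ^+ 2 + 1) * r + r * e2 = e2 * (r * (r ^+ 2 + 2)) by ring.
  by rewrite ler_wpM2l ?(ltW e20)// lerDl.
have ERq : Ex Rq = Ex Q + u * Ex (Rq * Q).
  by rewrite -ExZ -idz -ExD addrC subrK.
have b1 : cmod (Ex Rp) <= r by apply: le_trans (Ex_le _) rp.
have b2 : cmod (Ex (Rp * Rp)) <= r ^+ 2 by rewrite expr2; apply: Ex_le2.
have b3 : cmod (Ex (Rq * Q)) <= r ^+ 2 by rewrite expr2; apply: Ex_le2.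
move: ERq b1 b2 b3 n2 g2.
set EQ := Ex Q; set ERp := Ex Rp; set E2 := Ex (Rp * Rp); set F := Ex (Rq * Q).
move=> ERq b1 b2 b3 n2 g2.
pose w := ERp + zp * E2.
have bw : cmod w <= wb.
  apply: le_trans (cmodD _ _) _; rewrite cmodM lerD// ler_pM ?cmod_ge0//.
pose Y := (zp * ERp - alpha%:C) * w + m * zp * E2.
have bY : cmod Y <= G.
  apply: le_trans (cmodD _ _) _; rewrite !cmodM lerD//.
    rewrite ler_pM ?cmod_ge0//; apply: le_trans (cmodB _ _) _; rewrite cmodM.
    by rewrite lerD// ler_pM ?cmod_ge0.
  by rewrite ler_pM ?mulr_ge0 ?cmod_ge0// ler_pM ?cmod_ge0.
(* To first order, time contributes [h * zp * (zp * ERp - alpha) * w] and the motion of the point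
   [h * zp * m * w]. As [m = alpha - c], [alpha] cancels and the factor [zp * ERp - c] remains. The
   bracket holds errors that are [h] times something small. *)
have -> : zq * Ex Rq - zp * ERp = h%:C * (zp * w * (zp * ERp - c)) +
  (zq * (EQ - ERp - h%:C * ((zp * ERp - alpha%:C) * w)) +
   zq * ((u - h%:C * (m * zp)) * F + h%:C * (m * zp) * (F - E2)) +
   (u - h%:C * (m * zp)) * ERp + u * (h%:C * Y)).
  rewrite ERq /Y /w zqE /m.
  by ring.
rewrite [leRHS]mulrDr; apply: le_trans (cmodD _ _) (lerD _ _).
  rewrite cmodM cmod_real ger0_norm// ler_wpM2l// !cmodM ler_wpM2r ?cmod_ge0//.
  by rewrite ler_pM ?cmod_ge0.
have k1 : cmod (zq * (EQ - ERp - h%:C * ((zp * ERp - alpha%:C) * w))) <= h * (Z * e1).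
  rewrite cmodM [leRHS]mulrCA ler_pM ?cmod_ge0//; apply: le_trans g2 _.
  by rewrite ler_wpM2l.
have g3' : cmod (u - h%:C * (m * zp)) <= h * e1.
  by apply: le_trans g3 _; rewrite ler_wpM2l.
have k2 : cmod (zq * ((u - h%:C * (m * zp)) * F + h%:C * (m * zp) * (F - E2))) <=
    h * (Z * (r ^+ 2 + M * Z) * e1).
  have -> : h * (Z * (r ^+ 2 + M * Z) * e1) = Z * (h * e1 * r ^+ 2 + h * (M * Z) * e1) by ring.
  rewrite cmodM ler_pM ?cmod_ge0//; apply: le_trans (cmodD _ _) _.
  rewrite !cmodM lerD// ler_pM ?mulr_ge0 ?cmod_ge0//.
  by rewrite cmod_real ger0_norm// ler_wpM2l// ler_wpM2l.
have k3 : cmod ((u - h%:C * (m * zp)) * ERp) <= h * (r * e1).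
  by rewrite cmodM [leRHS]mulrCA [leRHS]mulrC ler_pM ?cmod_ge0.
have k4 : cmod (u * (h%:C * Y)) <= h * (G * e1).
  rewrite !cmodM cmod_real ger0_norm// [leLHS]mulrCA ler_wpM2l// [leRHS]mulrC ler_pM ?cmod_ge0//.
  exact: le_trans g4 e21.
apply: le_trans (le_trans (cmodD _ _) (lerD (le_trans (cmodD _ _) (lerD (le_trans (cmodD _ _) (lerD k1 k2)) k3)) k4)) _.
rewrite -!mulrDr ler_wpM2l// -!mulrDl.
apply: (@le_trans _ _ (C * e1)); last by rewrite mulrC divfK// gt_eqF.
by rewrite ler_wpM2r ?(ltW e10)// lerDl.
Qed.

(** Near each [s] half of the distance at [s] is a lower bound, because [dist_halfline] is
    Lipschitz; chaining makes the bound uniform. *)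
Lemma characteristic_dist_bound z c a b : 0 <= a -> a <= b ->
  (forall t, a <= t <= b -> 0 < dist_halfline (characteristic z c t)) ->
  exists2 e : R, 0 < e &
    forall t, a <= t <= b -> e <= dist_halfline (characteristic z c t).
Proof.
move=> a0 ab pos.
apply: (@cousin_chain _ (fun x y => exists2 e : R, 0 < e &
  forall t, x <= t <= y -> e <= dist_halfline (characteristic z c t))) => //.
  move=> x y u xy yu [e e0 he] [f f0 hf]; exists (Num.min e f).
    by rewrite lt_min e0.
  move=> t /andP[xt tu]; have [ty|yt] := leP t y.
    by rewrite ge_min he ?xt.
  by rewrite ge_min hf ?orbT// (ltW yt).
move=> s /andP[sa sb].
have d0 : 0 < dist_halfline (characteristic z c s) by apply: pos; rewrite sa.
have e0 : 0 < dist_halfline (characteristic z c s) / 2 by rewrite divr_gt0.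
have [d dp hd] := characteristic_increment z c (le_trans a0 ab) e0.
exists d => // p q ap ps sq qb sp qs.
exists (dist_halfline (characteristic z c s) / 2) => // t /andP[pt tq].
suff : cmod (characteristic z c s - characteristic z c t) <=
    dist_halfline (characteristic z c s) / 2.
  by have := cmod_lipschitz_dist (characteristic z c s) (characteristic z c t); lra.
have [ts|st] := leP t s.
  have [||||_ h] // := hd t s.
  - exact: le_trans (le_trans a0 ap) pt.
  - by rewrite ltrBlDr -ltrBlDl (lt_le_trans _ pt).
rewrite cmodBC; have [||||_ h] // := hd s t.
- exact: le_trans a0 sa.
- exact: ltW.
- exact: le_trans qb.
- by rewrite ltrBlDl (le_lt_trans tq).
Qed.

Lemma characteristic_const z c a b : 0 <= a -> a <= b ->
  (forall t, a <= t <= b -> 0 < dist_halfline (characteristic z c t)) ->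
  stieltjes_h a (characteristic z c a) = c <->
  stieltjes_h b (characteristic z c b) = c.
Proof.
move=> a0 ab pos; have b0 := le_trans a0 ab.
have [e e0 he] := characteristic_dist_bound a0 ab pos.
have [Z Z0 hZ] := characteristic_bound z c b.
pose k t := stieltjes_h t (characteristic z c t).
have k0 t : cmod (k t - c) = 0 <-> k t = c.
  split=> [/eqP|->]; last by rewrite subrr cmod0.
  by rewrite cmod_eq0 subr_eq0 => /eqP.
have r0 : 0 < e^-1 by rewrite invr_gt0.
apply: (iff_trans (iff_sym (k0 a))); apply: iff_trans (k0 b).
apply: (@gronwall_zero _ (fun t => cmod (k t - c)) _ _ (Z * (e^-1 + Z * e^-1 ^+ 2))) => //.
- by rewrite mulr_ge0// addr_ge0 ?mulr_ge0 ?exprn_ge0// ltW.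
- by move=> s _; exact: cmod_ge0.
move=> s f /andP[sa sb] f0.
have sb' : 0 <= s <= b by rewrite sb (le_trans a0).
have [d d0 hd] := stieltjes_h_increment b0 r0 hZ sb' f0.
exists d => // p q ap pq qb ps qs.
apply: le_trans (hd p q (le_trans a0 ap) pq qb ps qs _).
  rewrite -/(k _) -/(k _); have := cmodD (k q - k p) (k p - c).
  have := cmodD (k p - k q) (k q - c); rewrite !addrA !subrK [cmod (k p - k q)]cmodBC.
  by rewrite ler_norml; lra.
move=> t /andP[pt tq]; rewrite invrK; apply: he.
by rewrite (le_trans ap pt) (le_trans tq qb).
Qed.

End Characteristics.

(** * Polar form in the upper half-plane *)

Section PolarForm.
Variable R : realType.

Lemma Re_polar (r a : R) : complex.Re (r%:C * cexp (0 +i* a)) = r * cos a.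
Proof. by rewrite /= expR0; ring. Qed.

Lemma Im_polar (r a : R) : complex.Im (r%:C * cexp (0 +i* a)) = r * sin a.
Proof. by rewrite /= expR0; ring. Qed.

Lemma polar_upper (z : R[i]) : 0 < complex.Im z -> exists phi : R,
  [/\ 0 < phi, phi < pi & z = (cmod z)%:C * cexp (0 +i* phi)].
Proof.
move=> iz; have n0 : 0 < cmod z.
  by rewrite lt_def cmod_ge0 cmod_eq0 andbT; apply: contraTneq iz => ->; rewrite ltxx.
pose x := complex.Re z / cmod z.
have xE : `|x| < 1.
  rewrite normrM normfV [`|cmod z|]ger0_norm ?cmod_ge0// ltr_pdivrMr// mul1r.
  rewrite -(@ltr_pXn2r _ 2)// ?nnegrE ?cmod_ge0// sqr_cmod real_normK ?num_real//.
  by rewrite ltrDl exprn_gt0.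
have x11 : -1 <= x <= 1 by move: xE; rewrite ltr_norml => /andP[/ltW-> /ltW->].
have s2 : Num.sqrt (1 - x ^+ 2) = complex.Im z / cmod z.
  rewrite (_ : 1 - x ^+ 2 = (complex.Im z / cmod z) ^+ 2).
    by rewrite sqrtr_sqr ger0_norm// divr_ge0 ?ltW ?cmod_ge0.
  have h := sqr_cmod z; rewrite /x !expr_div_n.
  rewrite -[1](@divff _ (cmod z ^+ 2)) ?expf_neq0 ?gt_eqF//.
  by rewrite -mulrBl h addrAC subrr add0r.
exists (acos x); split.
- rewrite lt_def acos_ge0// andbT; apply/eqP => e.
  have := acosK x11; rewrite e cos0 => x1.
  by move: xE; rewrite -x1 normr1 ltxx.
- rewrite lt_def acos_lepi// andbT; apply/eqP => e.
  have := acosK x11; rewrite -e cospi => x1.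
  by move: xE; rewrite -x1 normrN normr1 ltxx.
apply: complex_eqP; rewrite ?(cReM, cImM)/= expR0 !mul1r !mul0r ?subr0 ?addr0.
  by rewrite acosK// /x mulrC divfK// gt_eqF.
by rewrite sin_acos// s2 mulrC divfK// gt_eqF.
Qed.

Lemma dist_halfline_upper (z : R[i]) : 0 < complex.Im z -> 0 < dist_halfline z.
Proof. by move=> h; rewrite lt_max normr_gt0 gt_eqF. Qed.

Lemma dist_halfline_nonreal (z : R[i]) : complex.Im z != 0 -> 0 < dist_halfline z.
Proof. by move=> h; rewrite lt_max normr_gt0 h. Qed.

End PolarForm.

(** * The functional equation *)

Section FunctionalEquation.
Variables (R : realType) (A : wstarProbSpace R) (W X : R -> A) (theta : R).
Hypothesis bm : free_brownian_motion W.
Hypothesis posX : forall t, 0 <= t -> positive (X t).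
Hypothesis sde :
  free_sde W (fun x => theta%:C *: x) (@psqrt R A) (@psqrt R A) X.
Hypothesis X0 : X 0 = 1.

Let saX t (t0 : 0 <= t) : selfadjoint (X t) := solution_selfadjoint sde t0.

Local Notation Rs t z := ((X t - z%:A)^-1).
Local Notation alpha := (theta - 1).
Local Notation hS := (stieltjes_h X).
Local Notation char := (characteristic theta).

Lemma star_inv (a : A) : a \is a GRing.unit -> star a^-1 = (star a)^-1.
Proof.
move=> ua; have us : star a \is a GRing.unit.
  by apply/unitrP; exists (star a^-1); rewrite -!starM mulrV// mulVr// star1.
by apply: (mulrI us); rewrite -starM mulVr// star1 mulrV.
Qed.

Lemma star_solution_resolvent t z : 0 <= t -> 0 < dist_halfline z ->
  star (Rs t z) = Rs t (conjc z).
Proof.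
move=> t0 d0; rewrite star_inv ?(solution_unit posX sde)//.
by rewrite star_resolvent//; exact: saX.
Qed.

Lemma dist_halfline_conj (z : R[i]) : dist_halfline (conjc z) = dist_halfline z.
Proof. by case: z => a b; rewrite /dist_halfline /= normrN. Qed.

(** From the resolvent identity at [z] and its conjugate together with [X R = 1 + z R]. The trace on
    the right is the Poisson-type integral of [u / |u - z|^2], so the sign of [Im h] is that of
    [Im z], and [h] is real on the negative axis. *)
Lemma Im_stieltjes_h t z : 0 <= t -> 0 < dist_halfline z ->
  complex.Im (hS t z) =
  complex.Im z * complex.Re (Ex (X t * (Rs t z * Rs t (conjc z)))).
Proof.
move=> t0 d0; have d0' : 0 < dist_halfline (conjc z) by rewrite dist_halfline_conj.
have u := solution_unit posX sde t0 d0; have u' := solution_unit posX sde t0 d0'.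
have XR := mul_resolvent posX sde t0 d0.
have starR := star_solution_resolvent t0 d0.
set Q := Rs t z in u XR starR *; set Q' := Rs t (conjc z) in u' starR *.
have e : X t * (Q * Q') = Q' + z *: (Q * Q').
  by rewrite mulrA XR mulrDl mul1r scalerAl.
have real : complex.Im (Ex (Q * Q')) = 0.
  by rewrite Ex_tracial -starR tnorm2E.
rewrite /stieltjes_h e ExD ExZ cReD cReM real mulr0 subr0.
have -> : Ex Q' = conjc (Ex Q) by rewrite -starR Ex_star.
have id : Q - Q' = (z - conjc z) *: (Q * Q').
  rewrite invr_sub//.
  have -> : X t - (conjc z)%:A - (X t - z%:A) = (z - conjc z)%:A.
    by rewrite opprB addrC addrA subrK scalerBl.
  by rewrite mulr_algr -scalerAl.
have := congr1 (@Ex R A) id; rewrite ExB ExZ -starR Ex_star.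
move: real; rewrite -starR; case: (Ex (Q * _)) => c d /= ->.
case: (Ex Q) => p q; case: z {d0 d0' u u' XR starR e id Q Q'} => x y /=.
case=> _ h; have {}h : q = y * c by lra.
by rewrite h; ring.
Qed.

Lemma Im_stieltjes t z : 0 <= t -> 0 < dist_halfline z ->
  complex.Im (Ex (Rs t z)) = complex.Im z * complex.Re (Ex (Rs t z * Rs t (conjc z))).
Proof.
move=> t0 d0; have d0' : 0 < dist_halfline (conjc z) by rewrite dist_halfline_conj.
have u := solution_unit posX sde t0 d0; have u' := solution_unit posX sde t0 d0'.
have starR := star_solution_resolvent t0 d0.
set Q := Rs t z in u starR *; set Q' := Rs t (conjc z) in u' starR *.
have real : complex.Im (Ex (Q * Q')) = 0.
  by rewrite Ex_tracial -starR tnorm2E.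
have id : Q - Q' = (z - conjc z) *: (Q * Q').
  rewrite invr_sub//.
  have -> : X t - (conjc z)%:A - (X t - z%:A) = (z - conjc z)%:A.
    by rewrite opprB addrC addrA subrK scalerBl.
  by rewrite mulr_algr -scalerAl.
have := congr1 (@Ex R A) id; rewrite ExB ExZ -starR Ex_star.
move: real; rewrite -starR; case: (Ex (Q * _)) => c d /= ->.
case: (Ex Q) => p q; case: z {d0 d0' u u' starR id Q Q'} => x y /=.
by case=> _ h; lra.
Qed.

Lemma Ex_X_resolvent_ge0 t z : 0 <= t -> 0 < dist_halfline z ->
  0 <= complex.Re (Ex (X t * (Rs t z * Rs t (conjc z)))).
Proof.
move=> t0 d0; have starR := star_solution_resolvent t0 d0.
have [b [sb _ bb]] := positive_sqrt (saX t0) (posX t0).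
rewrite -starR -{1}bb -[b * b * _]mulrA Ex_tracial.
have -> : b * (Rs t z * star (Rs t z)) * b = star (star (Rs t z) * b) * (star (Rs t z) * b).
  by rewrite starM starK sb !mulrA.
exact: tnorm2_ge0.
Qed.

(** Strictness comes from faithfulness: the resolvent is invertible, hence not zero. *)
Lemma Ex_resolvent_gt0 t z : 0 <= t -> 0 < dist_halfline z ->
  0 < complex.Re (Ex (Rs t z * Rs t (conjc z))).
Proof.
move=> t0 d0; rewrite Ex_tracial -star_solution_resolvent// -/(tnorm2 _).
rewrite lt_def tnorm2_ge0 andbT; apply/eqP => /tnorm2_eq0 e.
have := solution_unit posX sde t0 d0; rewrite -unitrV e.
by rewrite unitr0.
Qed.

Lemma stieltjes_h_initial z : z != 1 -> hS 0 z = z / (1 - z).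
Proof.
move=> z1; have nz : 1 - z != 0 by rewrite subr_eq0 eq_sym.
rewrite /stieltjes_h X0; congr (_ * _).
have -> : 1 - z%:A = (1 - z)%:A :> A by rewrite scalerBl scale1r.
have -> : ((1 - z)%:A)^-1 = ((1 - z)^-1)%:A :> A.
  have u : (1 - z)%:A \is a @GRing.unit A.
    by apply/unitrP; exists ((1 - z)^-1)%:A; rewrite !mulr_algl !scalerA mulVf ?divff// scale1r.
  by apply: (mulrI u); rewrite mulrV// mulr_algl scalerA divff// scale1r.
by rewrite Ex_alg.
Qed.

Lemma characteristic_initial z c : char z c 0 = z.
Proof. by rewrite /characteristic rmorph0 mulr0 cexp0 mulr1. Qed.

(** [z0] is the solution of [z / (1 - z) = eta], so the characteristic with constant [eta] that
    starts there carries the value [eta]. *)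
Lemma characteristic_forward (eta : R[i]) t (z0 := eta / (1 + eta)) : 0 <= t ->
  1 + eta != 0 -> (forall s, 0 <= s <= t -> 0 < complex.Im (char z0 eta s)) ->
  hS t (char z0 eta t) = eta.
Proof.
move=> t0 n0 pos.
have pos' s : 0 <= s <= t -> 0 < dist_halfline (char z0 eta s).
  by move=> hs; apply: dist_halfline_upper; exact: pos.
apply: (characteristic_const bm posX sde (lexx 0) t0 pos').1.
rewrite characteristic_initial stieltjes_h_initial.
  rewrite /z0 (_ : 1 - eta / (1 + eta) = (1 + eta)^-1); last by field.
  by rewrite invrK divfK.
apply/eqP => e; have := pos 0; rewrite lexx t0 => /(_ isT).
by rewrite characteristic_initial e ltxx.
Qed.

(** At time [s] the characteristic has argument [phi + v * (t - s)], with [phi] the argument of [z]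
    and [v = Im c]. If this reached [pi] at some [s >= 0], the point would lie on the negative axis,
    where [h] is real, against [v > 0]. Hence [phi + v * t < pi], which yields both the bound on
    [v * t] and the passage down to time [0]. *)
Lemma characteristic_backward t z (c := hS t z) (z0 := z / cexp ((alpha%:C - c) * t%:C)) :
  0 <= t -> 0 < complex.Im z ->
  [/\ 0 <= complex.Im c, complex.Im c * t < pi, z0 != 1 & hS 0 z0 = c].
Proof.
move=> t0 iz; have dz := dist_halfline_upper iz.
have v0 : 0 <= complex.Im c.
  by rewrite Im_stieltjes_h// mulr_ge0 ?Ex_X_resolvent_ge0// ltW.
have zE : char z0 c t = z by rewrite /characteristic divfK// cexp_neq0.
have [phi [phi0 phipi zpol]] := polar_upper iz.
set u := complex.Re c; set v := complex.Im c in v0 *.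
have chE s : char z0 c s =
    (cmod z * expR ((alpha - u) * (s - t)))%:C * cexp (0 +i* (phi + v * (t - s))).
  rewrite (characteristicD theta z0 c t s) zE {1}zpol !rmorphM/= -!mulrA; congr (_ * _).
  have -> : (expR ((alpha - u) * (s - t)))%:C = cexp ((alpha - u) * (s - t))%:C.
    by apply: complex_eqP; rewrite /= ?cos0 ?sin0 ?mulr1 ?mulr0.
  rewrite -!cexpD; congr cexp.
  have aux (d : R[i]) : (0 +i* phi) + (alpha%:C - d) * (s - t)%:C =
      ((alpha - complex.Re d) * (s - t))%:C + (0 +i* (phi + complex.Im d * (t - s))).
    by case: d => d1 d2; apply: complex_eqP => /=; ring.
  exact: aux.
have n0 : 0 < cmod z.
  by rewrite lt_def cmod_ge0 cmod_eq0 andbT; apply: contraTneq iz => ->; rewrite ltxx.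
have amp s : 0 < cmod z * expR ((alpha - u) * (s - t)) by rewrite mulr_gt0 ?expR_gt0.
have pos s : phi + v * (t - s) <= pi -> s <= t -> 0 < dist_halfline (char z0 c s).
  move=> angle st; rewrite chE.
  move: (amp s); set r := cmod z * _ => r0.
  have a0 : 0 < phi + v * (t - s) by rewrite ltr_pwDl// mulr_ge0// subr_ge0.
  move: angle; rewrite le_eqVlt => /predU1P[->|angle].
    by rewrite lt_max Re_polar cospi mulrN1 opprK r0 orbT.
  apply: dist_halfline_upper; rewrite Im_polar mulr_gt0//.
  by apply: sin_gt0_pi; rewrite a0.
have kt : hS t (char z0 c t) = c by rewrite zE.
have key : phi + v * t < pi.
  rewrite ltNge; apply/negP => big.
  have vp : 0 < v.
    by rewrite lt_def v0 andbT; apply/eqP => ve; move: big; rewrite ve mul0r addr0 leNgt phipi.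
  (* The time at which the argument equals [pi]. The negative axis is still at positive distance
     from the half-line, so [h] is constant up to and including this time. *)
  pose s := t - (pi - phi) / v.
  have s0 : 0 <= s by rewrite subr_ge0 ler_pdivrMr// lerBlDl mulrC.
  have st : s <= t by rewrite lerBlDr lerDl divr_ge0// subr_ge0 ltW.
  have vs : v * (t - s) = pi - phi.
    by rewrite /s opprB addrCA subrr addr0 mulrC divfK// gt_eqF.
  have pos' r : s <= r <= t -> 0 < dist_halfline (char z0 c r).
    move=> /andP[sr rt]; apply: pos => //.
    have : v * (t - r) <= v * (t - s) by rewrite ler_wpM2l// lerD2l lerN2.
    by rewrite vs; lra.
  have ks := (characteristic_const bm posX sde s0 st pos').2 kt.
  have ds : 0 < dist_halfline (char z0 c s) by apply: pos'; rewrite lexx st.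
  have : v = 0.
    rewrite /v -[in LHS]ks Im_stieltjes_h//.
    rewrite {1}chE vs Im_polar (_ : phi + (pi - phi) = pi); last by ring.
    by rewrite sinpi !mulr0 mul0r.
  by move=> ve; move: vp; rewrite ve ltxx.
have pos' s : 0 <= s <= t -> 0 < dist_halfline (char z0 c s).
  move=> /andP[s0 st]; apply: pos => //; apply: ltW; apply: le_lt_trans key.
  by rewrite lerD2l ler_wpM2l// lerBlDr lerDl.
have k0 := (characteristic_const bm posX sde (lexx 0) t0 pos').2 kt.
rewrite characteristic_initial in k0; split=> //.
  by apply: le_lt_trans key; rewrite lerDr ltW.
apply/eqP => z01; have := chE 0; rewrite characteristic_initial z01 subr0 => e.
have : 0 < complex.Im (1 : R[i]).
  rewrite e Im_polar; apply: mulr_gt0; first exact: amp.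
  by apply: sin_gt0_pi; rewrite key ltr_pwDl// mulr_ge0.
by rewrite /= ltxx.
Qed.

Lemma stieltjes_neq0 t z : 0 <= t -> complex.Im z != 0 -> Ex (Rs t z) != 0.
Proof.
move=> t0 iz; apply/eqP => e; have d0 := dist_halfline_nonreal iz.
have := Im_stieltjes t0 d0; rewrite e => /eqP; rewrite eq_sym mulf_eq0 (negbTE iz)/=.
by rewrite gt_eqF// Ex_resolvent_gt0.
Qed.

Lemma functional_equation_upper t z (g := Ex (Rs t z)) : 0 <= t -> 0 < complex.Im z ->
  z + g^-1 = cexp ((alpha%:C - z * g) * t%:C).
Proof.
move=> t0 iz; have [_ _ z01] := characteristic_backward t0 iz.
have g0 : g != 0 by apply: stieltjes_neq0 => //; rewrite gt_eqF.
have z0 : z != 0 by apply: contraTneq iz => ->; rewrite ltxx.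
rewrite stieltjes_h_initial// /stieltjes_h -/g => e.
have n0 := cexp_neq0 ((alpha%:C - z * g) * t%:C).
move: z01 e n0; rewrite /stieltjes_h -/g; set E := cexp _ => z01 e n0.
have n1 : 1 - z / E != 0 by rewrite subr_eq0 eq_sym.
have h : g * (E - z) = 1.
  apply: (mulfI z0); rewrite mulrA -e mulr1.
  have -> : E - z = (1 - z / E) * E by rewrite mulrBl mul1r divfK.
  by rewrite mulrA divfK// divfK.
have -> : g^-1 = E - z by apply: (mulfI g0); rewrite h divff.
by rewrite addrC subrK.
Qed.

Lemma functional_equation t z (g := Ex (Rs t z)) : 0 <= t -> complex.Im z != 0 ->
  z + g^-1 = cexp ((alpha%:C - z * g) * t%:C).
Proof.
move=> t0 iz; have [|i0] := ltP 0 (complex.Im z).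
  exact: functional_equation_upper.
have iz' : 0 < complex.Im (conjc z).
  by case: z iz i0 {g} => a b /= b0 b1; rewrite oppr_gt0 lt_def eq_sym b0.
have d0 := dist_halfline_nonreal iz.
have := functional_equation_upper t0 iz'.
rewrite -star_solution_resolvent// Ex_star -/g => /(congr1 conjc).
rewrite -cexp_conj rmorphD/= conjcK => e.
have {e} : z + (conjc (conjc g)^-1) = cexp (conjc ((alpha%:C - conjc z * conjc g) * t%:C)) by [].
have aux (z' g' : R[i]) : conjc ((alpha%:C - conjc z' * conjc g') * t%:C) =
    (alpha%:C - z' * g') * t%:C.
  by case: z' g' => a b [a' b']; apply: complex_eqP => /=; ring.
by rewrite conjc_inv conjcK aux.
Qed.

End FunctionalEquation.
(** * Spectral distribution *)

Section SpectralMeasure.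
Variables (R : realType) (A : wstarProbSpace R) (x : A).
Variable mu : probability (measurableTypeR R) R.
Hypothesis spec : spectral_distribution x mu.
Implicit Types (p f : {poly R}) (I J N : set (measurableTypeR R)).

Definition poly_eval p : A := horner_alg x (map_poly (real_complex R) p).

Lemma spectral_poly p : mu.-integrable setT (EFin \o horner p) /\
  Ex (poly_eval p) = (\int[mu]_y p.[y])%:C.
Proof.
pose F n : R -> R := fun y => \sum_(i < n) p`_i * y ^+ i.
have h n : mu.-integrable setT (EFin \o F n) /\
    Ex (\sum_(i < n) (p`_i)%:C *: x ^+ i) = (\int[mu]_y F n y)%:C.
  elim: n => [|n [ih1 ih2]].
    have F0 : F 0%N = cst 0 by apply/funext => y; rewrite /F big_ord0.
    rewrite F0 big_ord0 Ex0 Rintegral_cst// mul0r; split=> //.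
    exact: finite_measure_integrable_cst.
  have FS : F n.+1 = fun y => F n y + p`_n * y ^+ n.
    by apply/funext => y; rewrite /F big_ord_recr.
  have [i1 i2] := spec n.
  have i3 : mu.-integrable setT (EFin \o (fun y => p`_n * y ^+ n)).
    have -> : EFin \o (fun y => p`_n * y ^+ n) = (fun y => (p`_n)%:E * (y ^+ n)%:E)%E.
      by apply/funext => y; rewrite /= EFinM.
    by apply: integrableZl => //; exact: i1.
  rewrite FS big_ord_recr/= RintegralD// RintegralZl// ExD ExZ ih2 i2 rmorphD rmorphM.
  split=> //.
  have -> : EFin \o (fun y => F n y + p`_n * y ^+ n) =
      ((EFin \o F n) \+ (EFin \o (fun y : R => (p`_n * y ^+ n)%R)))%E.
    by apply/funext => y; rewrite /= EFinD.
  by apply: integrableD.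
have [h1 h2] := h (size p).
have -> : horner p = F (size p) by apply/funext => y; rewrite horner_coef.
split=> //; rewrite -h2; apply: (congr1 (@Ex R A)).
rewrite /poly_eval -{1}(coefK p) poly_def !raddf_sum/=; apply: eq_bigr => i _.
by rewrite map_polyZ map_polyXn/= linearZ/= rmorphXn/= horner_algX mulr_algl.
Qed.

Lemma poly_evalD p f : poly_eval (p + f) = poly_eval p + poly_eval f.
Proof. by rewrite /poly_eval !rmorphD. Qed.

Lemma poly_evalB p f : poly_eval (p - f) = poly_eval p - poly_eval f.
Proof. by rewrite /poly_eval !rmorphB. Qed.

Lemma poly_evalM p f : poly_eval (p * f) = poly_eval p * poly_eval f.
Proof. by rewrite /poly_eval !rmorphM. Qed.

Lemma poly_evalX n : poly_eval ('X ^+ n) = x ^+ n.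
Proof. by rewrite /poly_eval map_polyXn rmorphXn/= horner_algX. Qed.

Lemma poly_eval_exp p n : poly_eval (p ^+ n) = poly_eval p ^+ n.
Proof. by rewrite /poly_eval !rmorphXn. Qed.

Lemma poly_evalC (c : R) : poly_eval c%:P = c%:C%:A.
Proof. by rewrite /poly_eval map_polyC/= horner_algC. Qed.

Lemma poly_eval1 : poly_eval 1 = 1.
Proof. by rewrite /poly_eval !rmorph1. Qed.

Definition mass I : R := fine (mu I).

Lemma mass_ge0 I : 0 <= mass I.
Proof. by rewrite fine_ge0// measure_ge0. Qed.

Lemma massE I : measurable I -> mu I = (mass I)%:E.
Proof. by move=> mI; rewrite fineK// fin_num_measure. Qed.

Lemma mass_le I N : measurable I -> measurable N -> I `<=` N -> mass I <= mass N.
Proof. by move=> mI mN IN; rewrite -lee_fin -!massE// le_measure ?inE. Qed.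

Lemma mass_eq0 I : measurable I -> mass I <= 0 -> mu I = 0.
Proof.
move=> mI h; rewrite massE//; congr (_%:E); apply/eqP.
by rewrite eq_le h mass_ge0.
Qed.

Lemma massU_le I J : measurable I -> measurable J -> mass (I `|` J) <= mass I + mass J.
Proof.
move=> mI mJ; rewrite -lee_fin EFinD -!massE//; last exact: measurableU.
exact: measureU2.
Qed.

(** Markov's inequality for polynomial integrands, the only ones whose integral is known from the
    operator. The null set [N] allows signs to be checked on an interval carrying [mu]. *)
Lemma mass_poly_le I N f (k : R) : measurable I -> measurable N -> mu N = 0 ->
  (forall y, ~ N y -> 0 <= f.[y]) -> (forall y, I y -> ~ N y -> k <= f.[y]) ->
  0 <= k -> k * mass I <= complex.Re (Ex (poly_eval f)).
Proof.
move=> mI mN N0 f0 fk k0; have [fi ->] := spectral_poly f.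
have mIN : measurable (I `\` N) by exact: measurableD.
have mf : measurable_fun setT (EFin \o horner f) := measurable_int _ fi.
have eI : mu I = mu (I `\` N).
  rewrite measureD//; last by rewrite ltey_eq fin_num_measure.
  rewrite [X in (_ - X)%E](_ : _ = 0%E) ?sube0//.
  by apply: (subset_measure0 _ _ _ N0) => //; exact: measurableI.
have -> : complex.Re (\int[mu]_y f.[y])%:C = fine (\int[mu]_y (f.[y])%:E)%E by [].
rewrite -lee_fin EFinM [leRHS]fineK; last exact: (integrable_fin_num measurableT fi).
rewrite -massE// eI -[leLHS](integral_cst mu mIN k%:E).
rewrite [leRHS](negligible_integral mN (@measurableT _ (measurableTypeR R)) fi N0).
apply: (@le_trans _ _ (\int[mu]_(y in I `\` N) (f.[y])%:E)%E).
  apply: ge0_le_integral => //.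
  - exact: measurable_funTS.
  - by move=> y [Iy Ny]; rewrite lee_fin fk.
apply: ge0_subset_integral => //.
- exact: measurableD.
- exact: measurable_funTS.
- by move=> y [_ Ny]; rewrite lee_fin f0.
- by move=> y [].
Qed.

End SpectralMeasure.

(** * Support of the spectral distribution and Poisson-type integrals *)

Section SpectralSupport.
Variables (R : realType) (A : wstarProbSpace R) (x : A).
Variable mu : probability (measurableTypeR R) R.
Hypothesis spec : spectral_distribution x mu.
Hypotheses (sa : selfadjoint x) (px : positive x).
Implicit Types (p f : {poly R}) (I N : set (measurableTypeR R)).
Local Notation eval := (poly_eval x).
Local Notation mass := (mass mu).

Lemma le_geometric (a b k r : R) : 0 <= r -> r < 1 -> 0 <= k ->
  (forall n, a <= b + k * r ^+ n) -> a <= b.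
Proof.
move=> r0 r1 k0 h; apply/ler_addgt0Pr => e e0.
have k1 : 0 < k + 1 by rewrite ltr_wpDl.
have [n hn] := expr_small r0 r1 (divr_gt0 e0 k1).
apply: le_trans (h n) _; rewrite lerD2l; move: hn; rewrite ltr_pdivlMr// => hn.
have := exprn_ge0 n r0; nra.
Qed.

(** Chebyshev's inequality with the even powers of [u - M / 2]. Positivity gives [x - M / 2] norm at
    most [M / 2], while outside the interval the distance to the midpoint is at least [M / 2 + c];
    the power of the ratio tends to [0]. *)
Lemma mass_outside (M c : R) : opnorm x <= M -> 0 < c ->
  mu (~` `[- c, M + c]) = 0.
Proof.
move=> xM c0; have M0 : 0 <= M by apply: le_trans xM; exact: opnorm_ge0.
have mS : measurable (~` `[- c, M + c] : set (measurableTypeR R)) by exact: measurableC.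
suff : mass (~` `[- c, M + c]) <= 0.
  move=> h; rewrite massE//; congr (_%:E); apply/eqP.
  by rewrite eq_le h mass_ge0.
pose b := M / 2 + c; have b0 : 0 < b by rewrite /b ltr_wpDl// divr_ge0.
have r1 : (M / 2 / b) ^+ 2 < 1.
  rewrite expr_lte1// ?divr_ge0 ?(ltW b0)//.
  by rewrite ltr_pdivrMr// mul1r /b ltrDl.
apply: (@le_geometric _ _ 1 _ (sqr_ge0 _) r1) => // n; rewrite add0r mul1r.
have nx : opnorm (x - (M / 2)%:C%:A) <= M / 2.
  apply: selfadjoint_opnorm_le.
  - by apply: selfadjointB => //; apply: selfadjointZ; exact: selfadjoint1.
  - by rewrite divr_ge0.
  move=> xi; rewrite qformB qform_alg/=.
  have q0 := positive_qform xi px.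
  have := qform_le x xi; rewrite (ger0_norm q0) => qM.
  have := ler_wpM2r (sqr_ge0 (hnorm xi)) xM.
  by rewrite ler_norml => qM'; apply/andP; split; lra.
pose f : {poly R} := ('X - (M / 2)%:P) ^+ (2 * n).
have fE y : f.[y] = (y - M / 2) ^+ (2 * n) by rewrite /f horner_exp hornerXsubC.
have h : b ^+ (2 * n) * mass (~` `[- c, M + c]) <= complex.Re (Ex (eval f)).
  apply: (mass_poly_le spec mS (@measurable0 _ _)).
  - exact: measure0.
  - by move=> y _; rewrite fE exprM exprn_ge0// sqr_ge0.
  - move=> y /= hy _; rewrite fE !exprM lerXn2r ?nnegrE ?sqr_ge0//.
    move: hy; rewrite in_itv/= => /negP; rewrite negb_and -!ltNge /b => /orP[hy|hy]; nra.
  - by rewrite exprn_ge0// ltW.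
have g : complex.Re (Ex (eval f)) <= (M / 2) ^+ (2 * n).
  apply: le_trans (le_trans (ler_norm _) (Re_le_cmod _)) (le_trans (Ex_le _) _).
  rewrite /f poly_eval_exp poly_evalB poly_evalC -['X]expr1 poly_evalX expr1.
  exact: opnormX_le.
have bn : 0 < b ^+ (2 * n) by rewrite exprn_gt0.
rewrite -exprM expr_div_n ler_pdivlMr// mulrC.
exact: le_trans h g.
Qed.

Lemma spectral_support (M : R) : opnorm x <= M -> mu (~` `[0, M]) = 0.
Proof.
move=> xM.
have -> : ~` `[0, M] = \bigcup_k (~` `[- k.+1%:R^-1, M + k.+1%:R^-1]) :> set R.
  rewrite -setC_bigcap; congr (~` _); apply/seteqP; split=> y /=.
    rewrite in_itv/= => /andP[y0 yM] k _ /=; rewrite in_itv/=.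
    by rewrite (le_trans _ y0) ?oppr_le0//= (le_trans yM)// lerDl.
  move=> h; rewrite in_itv/=.
  have inv k : 0 < k.+1%:R^-1 :> R by [].
  have small (e : R) : 0 < e -> exists k, k.+1%:R^-1 < e.
    move=> e0; exists (Num.truncn e^-1); rewrite -[ltRHS]invrK ltf_pV2 ?posrE ?invr_gt0//.
    exact: truncnS_gt.
  apply/andP; split.
    rewrite leNgt; apply/negP => y0.
    have [|k hk] := small (- y); first by rewrite oppr_gt0.
    by have := h k I; rewrite /= in_itv/= => /andP[+ _]; rewrite lerNl leNgt hk.
  rewrite leNgt; apply/negP => y0.
  have [|k hk] := small (y - M); first by rewrite subr_gt0.
  by have := h k I; rewrite /= in_itv/= => /andP[_]; rewrite -lerBlDl leNgt hk.
apply/negligibleP; first by apply: bigcup_measurable => k _; exact: measurableC.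
apply: negligible_bigcup => k; apply/negligibleP; first exact: measurableC.
exact: mass_outside.
Qed.

(* [P = (x - a)^2 + y^2] is invertible and [(1 - (1 - P/C)^n) / P] are
   polynomials that increase to [1/P] both at [x] and on the support of [mu]. *)
Lemma mass_resolvent_le (a y : R) (w : {poly R}) I (k : R) (z := a +i* y) : 0 < y ->
  (forall u, 0 <= u -> 0 <= w.[u]) -> measurable I -> 0 <= k ->
  (forall u, I u -> 0 <= u -> k * ((u - a) ^+ 2 + y ^+ 2) <= w.[u]) ->
  k * mass I <= complex.Re (Ex (eval w * ((x - z%:A)^-1 * (x - (conjc z)%:A)^-1))).
Proof.
move=> y0 w0 mI k0 hk.
have dz : 0 < dist_halfline z by apply: dist_halfline_upper.
have dz' : 0 < dist_halfline (conjc z) by rewrite dist_halfline_conj.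
have u1 := resolvent_unit sa px dz; have u2 := resolvent_unit sa px dz'.
pose P : {poly R} := ('X - a%:P) ^+ 2 + (y ^+ 2)%:P.
have PE u : P.[u] = (u - a) ^+ 2 + y ^+ 2.
  by rewrite /P hornerD horner_exp hornerXsubC hornerC.
have sR : star (x - z%:A) = x - (conjc z)%:A by exact: star_resolvent.
have evP : eval P = (x - (conjc z)%:A) * (x - z%:A).
  have zE : z = a%:C + (0 +i* y) by apply: complex_eqP; rewrite /= ?addr0 ?add0r.
  have zE' : conjc z = a%:C - (0 +i* y).
    by apply: complex_eqP; rewrite /= ?subr0 ?sub0r ?oppr0 ?addr0 ?add0r.
  rewrite zE'; clearbody z; rewrite zE.
  set B := x - a%:C%:A; set Y : A := (0 +i* y)%:A.
  have -> : x - (a%:C - (0 +i* y))%:A = B + Y.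
    by rewrite scalerBl opprB addrA addrAC.
  have -> : x - (a%:C + (0 +i* y))%:A = B - Y.
    by rewrite scalerDl opprD addrA.
  have BY : B * Y = Y * B by rewrite mulr_algr mulr_algl.
  have YY : Y * Y = - (y ^+ 2)%:C%:A.
    rewrite mulr_algl scalerA -scaleNr; congr (_ *: _).
    by apply: complex_eqP => /=; ring.
  rewrite /P poly_evalD poly_eval_exp poly_evalB.
  rewrite -['X]expr1 poly_evalX expr1 !poly_evalC -/B.
  have -> : (B + Y) * (B - Y) = B * B - Y * Y.
    by clearbody B Y; rewrite mulrDl !mulrBr BY addrA subrK.
  by rewrite YY opprK expr2.
pose M := opnorm x.
(* [C] dominates the norm of [P] at [x] and also the values of [P] on [[0, M]]. *)
pose C := opnorm (eval P) + (M + `|a|) ^+ 2 + y ^+ 2.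
have M0 : 0 <= M by exact: opnorm_ge0.
have y2 : 0 < y ^+ 2 by rewrite exprn_gt0.
have C1 : y ^+ 2 <= C by rewrite /C lerDr addr_ge0 ?opnorm_ge0 ?sqr_ge0.
have C2 : opnorm (eval P) <= C by rewrite /C -addrA lerDl addr_ge0 ?sqr_ge0.
have C0 : 0 < C by apply: lt_le_trans C1.
have sP : selfadjoint (eval P) by rewrite evP -sR; exact: selfadjoint_star.
have cP xi : y ^+ 2 * hnorm xi ^+ 2 <= qform (eval P) xi.
  rewrite evP -sR qform_star -exprMn ler_pXn2r ?nnegrE ?hnorm_ge0 ?mulr_ge0 ?hnorm_ge0 ?(ltW y0)//.
  apply: le_trans (resolvent_lower_bound z xi sa px).
  by rewrite ler_wpM2r ?hnorm_ge0// /dist_halfline le_max /= ler_norm.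
pose r := 1 - y ^+ 2 / C.
have r0 : 0 <= r by rewrite subr_ge0 ler_pdivrMr// mul1r.
have r1 : r < 1 by rewrite /r ltrBlDr ltrDl divr_gt0.
(* The ratio of the geometric series for [1 / P]: norm at most [r < 1] at [x], values in [[0, r]] on
   [[0, M]]. *)
pose T : {poly R} := 1 - (C^-1)%:P * P.
have nT : opnorm (eval T) <= r.
  rewrite poly_evalB poly_eval1 poly_evalM poly_evalC mulr_algl.
  exact: (selfadjoint_contraction sP).
have Tu u : 0 <= u -> u <= M -> 0 <= T.[u] <= r.
  move=> u0 uM; rewrite /T hornerD hornerN hornerM !hornerC PE.
  have h1 : (u - a) ^+ 2 + y ^+ 2 <= C.
    rewrite /C lerD2r -[leLHS]add0r lerD ?opnorm_ge0//.
    rewrite -[leLHS]real_normK ?num_real// lerXn2r ?nnegrE ?addr_ge0//.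
    by apply: le_trans (ler_normB _ _) _; rewrite lerD2r ger0_norm.
  rewrite subr_ge0 ler_pdivrMl// mulr1 h1/= /r lerD2l lerN2 mulrC ler_wpM2l ?invr_ge0 ?(ltW C0)//.
  by rewrite lerDr sqr_ge0.
pose S n : {poly R} := (C^-1)%:P * \sum_(i < n) T ^+ i.
have PS n : P * S n = 1 - T ^+ n.
  have h := subrX1 T n.
  have TP : T - 1 = - ((C^-1)%:P * P) by rewrite /T addrAC subrr add0r.
  by rewrite -opprB h TP mulNr opprK /S; ring.
set Q := (x - z%:A)^-1 * (x - (conjc z)%:A)^-1.
have QP : Q * eval P = 1.
  by rewrite evP /Q mulrA mulrVK// mulVr.
have evS n : eval (S n) = Q * (1 - eval T ^+ n).
  rewrite -poly_eval_exp -(poly_eval1 x) -poly_evalB -PS poly_evalM mulrA QP.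
  by rewrite mul1r.
have SE n u : P.[u] * (S n).[u] = 1 - T.[u] ^+ n.
  by rewrite -hornerM PS hornerD hornerN hornerC horner_exp.
have Pu u : 0 < P.[u] by rewrite PE ltr_wpDl// sqr_ge0.
have S0 n u : 0 <= u -> u <= M -> 0 <= (S n).[u].
  move=> u0 uM; have /andP[t0 t1] := Tu u u0 uM.
  rewrite -(pmulr_rge0 _ (Pu u)) SE subr_ge0 exprn_ile1//.
  exact: le_trans t1 (ltW r1).
have bound n : k * (1 - r ^+ n) * mass I <= complex.Re (Ex (eval (w * S n))).
  apply: (mass_poly_le spec mI (N := ~` `[0, M])).
  - exact: measurableC.
  - exact: spectral_support.
  - move=> u /= /contrapT; rewrite in_itv/= => /andP[u0 uM].
    by rewrite hornerM mulr_ge0 ?w0 ?S0.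
  - move=> u Iu /= /contrapT; rewrite in_itv/= => /andP[u0 uM].
    rewrite hornerM; have /andP[t0 t1] := Tu u u0 uM.
    apply: (@le_trans _ _ (k * P.[u] * (S n).[u])).
      rewrite -mulrA SE ler_wpM2l// lerD2l lerN2.
      by rewrite lerXn2r ?nnegrE.
    by rewrite ler_wpM2r ?S0// PE hk.
  - by rewrite mulr_ge0// subr_ge0 exprn_ile1// ltW.
pose K := opnorm (eval w) * opnorm Q + k * mass I.
apply: (@le_geometric _ _ K r r0 r1).
  by rewrite addr_ge0 ?mulr_ge0 ?opnorm_ge0 ?mass_ge0.
move=> n; have := bound n; rewrite poly_evalM evS.
have -> : eval w * (Q * (1 - eval T ^+ n)) = eval w * Q - eval w * (Q * eval T ^+ n).
  by rewrite -mulrBr; congr (_ * _); rewrite mulrBr mulr1.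
rewrite ExB cReD cReN.
have h : `|complex.Re (Ex (eval w * (Q * eval T ^+ n)))| <= opnorm (eval w) * opnorm Q * r ^+ n.
  apply: le_trans (Re_le_cmod _) (le_trans (Ex_le _) (le_trans (opnormM _ _) _)).
  rewrite -mulrA ler_wpM2l ?opnorm_ge0// (le_trans (opnormM _ _))// ler_wpM2l ?opnorm_ge0//.
  exact: opnormX_le.
move: h; rewrite ler_norml => /andP[h _]; rewrite /K.
by move: (complex.Re _) (complex.Re _) (opnorm _ * _) h => e1 e2 e3 h1 h2; lra.
Qed.

End SpectralSupport.

(** * Bounds on the mass of intervals and of the origin *)

Section SpectralEstimates.
Variables (R : realType) (A : wstarProbSpace R) (W X : R -> A) (theta : R).
Hypothesis bm : free_brownian_motion W.
Hypothesis posX : forall t, 0 <= t -> positive (X t).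
Hypothesis sde : free_sde W (fun x => theta%:C *: x) (@psqrt R A) (@psqrt R A) X.
Hypothesis X0 : X 0 = 1.
Variables (t : R) (mu : probability (measurableTypeR R) R).
Hypotheses (t0 : 0 < t) (spec : spectral_distribution (X t) mu).
Implicit Types (I N : set (measurableTypeR R)) (a b p q e d : R).
Local Notation mass := (mass mu).
Local Notation alpha := (theta - 1).
Local Notation char := (characteristic theta).
Let t0' : 0 <= t := ltW t0.
Let sa : selfadjoint (X t) := solution_selfadjoint sde t0'.
Let px : positive (X t) := posX t0'.

Lemma mass_stieltjes_le a y I k : 0 < y -> measurable I -> 0 <= k ->
  (forall u, I u -> 0 <= u -> k * ((u - a) ^+ 2 + y ^+ 2) <= u) ->
  k * mass I <= complex.Im (stieltjes_h X t (a +i* y)) / y.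
Proof.
move=> y0 mI k0 hk; have dz : 0 < dist_halfline (a +i* y) by exact: dist_halfline_upper.
have w0 u : 0 <= u -> 0 <= ('X : {poly R}).[u] by rewrite hornerX.
have := @mass_resolvent_le _ _ _ mu spec sa px a y 'X I k y0 w0 mI k0.
move=> h; rewrite (Im_stieltjes_h posX sde t0' dz)/= [y * _]mulrC mulfK ?gt_eqF//.
apply: le_trans (h _) _ => [u Iu u0|]; first by rewrite hornerX hk.
by rewrite -['X]expr1 poly_evalX expr1.
Qed.

(** The point [z] is taken above the midpoint, at height [y] equal to half the length. On the
    interval [|u - z|^2 <= 2 y^2] and [u >= p], while [Im h <= pi / t]. *)
Lemma mass_interval_le p q : 0 < p -> p < q ->
  mass `[p, q] <= pi / t / p * (q - p).
Proof.
move=> p0 pq; pose a := (p + q) / 2; pose y := (q - p) / 2.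
have y0 : 0 < y by rewrite /y divr_gt0// subr_gt0.
have ye : q - p = 2 * y by rewrite /y; lra.
have y2 : 0 < 2 * y ^+ 2 by rewrite mulr_gt0// exprn_gt0.
have [_ /ltW hI _ _] := characteristic_backward bm posX sde (z := a +i* y) t0' y0.
have h : p / (2 * y ^+ 2) * mass `[p, q] <= complex.Im (stieltjes_h X t (a +i* y)) / y.
  apply: mass_stieltjes_le => //; first by rewrite divr_ge0 ?(ltW p0) ?(ltW y2).
  move=> u /=; rewrite in_itv/= => /andP[pu uq] u0.
  rewrite mulrAC ler_pdivrMr//; apply: (@le_trans _ _ (p * (2 * y ^+ 2))).
    by rewrite ler_wpM2l ?(ltW p0)// /a /y; nra.
  by rewrite ler_wpM2r ?(ltW y2).
move: h; rewrite mulrAC ler_pdivrMr// => h.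
have {}h : p * mass `[p, q] <= 2 * y * complex.Im (stieltjes_h X t (a +i* y)).
  by apply: le_trans h _; rewrite le_eqVlt; apply/orP; left; apply/eqP; field; rewrite gt_eqF.
have It : complex.Im (stieltjes_h X t (a +i* y)) <= pi / t by rewrite ler_pdivlMr.
have {}It := ler_wpM2l (ltW (mulr_gt0 (@ltr0Sn R 1) y0)) It.
rewrite ye mulrAC ler_pdivlMr// mulrC (le_trans h)// (le_trans It)//.
by rewrite mulrC.
Qed.

(** At [z = i y] an atom of mass [m] forces [|g| >= m / y], so [z + g^-1] is [O(y)]. But
    [|z g| <= 1] keeps the exponential above [L] in modulus. *)
Lemma mass_zero : mu [set 0] = 0.
Proof.
have m0 : measurable ([set 0] : set (measurableTypeR R)) by exact: measurable_set1.
apply: mass_eq0 => //; rewrite leNgt; apply/negP; set m := mass _ => mp.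
pose L := expR (- ((`|alpha| + 1) * t)).
have key y : 0 < y -> L <= y * (1 + m^-1).
  move=> y0; pose z : R[i] := 0 +i* y; pose g := Ex ((X t - z%:A)^-1).
  have dz : 0 < dist_halfline z by exact: dist_halfline_upper.
  have iz : complex.Im z != 0 by rewrite gt_eqF.
  have y2 : 0 < y ^+ 2 by rewrite exprn_gt0.
  have h : y^-1 ^+ 2 * m <= complex.Im g / y.
    have := @mass_resolvent_le _ _ _ mu spec sa px 0 y 1 [set 0] (y^-1 ^+ 2) y0.
    rewrite (Im_stieltjes posX sde t0' dz)/= [y * _]mulrC mulfK ?gt_eqF//.
    rewrite poly_eval1 mul1r; apply=> //.
    - by move=> u _; rewrite hornerC.
    - by rewrite sqr_ge0.
    - by move=> u /= -> _; rewrite hornerC subr0 expr0n add0r -exprMn mulVf ?expr1n ?gt_eqF.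
  have mg : m / y <= cmod g.
    apply: le_trans (le_trans (ler_norm _) (Im_le_cmod g)).
    move: h; rewrite ler_pdivlMr// => h; apply: le_trans h.
    by rewrite le_eqVlt; apply/orP; left; apply/eqP; field; rewrite gt_eqF.
  have g0 : 0 < cmod g by apply: lt_le_trans mg; rewrite divr_gt0.
  have zg : cmod (z * g) <= 1.
    have zy : cmod z = y.
      by apply: (@pexpIrn _ 2); rewrite ?nnegrE ?cmod_ge0 ?(ltW y0)// sqr_cmod /=; ring.
    rewrite cmodM zy; have : cmod g <= y^-1.
      apply: le_trans (Ex_le _) (le_trans (opnorm_resolvent sa px dz) _).
      by rewrite lef_pV2 ?posrE// /dist_halfline le_max /= ler_norm.
    by move=> h2; apply: le_trans (ler_wpM2l (ltW y0) h2) _; rewrite mulfV ?gt_eqF.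
  have := functional_equation bm posX sde X0 t0' iz; rewrite -/g => /(congr1 (@cmod R)).
  rewrite cmod_cexp => e.
  have up : cmod (z + g^-1) <= y * (1 + m^-1).
    apply: le_trans (cmodD _ _) _; rewrite mulrDr mulr1 cmodV.
    have -> : cmod z = y.
      by apply: (@pexpIrn _ 2); rewrite ?nnegrE ?cmod_ge0 ?(ltW y0)// sqr_cmod /=; ring.
    rewrite lerD2l -[leRHS]invrK lef_pV2 ?posrE ?invr_gt0 ?mulr_gt0 ?invr_gt0//.
    by rewrite invfM invrK mulrC.
  apply: le_trans up; rewrite e ler_expR.
  have := le_trans (Re_le_cmod _) zg; rewrite ler_norml => /andP[_ h2].
  have := ler_norm (- alpha); rewrite normrN => h3.
  have -> : complex.Re ((alpha%:C - z * g) * t%:C) = (alpha - complex.Re (z * g)) * t.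
    by move: (z * g) => [u v] /=; ring.
  by rewrite -mulNr ler_pM2r//; lra.
have L0 : 0 < L by exact: expR_gt0.
have c0 : 0 < 1 + m^-1 by rewrite addr_gt0// invr_gt0.
(* At this height the upper bound is [L / 2]. *)
have := key (L / (1 + m^-1) / 2).
rewrite mulrAC divfK ?gt_eqF// !divr_gt0// => /(_ isT).
lra.
Qed.

End SpectralEstimates.
(** * Edges of the support *)

Section Edges.
Variable R : realType.
Implicit Types (a b h s t x y d e theta : R).

Lemma norm_sin_le x : `|sin x| <= `|x|.
Proof.
have pos y : 0 <= y -> `|sin y| <= `|y|.
  move=> y0; have [|c _] := @MVT_segment R sin cos 0 y y0 (fun c _ => is_derive_sin c).
    by apply: continuous_subspaceT => c; exact: continuous_sin.
  rewrite sin0 !subr0 => ->; rewrite normrM ler_piMl// ler_norml cos_geN1.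
  exact: cos_le1.
have [|x0] := leP 0 x; first exact: pos.
by rewrite -(normrN x) -(normrN (sin x)) -sinN pos// oppr_ge0 ltW.
Qed.

Lemma cos_ge_sqr x : 1 - x ^+ 2 / 2 <= cos x.
Proof.
have h : sin (x / 2) ^+ 2 <= (x / 2) ^+ 2.
  by rewrite -[leLHS]real_normK ?num_real// -[leRHS]real_normK ?num_real// lerXn2r ?nnegrE// norm_sin_le.
set y := x / 2 in h *; have -> : x = y *+ 2 by rewrite mulr2n /y; lra.
clearbody y; rewrite cos_mulr2n; rewrite sin2cos2 in h.
by move: (cos y ^+ 2) h => c h; rewrite (mulr2n y) (mulr2n c); lra.
Qed.

(** [D] is [|1 + eta|^2] and [N + i d] is [eta] times the conjugate of [1 + eta]; the exponential
    then rotates by the angle [- d * s]. *)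
Lemma characteristic_edge theta h d s (D := (1 + h) ^+ 2 + d ^+ 2)
    (N := h * (1 + h) + d ^+ 2) (eta := h +i* d) : 1 + h != 0 ->
  characteristic theta (eta / (1 + eta)) eta s =
  (expR ((theta - 1 - h) * s) / D)%:C *
  ((N * cos (d * s) + d * sin (d * s)) +i* (d * cos (d * s) - N * sin (d * s))).
Proof.
move=> h1.
have D0 : D != 0 by rewrite gt_eqF// ltr_pwDl ?sqr_ge0// exprn_even_gt0.
have e0 : 1 + eta != 0.
  by apply: contraNneq h1 => /(congr1 (@complex.Re R))/= ->.
have -> : eta / (1 + eta) = D^-1%:C * (N +i* d).
  apply: (mulIf e0); rewrite divfK//.
  by rewrite /eta; apply: complex_eqP => /=; rewrite /N /D in D0 *; field.
rewrite /characteristic.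
have -> : cexp (((theta - 1)%:C - eta) * s%:C) =
    (expR ((theta - 1 - h) * s))%:C * (cos (d * s) +i* - sin (d * s)).
  have e : ((theta - 1)%:C - eta) * s%:C = ((theta - 1 - h) * s) +i* (- (d * s)).
    by rewrite /eta; apply: complex_eqP => /=; ring.
  by rewrite e /cexp /= cosN sinN; apply: complex_eqP => /=; ring.
by rewrite /eta; clearbody D N; apply: complex_eqP => /=; field.
Qed.

(** The end point at time [t] of the characteristic with real constant [h]. Its logarithmic
    derivative in [h] is [1 / (h (1 + h)) - t], so [r1] and [r2] are its critical points. *)
Definition edge_map theta t h := h / (1 + h) * expR ((theta - 1 - h) * t).

Lemma edge_map_gt0 theta t h : 0 < h * (1 + h) -> 0 < edge_map theta t h.
Proof.
move=> hp; have h1 : 1 + h != 0 by apply: contraTneq hp => ->; rewrite mulr0 ltxx.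
rewrite /edge_map mulr_gt0 ?expR_gt0//.
have -> : h / (1 + h) = h * (1 + h) / (1 + h) ^+ 2 by field.
by rewrite divr_gt0// exprn_even_gt0.
Qed.

(* Along [eta = h + i d] the characteristic ends at a point whose distance to
   [edge_map t h] is of order [d] while its height is bounded below by a
   multiple of [d]; the condition [h (1 + h) t < 1] says that
   [edge_map t] is not critical at [h]. *)
Lemma characteristic_edge_bounds theta t h : 0 < t -> 0 < h * (1 + h) ->
  h * (1 + h) * t < 1 ->
  exists c K d0, [/\ 0 < c, 0 < K, 0 < d0 & forall d, 0 < d -> d < d0 ->
    let eta := h +i* d in let z0 := eta / (1 + eta) in
    (forall s, 0 <= s <= t -> 0 < complex.Im (characteristic theta z0 eta s)) /\
    let z := characteristic theta z0 eta t in
    [/\ c * d <= complex.Im z, complex.Im z <= K * d &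
        `|complex.Re z - edge_map theta t h| <= K * d]].
Proof.
move=> t0 n0 nt; set n := h * (1 + h) in n0 nt.
have h1 : 1 + h != 0 by apply: contraTneq n0 => e; rewrite /n e mulr0 ltxx.
pose q := (1 + h) ^+ 2; have q0 : 0 < q by rewrite exprn_even_gt0.
pose E := expR ((theta - 1 - h) * t); have E0 : 0 < E by exact: expR_gt0.
(* The height is a positive multiple of [d cos (d s) - N sin (d s)], about [d * (1 - n * s)] for
   small [d]; [c1] is its slope at the worst time [s = t]. *)
pose c1 := 1 - n * t; have c10 : 0 < c1 by rewrite /c1; lra.
(* The corrections of higher order amount to [d ^+ 2 * T] in that slope: [t] from the [d ^+ 2] in
   [N], [t ^+ 2 / 2] from the cosine. For [d * T < c1 / 2] half of the slope is left. *)
pose T := t + t ^+ 2 / 2.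
have t2 : 0 < t ^+ 2 by rewrite exprn_gt0.
have T0 : 0 < T by rewrite /T addr_gt0// divr_gt0.
(* The two summands of [K] bound the height and the horizontal displacement. *)
exists (E * c1 / (2 * (q + 1))), (E * 2 / q + E * (q * (1 + 3 / 2 * t) + n) / q ^+ 2).
exists (Num.min 1 (c1 / 2 / T)).
have q1 : 0 < q + 1 by rewrite addr_gt0.
have L0 : 0 < q * (1 + 3 / 2 * t) + n.
  by rewrite addr_gt0// mulr_gt0// addr_gt0// mulr_gt0// divr_gt0.
have K1 : 0 < E * 2 / q by rewrite divr_gt0// mulr_gt0.
have K2 : 0 < E * (q * (1 + 3 / 2 * t) + n) / q ^+ 2 by apply: divr_gt0; [exact: mulr_gt0|exact: exprn_gt0].
split.
- by rewrite divr_gt0 ?mulr_gt0.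
- by rewrite addr_gt0.
- by rewrite lt_min ltr01 !divr_gt0.
move=> d d0; rewrite lt_min => /andP[d1]; rewrite ltr_pdivlMr// => dT.
have d2 : d ^+ 2 <= d by rewrite expr2 ler_piMl// ltW.
have d2' : 0 < d ^+ 2 by rewrite exprn_gt0.
set D := q + d ^+ 2; set N := n + d ^+ 2.
have D0 : 0 < D by rewrite /D addr_gt0.
have N0 : 0 < N by rewrite /N addr_gt0.
have Nt : N * t + d ^+ 2 * (t ^+ 2 / 2) <= 1 - c1 / 2.
  have : d ^+ 2 * T <= c1 / 2.
    by apply: le_trans (ltW dT); rewrite ler_pM2r.
  by rewrite /T /N /c1; nra.
have low s : 0 <= s <= t -> d * (c1 / 2) <= d * cos (d * s) - N * sin (d * s).
  move=> /andP[s0 st].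
  have ds0 : 0 <= d * s by rewrite mulr_ge0// ltW.
  have hs : sin (d * s) <= d * s.
    by apply: le_trans (ler_norm _) (le_trans (norm_sin_le _) _); rewrite ger0_norm.
  have hc := cos_ge_sqr (d * s).
  have hs' : N * sin (d * s) <= d * (N * t).
    apply: (@le_trans _ _ (N * (d * s))); first by rewrite ler_pM2l.
    by rewrite mulrCA ler_pM2l// ler_pM2l.
  have hc' : d * (1 - d ^+ 2 * (t ^+ 2 / 2)) <= d * cos (d * s).
    rewrite ler_pM2l//; apply: le_trans hc; rewrite lerD2l lerN2 exprMn -mulrA ler_pM2l//.
    by rewrite ler_pM2r// lerXn2r ?nnegrE// ltW.
  apply: (@le_trans _ _ (d * (1 - d ^+ 2 * (t ^+ 2 / 2)) - d * (N * t))).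
    by rewrite -mulrBr ler_pM2l//; lra.
  by rewrite lerB.
have up : d * cos (d * t) - N * sin (d * t) <= 2 * d.
  have h3 : `|N * sin (d * t)| <= d.
    rewrite normrM (gtr0_norm N0); apply: (@le_trans _ _ (N * (d * t))).
      by rewrite ler_pM2l// (le_trans (norm_sin_le _))// ger0_norm// mulr_ge0// ltW.
    by rewrite mulrCA ler_piMr ?(ltW d0)//; nra.
  have h4 : d * cos (d * t) <= d by rewrite ler_piMr ?cos_le1 ?(ltW d0).
  by move: h3; rewrite ler_norml => /andP[h3 _]; lra.
move=> eta z0; rewrite /z0 /eta.
have chE s := characteristic_edge theta d s h1.
split=> [s st|].
  rewrite chE -/q -/n -/D -/N /= mul0r addr0 mulr_gt0 ?divr_gt0 ?expR_gt0//.
  by apply: lt_le_trans (low _ st); rewrite mulr_gt0// divr_gt0.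
rewrite chE -/q -/n -/D -/N -/E /= !mul0r subr0 addr0.
have DV : D^-1 <= q^-1 by rewrite lef_pV2 ?posrE// /D lerDl ltW.
have DV' : (q + 1)^-1 <= D^-1 by rewrite lef_pV2 ?posrE// /D lerD2l (le_trans d2)// ltW.
have tt : 0 <= t <= t by rewrite lexx ltW.
have pos : 0 <= d * cos (d * t) - N * sin (d * t).
  by apply: le_trans (low _ tt); rewrite mulr_ge0 ?divr_ge0 ?(ltW c10) ?(ltW d0).
split.
- rewrite [leLHS](_ : _ = E / (q + 1) * (d * (c1 / 2))); last by field; rewrite gt_eqF.
  by rewrite ler_pM ?low// ?mulr_ge0 ?invr_ge0 ?(ltW E0) ?(ltW q1) ?(ltW d0) ?divr_ge0 ?(ltW c10)// ler_pM2l.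
- apply: (@le_trans _ _ (E * 2 / q * d)); last by rewrite ler_pM2r// lerDl ltW.
  rewrite [leRHS](_ : _ = E / q * (2 * d)); last by field; rewrite gt_eqF.
  by rewrite ler_pM// ?mulr_ge0 ?invr_ge0 ?(ltW E0) ?(ltW D0)// ler_pM2l.
have -> : edge_map theta t h = E * (n / q) by rewrite /edge_map -/E /n /q; field.
set c := cos _; set s := sin _.
have -> : E / D * (N * c + d * s) - E * (n / q) =
    E / (D * q) * (q * (n * (c - 1) + d ^+ 2 * c + d * s) - n * d ^+ 2).
  by rewrite /D /N; field; rewrite !gt_eqF.
have hs : `|d * s| <= d ^+ 2 * t.
  rewrite normrM (gtr0_norm d0) expr2 -mulrA ler_pM2l// (le_trans (norm_sin_le _))//.
  by rewrite ger0_norm// mulr_ge0// ltW.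
have hc : 0 <= n * (1 - c) <= d ^+ 2 * (t / 2).
  have h5 : 1 - c <= d ^+ 2 * (t ^+ 2 / 2).
    by have := cos_ge_sqr (d * t); rewrite -/c exprMn; lra.
  rewrite mulr_ge0 ?subr_ge0 ?cos_le1 ?(ltW n0)//=.
  apply: (@le_trans _ _ (n * (d ^+ 2 * (t ^+ 2 / 2)))); first by rewrite ler_pM2l.
  by rewrite mulrCA ler_pM2l//; nra.
have hd : `|d ^+ 2 * c| <= d ^+ 2.
  by rewrite normrM (gtr0_norm d2') ler_piMr ?(ltW d2')// ler_norml cos_geN1 cos_le1.
have num : `|q * (n * (c - 1) + d ^+ 2 * c + d * s) - n * d ^+ 2| <=
    (q * (1 + 3 / 2 * t) + n) * d.
  apply: (@le_trans _ _ ((q * (1 + 3 / 2 * t) + n) * d ^+ 2)); last by rewrite ler_pM2l.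
  have h6 : `|n * (c - 1) + d ^+ 2 * c + d * s| <= d ^+ 2 * (1 + 3 / 2 * t).
    move: hs hd; rewrite !ler_norml => /andP[? ?] /andP[? ?]; move/andP: hc => [? ?].
    by apply/andP; split; nra.
  apply: le_trans (ler_normB _ _) _; rewrite mulrDl lerD//; last by rewrite (gtr0_norm (mulr_gt0 n0 d2')).
  by rewrite normrM (gtr0_norm q0) -mulrA ler_pM2l// [leRHS]mulrC.
rewrite normrM gtr0_norm; last by rewrite divr_gt0// mulr_gt0.
apply: (@le_trans _ _ (E * (q * (1 + 3 / 2 * t) + n) / q ^+ 2 * d)); last by rewrite ler_pM2r// lerDr ltW.
rewrite [leRHS](_ : _ = E / q ^+ 2 * ((q * (1 + 3 / 2 * t) + n) * d)); last by ring.
apply: ler_pM => //; first by rewrite ltW// divr_gt0// mulr_gt0.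
rewrite ler_pM2l// lef_pV2 ?posrE; [|exact: mulr_gt0|exact: exprn_gt0].
by rewrite expr2 ler_pM2r// /D lerDl ltW.
Qed.

End Edges.

(** * Values of the edge map outside the claimed interval *)

Section EdgeValues.
Variable R : realType.
Implicit Types (h r t x theta : R).

Lemma edge_map_continuous theta t h : 1 + h != 0 -> {for h, continuous (edge_map theta t)}.
Proof.
move=> h1; apply: continuousM.
  apply: continuousM; first exact: cvg_id.
  by apply: continuousV => //; apply: continuousD; [exact: cvg_cst|exact: cvg_id].
apply: continuous_comp; last exact: continuous_expR.
apply: continuousM; last exact: cvg_cst.
by apply: continuousB; [exact: cvg_cst|exact: cvg_id].
Qed.

Lemma edge_map_IVT theta t h r x : h <= r -> (forall y, h <= y <= r -> 1 + y != 0) ->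
  Num.min (edge_map theta t h) (edge_map theta t r) <= x <=
  Num.max (edge_map theta t h) (edge_map theta t r) ->
  exists2 y, h <= y <= r & edge_map theta t y = x.
Proof.
move=> hr nz hx; have [|y] := IVT hr _ hx; last first.
  by rewrite in_itv/= => hy e; exists y.
apply: continuous_in_subspaceT => y; rewrite inE/= in_itv/= => hy.
exact/edge_map_continuous/nz.
Qed.

(** The intermediate value theorem on [[0, r]], as the map vanishes at [0]. *)
Lemma edge_map_below theta t r x : 0 < t -> 0 < r -> r * (1 + r) * t = 1 ->
  0 < x < edge_map theta t r ->
  exists h, [/\ 0 < h * (1 + h), h * (1 + h) * t < 1 & edge_map theta t h = x].
Proof.
move=> t0 r0 rt /andP[x0 xr].
have e0 : edge_map theta t 0 = 0 by rewrite /edge_map !mul0r.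
have [y /andP[y0 _]||h /andP[h0 hr] hE] := @edge_map_IVT theta t 0 r x (ltW r0).
- by rewrite gt_eqF// ltr_wpDr.
- by rewrite e0 ge_min (ltW x0)/= le_max (ltW xr) orbT.
have hp : 0 < h by rewrite lt_neqAle h0 andbT eq_sym; apply: contraTneq x0 => e; rewrite -hE e e0 ltxx.
have hr' : h < r by rewrite lt_neqAle hr andbT; apply: contraTneq xr => e; rewrite -hE e ltxx.
exists h; split=> //; first by rewrite mulr_gt0// addr_gt0.
by rewrite -rt ltr_pM2r//; nra.
Qed.

Lemma edge_map_above theta t r x : 0 < t -> r < - 1 -> r * (1 + r) * t = 1 ->
  edge_map theta t r < x ->
  exists h, [/\ 0 < h * (1 + h), h * (1 + h) * t < 1 & edge_map theta t h = x].
Proof.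
move=> t0 r1 rt xr.
have x0 : 0 < x by apply: lt_trans xr; apply: edge_map_gt0; nra.
pose L := expR (theta * t); have L0 : 0 < L := expR_gt0 _.
(* The map has a pole at [-1]: its value at [-1 - d] is at least [L / d], hence at least [x], while
   [-1 - d] stays to the right of [r]. *)
pose d := Num.min (- 1 - r) (L / x).
have d0 : 0 < d by rewrite lt_min subr_gt0 r1 divr_gt0.
have d1 : d <= - 1 - r by rewrite ge_min lexx.
have dL : d <= L / x by rewrite ge_min lexx orbT.
have big : x <= edge_map theta t (- 1 - d).
  have -> : edge_map theta t (- 1 - d) = (1 + d) / d * expR ((theta + d) * t).
    rewrite /edge_map; congr (_ * expR (_ * _)); last by ring.
    by field; rewrite gt_eqF// -[_ + _]opprK oppr_eq0 gt_eqF//; lra.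
  apply: (@le_trans _ _ (1 / d * L)).
    by rewrite mul1r mulrC ler_pdivlMr// mulrC -ler_pdivlMr.
  apply: ler_pM; rewrite ?divr_ge0 ?(ltW L0) ?(ltW d0)//.
    by rewrite ler_pM2r ?invr_gt0// lerDl ltW.
  by rewrite ler_expR ler_pM2r// lerDl ltW.
have [|y /andP[_ y1]||h /andP[h0 hr] hE] := @edge_map_IVT theta t r (- 1 - d) x.
- by lra.
- by rewrite lt_eqF//; lra.
- by rewrite ge_min (ltW xr)/= le_max big orbT.
have hr' : r < h by rewrite lt_neqAle h0 andbT; apply: contraTneq xr => ->; rewrite hE ltxx.
exists h; split=> //; first by nra.
by rewrite -rt ltr_pM2r//; nra.
Qed.

End EdgeValues.

(** * Null sets and densities of probability measures on the line *)

Section NullSets.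
Variables (R : realType) (mu : probability (measurableTypeR R) R).
Implicit Types (I J N : set (measurableTypeR R)) (a b p q e d u v : R).
Local Notation mass := (mass mu).

(** Quadratic bounds make the mass of a short interval at most [e] times its length for any given
    [e]; chaining extends this to compact subintervals. *)
Lemma quadratic_mass_null a b :
  (forall x, a < x < b -> exists C d, 0 < d /\
     forall e, 0 < e -> e < d -> mass `[x - e, x + e] <= C * e ^+ 2) ->
  mu `]a, b[%classic = 0.
Proof.
move=> hyp.
have mi u v : measurable (`]u, v] : set (measurableTypeR R)) by [].
have inner p q : a < p -> q < b -> mu `]p, q]%classic = 0.
  move=> ap qb; have [pq|qp] := leP p q; last by rewrite set_itv_ge ?measure0// -leNgt ltW.
  apply: mass_eq0 => //.
  have key e : 0 < e -> mass `]p, q] <= e * (q - p).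
    move=> e0; apply: (@cousin_chain _ (fun u v => mass `]u, v] <= e * (v - u))) => //.
      move=> u v w uv vw h1 h2.
      have -> : `]u, w]%classic = `]u, v]%classic `|` `]v, w]%classic :> set R.
        by rewrite (@itv_bndbnd_setU _ _ _ (BRight v))// bnd_simp.
      by apply: le_trans (massU_le _ _ _) _ => //; lra.
    move=> s /andP[ps sq]; have [|C [d [d0 hC]]] := hyp s.
      by rewrite (lt_le_trans ap ps) (le_lt_trans sq qb).
    have C1 : 0 < `|C| + 1 by rewrite ltr_wpDl.
    pose m := Num.min (d / 2) (e / (`|C| + 1) / 2).
    have m1 : m <= d / 2 by rewrite ge_min lexx.
    have m2 : m <= e / (`|C| + 1) / 2 by rewrite ge_min lexx orbT.
    exists m; first by rewrite lt_min !divr_gt0.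
    move=> u v _ us sv _ hu hv.
    have [uv|uv] := leP v u.
      have -> : u = v by lra.
      by rewrite set_itv_ge ?bnd_simp ?ltxx// /mass measure0 subrr mulr0.
    pose E := v - u; have E0 : 0 < E by rewrite subr_gt0.
    have Ed : E < d by rewrite /E; lra.
    have Ee : E < e / (`|C| + 1) by rewrite /E; lra.
    apply: le_trans (le_trans (mass_le _ _ _ _) (hC E E0 Ed)) _ => //.
      by move=> y /=; rewrite !in_itv/= => /andP[? ?]; apply/andP; split; rewrite /E; lra.
    move: Ee; rewrite ltr_pdivlMr// => Ee.
    have := ler_norm C; rewrite -/E expr2 => ?.
    rewrite mulrA ler_pM2r//; nra.
  apply/ler_addgt0Pr => e e0; rewrite add0r.
  have l0 : 0 < q - p + 1 by lra.
  apply: le_trans (key (e / (q - p + 1)) (divr_gt0 e0 l0)) _.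
  by rewrite mulrAC ler_pdivrMr//; nra.
pose U : set (measurableTypeR R) := \bigcup_k `]a + k.+1%:R^-1, b - k.+1%:R^-1]%classic.
have mU : measurable U by exact: bigcup_measurable.
have U0 : mu U = 0.
  apply/negligibleP => //; apply: negligible_bigcup => k; apply/negligibleP => //.
  by apply: inner; rewrite ?ltrDl ?gtrBl.
apply: (subset_measure0 _ _ _ U0) => //.
move=> y /=; rewrite in_itv/= => /andP[ay yb].
pose m := Num.min (y - a) (b - y); have m0 : 0 < m by rewrite lt_min !subr_gt0 ay.
exists (Num.truncn m^-1) => //=; rewrite in_itv/=.
have : (Num.truncn m^-1).+1%:R^-1 < m.
  by rewrite -[ltRHS]invrK ltf_pV2 ?posrE ?invr_gt0//; exact: truncnS_gt.
by move: (_.+1%:R^-1) => r; rewrite lt_min => /andP[? ?]; apply/andP; split; lra.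
Qed.

(** Cover [N] by open intervals of total length below [e / (K + 1)] and cut them at [p]. The cut is
    there because the constant of [mass_interval_le] blows up at [0]. *)
Lemma lipschitz_mass_null p K N : 0 <= K ->
  (forall u v, p <= u -> u < v -> mass `[u, v] <= K * (v - u)) ->
  measurable N -> lebesgue_measure N = 0%E -> mu (N `&` `]p, +oo[) = 0.
Proof.
move=> K0 hK mN lN.
have mp : measurable (`]p, +oo[ : set (measurableTypeR R)) by [].
have mNp : measurable (N `&` `]p, +oo[) by exact: measurableI.
apply: mass_eq0 => //; apply/ler_addgt0Pr => e e0; rewrite add0r.
have K1 : 0 < K + 1 by rewrite ltr_wpDl.
have := @outer_measure_open_itv_cover R N.
rewrite [X in X = _ -> _](_ : _ = 0%E)//.
set S := [set _ | _ in _] => hS.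
have [] := @lb_ereal_inf_adherent _ S (e / (K + 1)) (divr_gt0 e0 K1).
  by rewrite -hS.
move=> _ [F [FI FN] <-]; rewrite -hS add0e => Fe.
have mF k : measurable (F k : set (measurableTypeR R)).
  by have [[u v] ->] := FI k.
have le1 : (mu (N `&` `]p, +oo[) <= \sum_(k <oo) mu (F k `&` `]p, +oo[))%E.
  apply: measure_sigma_subadditive => //.
    by move=> k; exact: measurableI.
  by move=> y [/FN[k _ Fy] py]; exists k.
have le2 k : (mu (F k `&` `]p, +oo[) <= K%:E * wlength idfun (F k))%E.
  have [[u v] /= FE] := FI k; rewrite FE wlength_itv/= lte_fin.
  have [vm|mv] := leP v (Num.max p u).
    rewrite [X in mu X](_ : _ = set0) ?measure0.
      by rewrite mule_ge0 ?lee_fin//; case: ifPn => // uv; rewrite -EFinB lee_fin subr_ge0 ltW.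
    rewrite -subset0 => y [/=]; rewrite !in_itv/= andbT => /andP[uy yv] py.
    by move: vm; rewrite leNgt => /negP; apply; rewrite gt_max (lt_trans py yv) (lt_trans uy yv).
  have uv : u < v by apply: le_lt_trans mv; rewrite le_max lexx orbT.
  have sub : `]u, v[%classic `&` `]p, +oo[%classic `<=` `[Num.max p u, v]%classic.
    move=> y [/=]; rewrite !in_itv/= andbT => /andP[uy yv] py.
    by rewrite ge_max (ltW py) (ltW uy) (ltW yv).
  have h : (mu `[Num.max p u, v]%classic <= (K * (v - u))%:E)%E.
    rewrite massE// lee_fin; apply: le_trans (hK _ _ _ mv) _; first by rewrite le_max lexx.
    by rewrite ler_wpM2l// lerD2l lerN2 le_max lexx orbT.
  rewrite uv -EFinB -EFinM; apply: le_trans h.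
  by rewrite le_measure ?inE//; exact: measurableI.
rewrite -lee_fin -massE//; apply: le_trans le1 _.
apply: le_trans (lee_nneseries (fun _ _ _ => measure_ge0 _ _) (fun k _ => le2 k)) _.
rewrite nneseriesZl//.
apply: (@le_trans _ _ (K%:E * (e / (K + 1))%:E)%E).
  by rewrite lee_wpmul2l ?lee_fin// ltW.
by rewrite -EFinM lee_fin mulrCA ler_piMr ?(ltW e0)// ler_pdivrMr// mul1r lerDl.
Qed.

(** The Radon-Nikodym derivative times the indicator of [J], so that it vanishes everywhere off [J]
    and not just almost everywhere. *)
Lemma density_of_null (J : set (measurableTypeR R)) : measurable J -> mu (~` J) = 0 ->
  (forall N, measurable N -> lebesgue_measure N = 0%E -> mu N = 0%E) ->
  exists2 f : R -> R, has_density mu f & forall x, ~ J x -> f x = 0.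
Proof.
move=> mJ muJ ac.
have dom : mu `<< (@lebesgue_measure R).
  by apply/null_content_dominatesP => N mN; exact: ac.
have [f [f0 ffin fi fE]] := @radon_nikodym_sigma_finite _ _ _ (@lebesgue_measure R) mu dom.
exists (fun x => fine (f x) * \1_J x); last first.
  by move=> x nJ; rewrite indicE memNset// mulr0.
have mf : measurable_fun setT (fine \o f).
  by apply: measurableT_comp => //; exact: measurable_int fi.
split.
- by apply: measurable_funM => //; exact: measurable_indic.
- by move=> x; rewrite mulr_ge0 ?fine_ge0.
move=> B mB.
have -> : mu B = mu (B `&` J).
  have mBJ : measurable (B `\` J) by exact: measurableD.
  rewrite (measureDI mu mB mJ).
  rewrite [X in (X + _)%E](_ : _ = 0%E) ?add0e//.
  by apply: (subset_measure0 _ _ _ muJ) => //; exact: measurableC.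
rewrite fE; last exact: measurableI.
rewrite integral_mkcondr; apply: eq_integral => x _.
rewrite /patch indicE; case: ifPn => xJ; first by rewrite mulr1 fineK.
by rewrite mulr0.
Qed.

End NullSets.

(** * The density and its support *)

Section SpectralDensity.
Variables (R : realType) (A : wstarProbSpace R) (W X : R -> A) (theta : R).
Hypothesis bm : free_brownian_motion W.
Hypothesis posX : forall t, 0 <= t -> positive (X t).
Hypothesis sde : free_sde W (fun x => theta%:C *: x) (@psqrt R A) (@psqrt R A) X.
Hypothesis X0 : X 0 = 1.
Variables (t : R) (mu : probability (measurableTypeR R) R).
Hypotheses (t0 : 0 < t) (spec : spectral_distribution (X t) mu).
Implicit Types (I N : set (measurableTypeR R)) (h p r : R).
Local Notation mass := (mass mu).
Let t0' : 0 <= t := ltW t0.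

(** At the end [z] of the characteristic with [d = e] one has [Im h = e] and [Im z >= c * e], so
    [Im h / Im z] is at most [1 / c]. On the interval of radius [e] around [x] the integrand
    [u / |u - z|^2] is at least [x / 2 / (M * e ^+ 2)]. *)
Lemma mass_edge h (x := edge_map theta t h) : 0 < h * (1 + h) -> h * (1 + h) * t < 1 ->
  exists C d, 0 < d /\
    forall e, 0 < e -> e < d -> mass `[x - e, x + e] <= C * e ^+ 2.
Proof.
move=> h0 ht; have x0 : 0 < x by exact: edge_map_gt0.
have [c [K [d0 [c0 K0 d00 hyp]]]] := characteristic_edge_bounds theta t0 h0 ht.
pose M := (1 + K) ^+ 2 + K ^+ 2.
have M0 : 0 < M by rewrite /M ltr_pwDr ?exprn_gt0 ?sqr_ge0.
exists (M * 2 / (c * x)), (Num.min d0 (x / 2)).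
split=> [|e e0]; first by rewrite lt_min d00 divr_gt0.
rewrite lt_min => /andP[ed ex]; have [pos [z1 z2 z3]] := hyp e e0 ed.
have n0 : 1 + (h +i* e) != 0.
  by apply/eqP => /(congr1 (@complex.Im R))/=/eqP; rewrite add0r gt_eqF.
have hz := characteristic_forward bm posX sde X0 t0' n0 pos.
set z := characteristic _ _ _ _ in z1 z2 z3 hz.
rewrite -/x in z3; clearbody z x.
have y0 : 0 < complex.Im z by apply: lt_le_trans z1; rewrite mulr_gt0.
have e2 : 0 < e ^+ 2 by rewrite exprn_gt0.
have Me : 0 < M * e ^+ 2 by rewrite mulr_gt0.
have k0 : 0 < x / 2 / (M * e ^+ 2) by rewrite !divr_gt0.
have := @mass_stieltjes_le _ _ _ _ _ posX sde t mu t0 spec (complex.Re z) (complex.Im z)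
  `[x - e, x + e] (x / 2 / (M * e ^+ 2)) y0.
rewrite (_ : complex.Re z +i* complex.Im z = z); last by case: (z).
rewrite hz /= => /(_ _ (ltW k0)) main.
have {}main : x / 2 / (M * e ^+ 2) * mass `[x - e, x + e] <= e / complex.Im z.
  apply: main => // u; rewrite in_itv/= => /andP[u1 u2] u0.
  have hs : (u - complex.Re z) ^+ 2 + complex.Im z ^+ 2 <= M * e ^+ 2.
    rewrite /M mulrDl -!exprMn; apply: lerD; last by rewrite lerXn2r ?nnegrE ?(ltW y0)// mulr_ge0 ?ltW.
    rewrite -[leLHS]real_normK ?num_real// lerXn2r ?nnegrE//; first by rewrite mulr_ge0// ltW// addr_gt0.
    by move: z3; rewrite -/x !ler_norml => /andP[? ?]; apply/andP; split; lra.
  apply: (@le_trans _ _ (x / 2)); last by lra.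
  by rewrite -[leRHS](@mulfVK _ (M * e ^+ 2)) ?gt_eqF// ler_pM2l// -[X in _ <= X]mulr1.
have ey : e / complex.Im z <= c^-1.
  by rewrite ler_pdivrMr// mulrC ler_pdivlMr// mulrC.
have := le_trans main ey.
rewrite -ler_pdivlMl// => /le_trans; apply.
by rewrite le_eqVlt; apply/orP; left; apply/eqP; field; rewrite !gt_eqF.
Qed.

Lemma spectral_abs_continuous N : measurable N -> lebesgue_measure N = 0%E -> mu N = 0.
Proof.
move=> mN lN; have sa := solution_selfadjoint sde t0'.
have supp := spectral_support spec sa (posX t0') (lexx _).
set M := opnorm _ in supp.
have m1 : measurable (~` `[0, M] : set (measurableTypeR R)) by exact: measurableC.
have m2 : measurable ([set 0] : set (measurableTypeR R)) by exact: measurable_set1.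
pose U : set (measurableTypeR R) := \bigcup_k (N `&` `]k.+1%:R^-1, +oo[).
have mU : measurable U by apply: bigcup_measurable => k _; exact: measurableI.
have U0 : mu.-negligible U.
  apply: negligible_bigcup => k; apply/negligibleP; first exact: measurableI.
  have p0 : 0 < k.+1%:R^-1 :> R by [].
  apply: (@lipschitz_mass_null _ mu _ (pi / t / k.+1%:R^-1)) => //.
    by rewrite !divr_ge0 ?pi_ge0 ?ltW.
  move=> u v pu uv; have u0 := lt_le_trans p0 pu.
  apply: le_trans (mass_interval_le bm posX sde t0 spec u0 uv) _.
  rewrite ler_pM2r ?subr_gt0// ler_pM2l ?divr_gt0 ?pi_gt0//.
  by rewrite lef_pV2 ?posrE.
have S0 : mu.-negligible (U `|` ([set 0] `|` ~` `[0, M])).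
  apply: negligibleU => //; apply: negligibleU; apply/negligibleP => //.
  exact: (mass_zero bm posX sde X0 t0 spec).
apply/negligibleP => //; apply: negligibleS S0 => y Ny.
have [y0|y0] := ltP y 0; first by right; right; rewrite /= in_itv/= leNgt y0.
have [->|yn] := eqVneq y 0; first by right; left.
have yp : 0 < y by rewrite lt_def yn.
left; exists (Num.truncn y^-1) => //; split => //=; rewrite in_itv/= andbT.
by rewrite -[ltRHS]invrK ltf_pV2 ?posrE ?invr_gt0//; exact: truncnS_gt.
Qed.

Lemma spectral_density r1 r2 :
  0 < r1 -> r1 * (1 + r1) * t = 1 -> r2 < - 1 -> r2 * (1 + r2) * t = 1 ->
  exists2 f : R -> R, has_density mu f &
    forall x, x \notin `[edge_map theta t r1, edge_map theta t r2] -> f x = 0.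
Proof.
move=> r10 r1t r21 r2t; have sa := solution_selfadjoint sde t0'.
set a := edge_map theta t r1; set b := edge_map theta t r2.
have supp := spectral_support spec sa (posX t0') (lexx _).
set M := opnorm _ in supp.
have mJ : measurable (`[a, b] : set (measurableTypeR R)) by [].
have muJ : mu (~` `[a, b]) = 0.
  have m1 : measurable (~` `[0, M] : set (measurableTypeR R)) by exact: measurableC.
  have m2 : measurable ([set 0] : set (measurableTypeR R)) by exact: measurable_set1.
  have n1 : mu `]0, a[%classic = 0.
    apply: quadratic_mass_null => x xa.
    by have [h [h1 h2 <-]] := edge_map_below t0 r10 r1t xa; exact: mass_edge.
  have n2 : mu `]b, M + 1[%classic = 0.
    apply: quadratic_mass_null => x /andP[xb _].
    by have [h [h1 h2 <-]] := edge_map_above t0 r21 r2t xb; exact: mass_edge.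
  have S0 : mu.-negligible ((`]0, a[ `|` `]b, M + 1[) `|` ([set 0] `|` ~` `[0, M])).
    apply: negligibleU; apply: negligibleU; apply/negligibleP => //.
    exact: (mass_zero bm posX sde X0 t0 spec).
  apply/negligibleP; first exact: measurableC.
  apply: negligibleS S0 => y /= /negP; rewrite in_itv/= negb_and -!ltNge => ab.
  have [yM|My] := boolP (0 <= y <= M); last by right; right; rewrite /= in_itv/=; apply/negP.
  move/andP: yM => [y0 yM].
  have [->|yn] := eqVneq y 0; first by right; left.
  have yp : 0 < y by rewrite lt_def yn.
  left; case/orP: ab => [ya|yb]; [left|right]; rewrite /= in_itv/= ?yp ?ya// yb/=.
  by rewrite ltr_pwDr.
have [f df f0] := density_of_null mJ muJ spectral_abs_continuous.
exists f => // x xJ; apply: f0 => /= h; by rewrite h in xJ.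
Qed.

End SpectralDensity.

(** * The functional equation and the support of the density *)

Theorem proposition3p8 (R : realType) (A : wstarProbSpace R)
    (W : R -> A) (theta : R) (X : R -> A) :
  free_brownian_motion W ->
  (forall t, 0 <= t -> positive (X t)) ->
  free_sde W (fun x => theta%:C *: x) (@psqrt R A) (@psqrt R A) X ->
  X 0 = 1 ->
  let alpha := theta - 1 in
  (forall (t : R) (z : R[i]), 0 <= t -> complex.Im z != 0 ->
     let g : R[i] := Ex ((X t - z%:A)^-1) in
     [/\ X t - z%:A \is a GRing.unit,
         g != 0 &
         z + g^-1 = cexp ((alpha%:C - z * g) * t%:C)]) /\
  (forall t : R, 0 < t ->
     let r1 := (-1 + Num.sqrt (1 + 4 / t)) / 2 in
     let r2 := (-1 - Num.sqrt (1 + 4 / t)) / 2 in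
     forall mu : probability (measurableTypeR R) R,
       spectral_distribution (X t) mu ->
       exists2 f : R -> R, has_density mu f &
         forall x, x \notin `[r1 / (1 + r1) * expR ((alpha - r1) * t),
                              r2 / (1 + r2) * expR ((alpha - r2) * t)] ->
                   f x = 0).
Proof.
move=> bm posX sde X0 alpha; split=> [t z t0 iz g|t t0 r1 r2 mu spec].
  split; last exact: (functional_equation bm posX sde X0).
    exact: (solution_unit posX sde t0 (dist_halfline_nonreal iz)).
  exact: (stieltjes_neq0 posX sde).
pose S := Num.sqrt (1 + 4 / t); have p4 : 0 < 4 / t by rewrite divr_gt0.
have SE : S ^+ 2 = 1 + 4 / t by rewrite sqr_sqrtr// addr_ge0// ltW.
have S1 : 1 < S by rewrite -sqrtr1 ltr_sqrt ?ltrDl// addr_gt0.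
(* Taken at [u = S] and [u = - S], this shows that [r1] and [r2] are the two roots of
   [h * (1 + h) * t = 1]. *)
have root u : u ^+ 2 = S ^+ 2 -> (- 1 + u) / 2 * (1 + (- 1 + u) / 2) * t = 1.
  move=> uS; have -> : (- 1 + u) / 2 * (1 + (- 1 + u) / 2) = (u ^+ 2 - 1) / 4 by field.
  by rewrite uS SE; field; rewrite gt_eqF.
have r10 : 0 < r1 by rewrite /r1 -/S; lra.
have r21 : r2 < - 1 by rewrite /r2 -/S; lra.
apply: (spectral_density bm posX sde X0 t0 spec r10 _ r21).
  exact: root.
by apply: root; rewrite sqrrN.
Qed.
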